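(* Let $A\in\mathbb{R}^{n\times d}$ with $n\ge d$, let $\lambda_1\in[1/2,1]$ be the largest eigenvalue of $A^\top A$, let $\lambda\in(0,\lambda_1)$ be an eigenvalue threshold and $\gamma\in(0,2/3]$ an eigengap parameter. For any $\epsilon\in(0,1)$ (and any failure probability $\delta\in(0,1)$) there is an $\epsilon$-approximate PCR algorithm for $(A,\lambda,\gamma)$ with running time $$\tilde{O}\left(\mathrm{nnz}(A)+\sqrt{\mathrm{nnz}(A)\cdot d\cdot\mathrm{sr}(A)}\;\frac{\kappa}{\gamma}\right).$$
   Context: Notation: $\mathrm{nnz}(A)$ is the number of nonzero entries of $A$; $\mathrm{sr}(A)=\|A\|_F^2/\|A\|_2^2=\|A\|_F^2/\lambda_1$ is the stable rank; $\kappa=\lambda_1/\lambda$. Norms are $\ell_2$ norms. Let $\lambda_1\ge\dots\ge\lambda_d\ge0$ be the eigenvalues of $A^\top A$ with orthonormal eigenvectors $\nu_1,\dots,\nu_d$. For $t>0$, $P_t$ denotes the orthogonal projection onto the span of those $\nu_i$ with $\lambda_i\ge t$. For $b\in\mathbb{R}^n$ and $t>0$ let $x_t^*$ be the minimum-norm element of $\arg\min_{x\in\mathbb{R}^d}\|AP_t x-b\|$. $\epsilon$-approximate PCR (principal component regression) algorithm: a randomized algorithm which, given any $b\in\mathbb{R}^n$, with probability at least $1-\delta$ returns a vector $w\in\mathbb{R}^d$ satisfying both $$\|(I-P_{(1-\gamma)\lambda})w\|\le\epsilon\|b\|\quad\text{and}\quad\|Aw-b\|\le\|Ax^*_{(1+\gamma)\lambda}-b\|+\epsilon\|b\|.$$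 $\tilde O$ hides factors polylogarithmic in the input parameters ($\lambda_1,\lambda,\gamma$, the size of $b$), the error rate $\epsilon$ and the failure probability $\delta$. Running time counts arithmetic operations in exact arithmetic (numerical constants depending only on $\lambda,\gamma,\epsilon$ may be precomputed). *)

(* Defs.v *)
From mathcomp Require Import all_boot all_order all_algebra.
From mathcomp Require Import boolp classical_sets reals exp.

Set Implicit Arguments.
Unset Strict Implicit.
Unset Printing Implicit Defensive.

Import Order.TTheory GRing.Theory Num.Theory.
Local Open Scope ring_scope.

(** ** Linear algebra *)

(* The norm `|_| of the libraries on matrices is the sup norm. *)
Definition l2norm (R : realType) (m : nat) (v : 'cV[R]_m) : R :=
  Num.sqrt (\sum_i v i 0 ^+ 2).

Definition nnz (R : realType) (n d : nat) (A : 'M[R]_(n, d)) : nat :=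
  #|[set ij : 'I_n * 'I_d | A ij.1 ij.2 != 0]|.

Definition stable_rank (R : realType) (n d : nat) (A : 'M[R]_(n, d))
    (lam1 : R) : R :=
  (\sum_i \sum_j A i j ^+ 2) / lam1.

(* lam 0 >= lam 1 >= ... are the eigenvalues of A^T A with multiplicity, and
   nu 0, nu 1, ... is a matching orthonormal eigenbasis. *)
Definition eigensystem (R : realType) (n d : nat) (A : 'M[R]_(n, d))
    (lam : 'I_d -> R) (nu : 'I_d -> 'cV[R]_d) : Prop :=
  [/\ forall i j, (nu i)^T *m nu j = (i == j)%:R%:M,
      forall i, (A^T *m A) *m nu i = lam i *: nu i
    & forall i j : 'I_d, (i <= j)%N -> lam j <= lam i].

(* The projection P_t onto the span of the nu i with t <= lam i; see
   [pcproj_in_span] and [pcproj_orthogonal] below. *)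
Definition pcproj (R : realType) (d : nat) (lam : 'I_d -> R)
    (nu : 'I_d -> 'cV[R]_d) (t : R) : 'M[R]_d :=
  \sum_(i | t <= lam i) nu i *m (nu i)^T.

Definition argmin_lsq (R : realType) (n d : nat) (M : 'M[R]_(n, d))
    (b : 'cV[R]_n) : set 'cV[R]_d :=
  [set x | forall y, l2norm (M *m x - b) <= l2norm (M *m y - b)].

(* The minimum-norm least-squares solution always exists and is unique, so the
   default value 0 of xget is never used. *)
Definition xstar (R : realType) (n d : nat) (A : 'M[R]_(n, d))
    (lam : 'I_d -> R) (nu : 'I_d -> 'cV[R]_d) (b : 'cV[R]_n) (t : R) :
    'cV[R]_d :=
  xget 0 [set x | argmin_lsq (A *m pcproj lam nu t) b x /\
    forall y, argmin_lsq (A *m pcproj lam nu t) b y -> l2norm x <= l2norm y].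

Definition pcr_success (R : realType) (n d : nat) (A : 'M[R]_(n, d))
    (lam : 'I_d -> R) (nu : 'I_d -> 'cV[R]_d) (lambda gamma eps : R)
    (b : 'cV[R]_n) (w : 'cV[R]_d) : Prop :=
  l2norm ((1%:M - pcproj lam nu ((1 - gamma) * lambda)) *m w)
    <= eps * l2norm b
  /\
  l2norm (A *m w - b)
    <= l2norm (A *m xstar A lam nu b ((1 + gamma) * lambda) - b)
       + eps * l2norm b.

(** ** Randomized real RAM *)

(* Programs are finite pieces of code, the same for inputs of all sizes.
   Memory consists of arrays of naturals (used for indices and counters) and
   arrays of reals, both families indexed by nat; scalars are cells number 0.
   There is no integer multiplication and no conversion from reals to integers,
   so that the unit-cost measure cannot be abused to compute with huge integers.
   The only source of randomness is a coin whose bias is a computed real. *)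

Inductive nexp : Type :=
| NConst of nat
| NRead of nat & nexp
| NAdd of nexp & nexp
| NSub of nexp & nexp
| NHalf of nexp.

Inductive rexp : Type :=
| ROfNat of nexp
| RRead of nat & nexp
| RAdd of rexp & rexp
| RSub of rexp & rexp
| RMul of rexp & rexp
| RDiv of rexp & rexp.

Inductive test : Type :=
| NLe of nexp & nexp
| RLe of rexp & rexp.

Inductive cmd : Type :=
| Skip
| NStore of nat & nexp & nexp
| RStore of nat & nexp & rexp
| Seq of cmd & cmd
| If of test & cmd & cmd
| While of test & cmd
| Flip of rexp & cmd & cmd.

Record state (R : realType) : Type := State {
  nmem : nat -> nat -> nat;
  rmem : nat -> nat -> R
}.

Definition upd (X : Type) (m : nat -> nat -> X) (a i : nat) (x : X) :
    nat -> nat -> X :=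
  fun a' i' => if (a' == a) && (i' == i) then x else m a' i'.

Fixpoint neval (R : realType) (s : state R) (e : nexp) : nat :=
  match e with
  | NConst k => k
  | NRead a e1 => nmem s a (neval s e1)
  | NAdd e1 e2 => (neval s e1 + neval s e2)%N
  | NSub e1 e2 => (neval s e1 - neval s e2)%N
  | NHalf e1 => (neval s e1)./2
  end.

Fixpoint reval (R : realType) (s : state R) (e : rexp) : R :=
  match e with
  | ROfNat e1 => (neval s e1)%:R
  | RRead a e1 => rmem s a (neval s e1)
  | RAdd e1 e2 => reval s e1 + reval s e2
  | RSub e1 e2 => reval s e1 - reval s e2
  | RMul e1 e2 => reval s e1 * reval s e2
  | RDiv e1 e2 => reval s e1 / reval s e2
  end.

Definition teval (R : realType) (s : state R) (g : test) : bool :=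
  match g with
  | NLe e1 e2 => (neval s e1 <= neval s e2)%N
  | RLe e1 e2 => reval s e1 <= reval s e2
  end.

(* Every node of an expression costs one unit of time, memory accesses and
   index computations included. *)

Fixpoint ncost (e : nexp) : nat :=
  match e with
  | NConst _ => 1
  | NRead _ e1 | NHalf e1 => (ncost e1).+1
  | NAdd e1 e2 | NSub e1 e2 => (ncost e1 + ncost e2).+1
  end.

Fixpoint rcost (e : rexp) : nat :=
  match e with
  | ROfNat e1 | RRead _ e1 => (ncost e1).+1
  | RAdd e1 e2 | RSub e1 e2 | RMul e1 e2 | RDiv e1 e2 =>
      (rcost e1 + rcost e2).+1
  end.

Definition tcost (g : test) : nat :=
  match g with
  | NLe e1 e2 => (ncost e1 + ncost e2).+1
  | RLe e1 e2 => (rcost e1 + rcost e2).+1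
  end.

(* Finitely supported distributions, as lists of weighted outcomes. *)
Definition fdist (R : realType) (X : Type) : Type := seq (R * X).

Definition dret (R : realType) (X : Type) (x : X) : fdist R X := [:: (1, x)].

Definition dbind (R : realType) (X Y : Type) (m : fdist R X)
    (f : X -> fdist R Y) : fdist R Y :=
  flatten [seq [seq (p.1 * q.1, q.2) | q <- f p.2] | p <- m].

Definition dmix (R : realType) (X : Type) (p : R) (m1 m2 : fdist R X) :
    fdist R X :=
  [seq (p * o.1, o.2) | o <- m1] ++ [seq ((1 - p) * o.1, o.2) | o <- m2].

Definition dprob (R : realType) (X : Type) (m : fdist R X) (E : set X) : R :=
  \sum_(o <- m | `[< E o.2 >]) o.1.

(* A memory state together with the time elapsed so far. *)
Definition config (R : realType) : Type := (state R * nat)%type.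

Definition tick (R : realType) (k : nat) (c : config R) : config R :=
  (c.1, (c.2 + k)%N).

(* None stands for a run that was cut off by lack of fuel. *)
Definition outcome (R : realType) : Type := option (config R).

Definition run_then (R : realType) (m : fdist R (outcome R))
    (f : config R -> fdist R (outcome R)) : fdist R (outcome R) :=
  dbind m (fun o => if o is Some c then f c else dret R None).

Definition clamp01 (R : realType) (x : R) : R := Num.max 0 (Num.min x 1).

Fixpoint loop (R : realType) (fuel : nat) (g : test)
    (body : config R -> fdist R (outcome R)) (c : config R) :
    fdist R (outcome R) :=
  if fuel is fuel'.+1 then
    let c' := tick (tcost g) c in
    if teval c.1 g then run_then (body c') (loop fuel' g body)
    else dret R (Some c')
  else dret R None.

(* The fuel bounds the number of iterations of each entered loop; as the test
   of a loop takes positive time, fuel T.+1 never cuts off a run of time T. *)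
Fixpoint exec (R : realType) (fuel : nat) (p : cmd) (c : config R) :
    fdist R (outcome R) :=
  let s := c.1 in
  match p with
  | Skip => dret R (Some c)
  | NStore a i e =>
      dret R (Some (tick (ncost i + ncost e).+1
        (State (upd (nmem s) a (neval s i) (neval s e)) (rmem s), c.2)))
  | RStore a i e =>
      dret R (Some (tick (ncost i + rcost e).+1
        (State (nmem s) (upd (rmem s) a (neval s i) (reval s e)), c.2)))
  | Seq p1 p2 => run_then (exec fuel p1 c) (exec fuel p2)
  | If g p1 p2 =>
      exec fuel (if teval s g then p1 else p2) (tick (tcost g) c)
  | While g p1 => loop fuel g (exec fuel p1) c
  | Flip e p1 p2 =>
      let c' := tick (rcost e).+1 c in
      dmix (clamp01 (reval s e)) (exec fuel p1 c') (exec fuel p2 c')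
  end.

(* The probability that p, started in state s, halts after at most T time
   units in a state belonging to E. *)
Definition prob_halts (R : realType) (T : nat) (p : cmd) (s : state R)
    (E : set (state R)) : R :=
  dprob (exec T.+1 p (s, 0%N))
    [set o | exists2 c : config R, o = Some c & E c.1 /\ (c.2 <= T)%N].

(** ** Input, output and correctness *)

(* The matrix is passed to the algorithm as the list of its nonzero entries, in
   row-major order. *)
Definition nz_positions (R : realType) (n d : nat) (A : 'M[R]_(n, d)) :
    seq ('I_n * 'I_d) :=
  [seq ij <- [seq (i, j) | i <- enum 'I_n, j <- enum 'I_d]
     | A ij.1 ij.2 != 0].

Definition input_nmem (R : realType) (n d : nat) (A : 'M[R]_(n, d))
    (cst : seq R) : nat -> nat -> nat :=
  fun a => nth 0%N (nth [::]
    [:: [:: n; d; nnz A; size cst];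
        [seq nat_of_ord ij.1 | ij <- nz_positions A];
        [seq nat_of_ord ij.2 | ij <- nz_positions A]] a).

Definition input_rmem (R : realType) (n d : nat) (A : 'M[R]_(n, d))
    (b : 'cV[R]_n) (lambda gamma eps delta : R) (cst : seq R) :
    nat -> nat -> R :=
  fun a => nth 0 (nth [::]
    [:: [:: lambda; gamma; eps; delta];
        [seq A ij.1 ij.2 | ij <- nz_positions A];
        [seq b i 0 | i <- enum 'I_n];
        cst] a).

(* cst is the table of precomputed constants; all cells not holding input are
   initially 0. *)
Definition input_state (R : realType) (n d : nat) (A : 'M[R]_(n, d))
    (b : 'cV[R]_n) (lambda gamma eps delta : R) (cst : seq R) : state R :=
  State (input_nmem A cst) (input_rmem A b lambda gamma eps delta cst).

(* The answer is read from cells 0, ..., d-1 of array 4 of reals, the first one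
   not holding input. *)
Definition output (R : realType) (d : nat) (s : state R) : 'cV[R]_d :=
  \col_j rmem s 4 j.

(* On input b, prog halts in at most T steps almost surely, and with
   probability at least 1 - delta its answer is correct. *)
Definition approx_pcr_in_time (R : realType) (prog : cmd) (cst : seq R)
    (n d : nat) (A : 'M[R]_(n, d)) (lam : 'I_d -> R) (nu : 'I_d -> 'cV[R]_d)
    (lambda gamma eps delta : R) (b : 'cV[R]_n) (T : nat) : Prop :=
  let s := input_state A b lambda gamma eps delta cst in
  prob_halts T prog s setT = 1 /\
  1 - delta <= prob_halts T prog s
    [set s' | pcr_success A lam nu lambda gamma eps b (output d s')].

(** ** Sanity checks *)

Lemma size_nz_positions (R : realType) (n d : nat) (A : 'M[R]_(n, d)) :
  size (nz_positions A) = nnz A.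
Proof.
rewrite /nnz cardsE cardE; apply: perm_size; apply: uniq_perm.
- apply/filter_uniq/allpairs_uniq; rewrite ?enum_uniq //.
  by move=> [a1 a2] [b1 b2] _ _ /=.
- exact: enum_uniq.
move=> [i j]; rewrite mem_filter mem_enum [RHS]unfold_in /=.
have -> : (i, j) \in [seq (x, y) | x <- enum 'I_n, y <- enum 'I_d].
  by apply/allpairsPdep; exists i, j; rewrite !mem_enum.
by rewrite andbT.
Qed.

Lemma pcproj_in_span (R : realType) (d : nat) (lam : 'I_d -> R)
    (nu : 'I_d -> 'cV[R]_d) (t : R) (x : 'cV[R]_d) :
  pcproj lam nu t *m x
    = \sum_(i | t <= lam i) ((nu i)^T *m x) 0 0 *: nu i.
Proof.
rewrite /pcproj mulmx_suml; apply: eq_bigr => i _.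
by rewrite -mulmxA [in LHS](mx11_scalar ((nu i)^T *m x)) mul_mx_scalar.
Qed.

Lemma pcproj_orthogonal (R : realType) (n d : nat) (A : 'M[R]_(n, d))
    (lam : 'I_d -> R) (nu : 'I_d -> 'cV[R]_d) (t : R) (x : 'cV[R]_d)
    (j : 'I_d) :
  eigensystem A lam nu -> t <= lam j ->
  (nu j)^T *m (x - pcproj lam nu t *m x) = 0.
Proof.
move=> [onu _ _] tj; rewrite mulmxBr pcproj_in_span mulmx_sumr (bigD1 j) //=.
rewrite big1 => [|i /andP[_ ij]]; last first.
  by rewrite -scalemxAr onu eq_sym (negPf ij) raddf0 scaler0.
rewrite -scalemxAr onu eqxx addr0 [X in X - _]mx11_scalar.
by rewrite scalemx1 subrr.
Qed.

Lemma dprobT (R : realType) (X : Type) (m : fdist R X) :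
  dprob m setT = \sum_(o <- m) o.1.
Proof. by apply: eq_bigl => o; apply/asboolT. Qed.

Lemma dprob_dbind1 (R : realType) (X Y : Type) (m : fdist R X)
    (f : X -> fdist R Y) :
  dprob m setT = 1 -> (forall x, dprob (f x) setT = 1) ->
  dprob (dbind m f) setT = 1.
Proof.
rewrite !dprobT /dbind => m1 f1; rewrite big_flatten big_map /= -m1.
apply: eq_bigr => p _.
by rewrite big_map /= -mulr_sumr -dprobT f1 mulr1.
Qed.

(* exec computes genuine probability distributions. *)
Lemma exec_total (R : realType) (fuel : nat) (p : cmd) (c : config R) :
  dprob (exec fuel p c) setT = 1.
Proof.
have ret1 X (x : X) : dprob (dret R x) setT = 1.
  by rewrite dprobT big_seq1.
have then1 m f : dprob m setT = 1 -> (forall c, dprob (f c) setT = 1) ->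
    @dprob R (outcome R) (run_then m f) setT = 1.
  by move=> m1 f1; apply: dprob_dbind1 => // -[].
elim: p c => //=.
- by move=> p1 IH1 p2 IH2 c; apply: then1.
- by move=> g p1 IH1 p2 IH2 c; case: ifP.
- move=> g p1 IH1 c.
  elim: {1}fuel c => //= k IHk c; case: ifP => // _.
  exact: then1.
- move=> e p1 IH1 p2 IH2 c.
  rewrite dprobT big_cat !big_map /= -!mulr_sumr -!dprobT IH1 IH2.
  by rewrite !mulr1 addrC subrK.
Qed.

Lemma exec_ge0 (R : realType) (fuel : nat) (p : cmd) (c : config R) :
  all (fun o => 0 <= o.1) (exec fuel p c).
Proof.
have then0 m f : all (fun o => 0 <= o.1) m ->
    (forall c, all (fun o : R * outcome R => 0 <= o.1) (f c)) ->
    all (fun o : R * outcome R => 0 <= o.1) (@run_then R m f).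
  move=> m0 f0; elim: m m0 => //= -[x o] m IH /andP[/= x0 m0].
  rewrite /run_then /dbind /= all_cat [X in _ && X]IH // andbT all_map.
  case: o => [c'|] /=; last by rewrite mulr1 x0.
  by apply: sub_all (f0 c') => -[y o'] /= y0; apply: mulr_ge0.
elim: p c => //=; rewrite ?ler01 //.
- by move=> p1 IH1 p2 IH2 c; apply: then0.
- by move=> g p1 IH1 p2 IH2 c; case: ifP.
- move=> g p1 IH1 c.
  elim: {1}fuel c => [|k IHk] c /=; first by rewrite ler01.
  by case: ifP => _; [apply: then0 | rewrite /= ler01].
- move=> e p1 IH1 p2 IH2 c; rewrite /dmix all_cat !all_map.
  have q0 : 0 <= clamp01 (reval c.1 e) by rewrite /clamp01 le_max lexx.
  have q1 : 0 <= 1 - clamp01 (reval c.1 e).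
    by rewrite subr_ge0 /clamp01 ge_max ler01 ge_min lexx orbT.
  apply/andP; split.
    by apply: sub_all (IH1 _) => -[y o'] /= y0; apply: mulr_ge0.
  by apply: sub_all (IH2 _) => -[y o'] /= y0; apply: mulr_ge0.
Qed.

(* Main.v *)
(* The algorithm is deterministic and exploits the exactness of the arithmetic.
   Round the entries of A to integers. If column j gets the weight Q ^ pos(j),
   for Q a large power of two, then a whole column of the integer matrix A^T A
   fits in one real, and all packed columns are obtained in O(nnz(A))
   operations: first pack the rows of A, then add up multiples of the packed
   rows. A product of A^T A with an integer vector is then a sum of at most
   min(d, nnz(A)) reals, whose base-Q digits are recovered from the top by
   bisection, in time O(log Q) each.

   So polynomials in A^T A of degree N cost about N sqrt(d nnz(A)) steps, up to
   logarithmic factors, and N = O(log(1/eps) kappa / gamma) suffices. Let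
   1 - 2x = cos t. Averaging a power of the Fejer kernel over the grid points
   with cosine at least 1 - 2 lambda gives a cosine polynomial
   r(t) = sum_k r_k cos kt with values in [0, 1], nearly 1 for
   x <= (1 - gamma) lambda and nearly 0 for x >= (1 + gamma) lambda. The answer
   is w = q(A^T A) A^T b with q(x) = sum_k r_k (1 - cos kt) / x. The functions
   (1 - cos kt) / x satisfy a three-term recurrence, in which rounding errors
   grow only quadratically. *)
Require Import Defs.
From mathcomp Require Import all_boot all_order all_algebra.
From mathcomp Require Import boolp classical_sets reals exp.
From mathcomp Require Import trigo ring lra zify.

Set Implicit Arguments.
Unset Strict Implicit.
Unset Printing Implicit Defensive.

Import Order.TTheory GRing.Theory Num.Theory.
Local Open Scope ring_scope.

(** * Cosine polynomials *)

(** The power of the Fejer kernel has three useful features. Its coefficients are nonnegative, so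
    their absolute sum is its value at 0. Its frequencies stay below the number N of grid points, so
    its translates over the whole grid add up to a constant, and an average over part of the grid is
    a step with no quadrature error. Away from its peak it drops by the factor 4^-p.

    Since x q(x) = r(0) - r(t) with r(0) nearly 1, the factor 1 - x q(x) is nearly r(t): q acts like
    1/x above the threshold and like 0 below it.

    The obstacle is that everything must fit into base-Q digits whatever the size of b. So A^T b is
    divided by its l1 norm, after which all iterates are polynomially bounded in n and N. A scale H
    > 280 N^5 n^7 / eps then makes rounding harmless and keeps every digit below H^4 / 8, whence Q =
    H^4. All these crude polynomial losses cost only a factor log H in time.

    The stable rank enters through being at least 1, and 1 / lambda becomes kappa up to a constant
    because lam1 >= 1/2. As the run is deterministic, it succeeds with probability 1. *)

Definition cospoly (R : realType) (D : nat) (f : R -> R) : Prop :=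
  exists2 a : nat -> R, (forall k, 0 <= a k) &
    forall x, f x = \sum_(k < D.+1) a k * cos (k%:R * x).

Section CosinePolynomials.
Variable R : realType.
Implicit Types (f g : R -> R) (x y c : R).

Lemma cospoly_cos D k : (k <= D)%N -> cospoly D (fun x : R => cos (k%:R * x)).
Proof.
move=> kD; exists (fun j => (j == k)%:R) => [j|x]; first exact: ler0n.
rewrite (bigD1 (Ordinal (kD : (k < D.+1)%N))) //= eqxx mul1r big1 ?addr0 // => i ik.
suff -> : (i == k :> nat) = false by rewrite mul0r.
by apply: contra_neqF ik => /eqP ik; apply: val_inj.
Qed.

Lemma eq_cospoly D f g : f =1 g -> cospoly D f -> cospoly D g.
Proof. by move=> fg [a a0 fE]; exists a => // x; rewrite -fg. Qed.

Lemma cospoly_comb D c f g : 0 <= c -> cospoly D f -> cospoly D g ->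
  cospoly D (fun x => c * f x + g x).
Proof.
move=> c0 [a a0 fE] [b b0 gE]; exists (fun k => c * a k + b k) => [k|x].
  by rewrite addr_ge0 ?mulr_ge0.
rewrite fE gE mulr_sumr -big_split; apply: eq_bigr => k _ /=.
by rewrite mulrDl mulrA.
Qed.

Lemma cospoly0 D : cospoly D (fun _ : R => 0).
Proof. by exists (fun _ => 0) => // x; rewrite big1 // => k _; rewrite mul0r. Qed.

Lemma cospoly_sum D n (c : nat -> R) (f : nat -> R -> R) :
  (forall i, (i < n)%N -> 0 <= c i /\ cospoly D (f i)) ->
  cospoly D (fun x => \sum_(i < n) c i * f i x).
Proof.
elim: n => [|n IH] H.
  by apply: eq_cospoly (cospoly0 D) => x; rewrite big_ord0.
have [c0 fn] := H n (ltnSn n).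
apply: eq_cospoly (cospoly_comb c0 fn (IH (fun i ni => H i (ltnW ni)))) => x.
by rewrite big_ord_recr addrC.
Qed.

Lemma cosMcos x y : cos x * cos y = 2^-1 * (cos (x + y) + cos (x - y)).
Proof. by rewrite cosD cosB; field. Qed.

Lemma cospoly_mul D E f g : cospoly D f -> cospoly E g ->
  cospoly (D + E) (fun x => f x * g x).
Proof.
move=> [a a0 fE] [b b0 gE].
have cc k l : (k <= D)%N -> (l <= E)%N ->
    cospoly (D + E) (fun x : R => cos (k%:R * x) * cos (l%:R * x)).
  (* Truncated subtraction kills one of the two summands, so [m] is the distance between [k] and
     [l]. *)
  move=> kD lE; pose m := ((k - l) + (l - k))%N.
  have h2 : 0 <= 2^-1 :> R by rewrite invr_ge0.
  have mDE : (m <= D + E)%N.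
    rewrite /m; have [kl|lk] := leqP k l.
      by rewrite (eqP kl) add0n (leq_trans (leq_subr _ _)) ?(leq_trans lE) ?leq_addl.
    by rewrite (eqP (ltnW lk)) addn0 (leq_trans (leq_subr _ _)) ?(leq_trans kD) ?leq_addr.
  apply: eq_cospoly (cospoly_comb h2 (cospoly_cos (leq_add kD lE))
    (cospoly_comb h2 (cospoly_cos mDE) (cospoly0 _))) => x.
  rewrite cosMcos addr0 -mulrDr natrD mulrDl; congr (_ * (_ + _)).
  rewrite /m; have [kl|lk] := leqP k l.
    by rewrite (eqP kl) add0n natrB // -mulrBl -cosN; congr cos; ring.
  by rewrite (eqP (ltnW lk)) addn0 natrB ?(ltnW lk) // -mulrBl.
apply: eq_cospoly (cospoly_sum (n := D.+1) (c := a)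
  (f := fun k x => \sum_(l < E.+1) b l * (cos (k%:R * x) * cos (l%:R * x))) _).
  move=> x; rewrite fE gE mulr_suml; apply: eq_bigr => k _.
  by rewrite -mulrA; congr (_ * _); rewrite mulr_sumr; apply: eq_bigr => l _; ring.
move=> k kD; split=> //.
apply: (@cospoly_sum _ _ b (fun l x => cos (k%:R * x) * cos (l%:R * x))).
by move=> l lE; split => //; apply: cc.
Qed.

Lemma cospoly_exp D f p : cospoly D f -> cospoly (D * p) (fun x => f x ^+ p).
Proof.
move=> fD; elim: p => [|p IH].
  by apply: eq_cospoly (@cospoly_cos _ 0 _) => // x; rewrite mul0r cos0 expr0.
rewrite mulnS; apply: eq_cospoly (cospoly_mul fD IH) => x; by rewrite exprS.
Qed.

Fixpoint dirichlet (m : nat) (x : R) : R :=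
  if m is m'.+1 then 2 * cos (m%:R * x) + dirichlet m' x else 1.

(** The unnormalised kernel (1 - cos mx) / (1 - cos x): a sum rather than a mean of Dirichlet
    kernels, so that the peak is m^2. *)
Definition fejer (m : nat) (x : R) : R := \sum_(l < m) dirichlet l x.

Lemma cospoly_dirichlet m D : (m <= D)%N -> cospoly D (dirichlet m).
Proof.
elim: m => [|m IH] mD.
  by apply: eq_cospoly (@cospoly_cos _ 0 _) => // x; rewrite mul0r cos0.
have h2 : 0 <= 2 :> R by [].
exact: eq_cospoly (cospoly_comb h2 (cospoly_cos mD) (IH (ltnW mD))).
Qed.

Lemma cospoly_fejer m : cospoly m.-1 (fejer m).
Proof.
case: m => [|m]; first by apply: eq_cospoly (cospoly0 _) => x; rewrite /fejer big_ord0.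
apply: eq_cospoly (cospoly_sum (n := m.+1) (c := fun _ => 1) (f := dirichlet) _).
  by move=> x; apply: eq_bigr => l _; rewrite mul1r.
by move=> i im; split=> //; apply: cospoly_dirichlet.
Qed.

(** Multiplied by 1 - cos x, each summand 2 cos kx becomes a negated second difference of cosines,
    so the sum telescopes. Summing once more telescopes again and gives [fejerE], in a form without
    division. *)
Lemma dirichletE m x :
  (1 - cos x) * dirichlet m x = cos (m%:R * x) - cos (m.+1%:R * x).
Proof.
elim: m => [|m IH] /=; first by rewrite mul0r cos0 mul1r mulr1.
rewrite mulrDr IH.
have -> : m.+2%:R * x = m.+1%:R * x + x by rewrite -natr1; ring.
have -> : m%:R * x = m.+1%:R * x - x by rewrite -natr1; ring.
by rewrite cosB cosD; ring.
Qed.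

Lemma fejerE m x : (1 - cos x) * fejer m x = 1 - cos (m%:R * x).
Proof.
elim: m => [|m IH]; first by rewrite /fejer big_ord0 mulr0 mul0r cos0 subrr.
by rewrite /fejer big_ord_recr /= mulrDr IH dirichletE; ring.
Qed.

Lemma fejer0 m : fejer m 0 = m%:R ^+ 2.
Proof.
have D0 l : dirichlet l 0 = 1 + l%:R *+ 2.
  elim: l => [|l IH] /=; first by rewrite mul0rn addr0.
  by rewrite IH mulr0 cos0 -natr1; ring.
rewrite /fejer; elim: m => [|m IH]; first by rewrite big_ord0 expr0n.
by rewrite big_ord_recr IH /= D0 -natr1; ring.
Qed.

Lemma fejer_decay m x w : 0 < w -> w <= 1 - cos x -> `|fejer m x| <= 2 / w.
Proof.
move=> w0 wx; rewrite ler_pdivlMr // mulrC.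
apply: (@le_trans _ _ `|(1 - cos x) * fejer m x|).
  rewrite normrM ler_wpM2r //; exact: le_trans wx (ler_norm _).
rewrite fejerE ler_norml.
have := cos_le1 (m%:R * x); have := cos_geN1 (m%:R * x); lra.
Qed.

(** Multiplication by 2 sin h, with h half the angular step, telescopes the sum; over k full turns
    the two ends cancel. The bounds on k put h strictly between 0 and pi, so sin h can be divided
    out. *)
Lemma sum_cos_grid N k : (0 < k < N)%N ->
  \sum_(j < N) cos (k%:R * (2 * pi * j%:R / N%:R)) = 0 :> R.
Proof.
case/andP=> k0 kN; have N0 : (0 < N)%N by apply: leq_ltn_trans kN.
have Nn0 : N%:R != 0 :> R by rewrite pnatr_eq0 -lt0n.
pose h : R := pi * k%:R / N%:R.
have sh : 0 < sin h.
  apply: sin_gt0_pi; rewrite /h; apply/andP; split.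
    by rewrite !mulr_gt0 ?pi_gt0 ?invr_gt0 ?ltr0n.
  rewrite -mulrA gtr_pMr ?pi_gt0 // ltr_pdivrMr ?ltr0n // mul1r.
  by rewrite ltr_nat.
have tel n : 2 * sin h * (\sum_(j < n) cos (k%:R * (2 * pi * j%:R / N%:R)))
    = sin (n%:R * (2 * h) - h) + sin h.
  elim: n => [|n IH]; first by rewrite big_ord0 mulr0 mul0r sub0r sinN addNr.
  rewrite big_ord_recr /= mulrDr IH.
  have -> : k%:R * (2 * pi * n%:R / N%:R) = n%:R * (2 * h).
    by rewrite /h; field.
  have -> : n.+1%:R * (2 * h) - h = n%:R * (2 * h) + h.
    by rewrite -natr1; ring.
  by rewrite sinB sinD; ring.
have NE : N%:R * (2 * h) - h = - h + pi *+ 2 *+ k.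
  by rewrite /h -mulrnA -[_ *+ (2 * k)]mulr_natr natrM; field.
have := tel N; rewrite NE (periodicn (@sinD2pi R)) sinN addNr => /eqP.
rewrite mulf_eq0 mulf_eq0 pnatr_eq0 /= gt_eqF //= => /eqP //.
Qed.

End CosinePolynomials.

(** * Step filters from averaged kernels *)

Section StepFilter.
Variable R : realType.
Implicit Types (f : R -> R) (x y c g : R).

Lemma cospoly_widen D E f : (D <= E)%N -> cospoly D f -> cospoly E f.
Proof.
move=> DE [a a0 fE]; apply: eq_cospoly (cospoly_sum (n := D.+1) (c := a)
  (f := fun k x => cos (k%:R * x)) _) => [x|k kD]; first by rewrite fE.
by split => //; apply: cospoly_cos; apply: leq_trans DE.
Qed.

(** Pairing the translates by [phi j] and by its opposite cancels the sine terms, so a partial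
    average of translates is again a cosine polynomial, with explicit coefficients. *)
Lemma cospoly_average D (a : nat -> R) (P : pred nat) (N : nat) (phi : nat -> R) x :
  \sum_(k < D) a k * (\sum_(j < N | P j) cos (k%:R * phi j)) * cos (k%:R * x)
  = \sum_(j < N | P j) 2^-1 *
      (\sum_(k < D) a k * cos (k%:R * (x - phi j))
       + \sum_(k < D) a k * cos (k%:R * (x + phi j))).
Proof.
under [RHS]eq_bigr do rewrite -big_split mulr_sumr.
rewrite [RHS]exchange_big /=; apply: eq_bigr => k _.
rewrite -mulrA [_ * cos _]mulrC mulr_sumr mulr_sumr; apply: eq_bigr => j _.
by rewrite mulrBr [_ * (_ + phi j)]mulrDr cosB cosD; field.
Qed.

(** The difference of cosines is, up to sign, 2 sin u sin v with u and v half the difference and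
    half the sum. Both sines are at most 1 in size, so each alone has square at least g^2 / 4, and 1
    - cos 2u = 2 sin^2 u. *)
Lemma cos_gap x y g : 0 <= g -> g <= `|cos x - cos y| ->
  g ^+ 2 / 2 <= 1 - cos (x - y) /\ g ^+ 2 / 2 <= 1 - cos (x + y).
Proof.
move=> g0 gxy; pose u := (x - y) / 2; pose v := (x + y) / 2.
have -> : x - y = u *+ 2 by rewrite /u -mulr_natr; field.
have -> : x + y = v *+ 2 by rewrite /v -mulr_natr; field.
have xE : x = v + u by rewrite /u /v; field.
have yE : y = v - u by rewrite /u /v; field.
have E : cos x - cos y = - (2 * sin v * sin u).
  by rewrite xE yE cosB cosD; ring.
have cos2 z : cos (z *+ 2) = 2 * cos z ^+ 2 - 1 by rewrite cos_mulr2n; ring.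
move: gxy; rewrite E normrN !cos2 => gxy.
have : g ^+ 2 <= (2 * sin v * sin u) ^+ 2.
  by rewrite -[leRHS]real_normK ?num_real // lerXn2r ?nnegrE.
rewrite !exprMn !sin2cos2.
have := sqr_ge0 (sin u); have := sqr_ge0 (sin v).
have := sqr_ge0 (cos u); have := sqr_ge0 (cos v).
rewrite !sin2cos2; set cu := cos u ^+ 2; set cv := cos v ^+ 2.
move=> cv0 cu0 sv su H.
have : (1 - cv) * (1 - cu) <= 1 - cv by nra.
have : (1 - cv) * (1 - cu) <= 1 - cu by nra.
by split; lra.
Qed.

(** The filter is the share of the kernel mass coming from grid points with cosine at least c. If
    cos x is at least g above c, the omitted points are all far from x; if it is g below, the chosen
    ones are. Either way at most N kernel tails are lost or gained. *)
Lemma step_filter c g (m p : nat) :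
  0 < g -> (0 < p)%N -> 8 <= m%:R ^+ 2 * g ^+ 2 ->
  let N := (2 * p * m)%N in
  exists2 r : nat -> R, \sum_(k < N) `|r k| <= N%:R &
    forall x, let s := \sum_(k < N) r k * cos (k%:R * x) in
    [/\ 0 <= s <= 1,
        c + g <= cos x -> 1 - N%:R * 4 ^- p <= s
      & cos x <= c - g -> s <= N%:R * 4 ^- p].
Proof.
move=> g0 p0 mg N.
have m0 : (0 < m)%N.
  by rewrite lt0n; apply: contraTneq mg => ->; rewrite expr0n mul0r -ltNge.
have N0 : (0 < N)%N by rewrite !muln_gt0 p0.
pose K x := fejer m x ^+ (2 * p).
have K0 x : 0 <= K x by rewrite /K exprM exprn_ge0 // sqr_ge0.
have [a a0 KE] : cospoly N.-1 K.
  (* The degree 2p(m - 1) is below N, as [sum_cos_grid] demands of every frequency it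
     annihilates. *)
  apply: cospoly_widen (cospoly_exp (2 * p) (cospoly_fejer R m)).
  rewrite -ltnS prednK // mulnC ltn_mul2l muln_gt0 p0 /=.
  by rewrite -{2}(prednK m0).
rewrite prednK // in KE.
pose phi (j : nat) : R := 2 * pi * j%:R / N%:R.
pose B (P : pred nat) x : R := \sum_(j < N | P j) 2^-1 * (K (x - phi j) + K (x + phi j)).
have BE P x : B P x =
    \sum_(k < N) a k * (\sum_(j < N | P j) cos (k%:R * phi j)) * cos (k%:R * x).
  by rewrite cospoly_average; apply: eq_bigr => j _; rewrite !KE.
pose Z := a 0%N * N%:R.
(* Partition of unity: over the full grid only the constant term survives. *)
have BZ x : B xpredT x = Z.
  rewrite BE (bigD1 (Ordinal N0)) //= [X in _ + X]big1 ?addr0 => [|k k0]; last first.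
    rewrite [X in _ * X * _](_ : _ = 0) ?mulr0 ?mul0r //.
    by apply: sum_cos_grid; rewrite ltn_ord andbT lt0n; exact: k0.
  rewrite mul0r cos0 mulr1; congr (_ * _).
  under eq_bigr do rewrite mul0r cos0.
  by rewrite sumr_const card_ord.
have B0 P x : 0 <= B P x.
  by apply: sumr_ge0 => j _; rewrite mulr_ge0 ?invr_ge0 ?addr_ge0.
have BC P x : B P x + B (predC P) x = Z.
  by rewrite -(BZ x) /B [in RHS](bigID (fun j : 'I_N => P j)).
have K00 : K 0 = (m%:R ^+ 2) ^+ (2 * p) by rewrite /K fejer0.
(* The grid point 0 alone contributes the whole peak at x = 0. *)
have ZK : K 0 <= Z.
  have phi0 : phi 0%N = 0 by rewrite /phi mulr0 mul0r.
  rewrite -(BZ 0) /B (bigD1 (Ordinal N0)) //= phi0 subr0 addr0.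
  have -> : 2^-1 * (K 0 + K 0) = K 0 by field.
  rewrite lerDl; apply: sumr_ge0 => j _.
  by rewrite mulr_ge0 ?invr_ge0 ?addr_ge0.
have m20 : 0 < m%:R ^+ 2 :> R by rewrite exprn_gt0 ?ltr0n.
have K0_gt0 : 0 < K 0 by rewrite K00 exprn_gt0.
have Z0 : 0 < Z by apply: lt_le_trans ZK.
have small (P : pred nat) x : (forall j, P j -> g <= `|cos x - cos (phi j)|) ->
    B P x <= Z * (N%:R * 4 ^- p).
  move=> far.
  have Ks y : g ^+ 2 / 2 <= 1 - cos y -> K y <= Z * 4 ^- p.
    move=> gy; have g2 : 0 < g ^+ 2 / 2 by rewrite divr_gt0 ?exprn_gt0.
    have := fejer_decay m g2 gy.
    have -> : 2 / (g ^+ 2 / 2) = 4 / g ^+ 2 by field; rewrite gt_eqF.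
    (* The hypothesis on m makes 4 / g^2 at most half of the peak m^2, and the power 2p of one half
       is 4^-p. *)
    move=> fy; have {}fy : `|fejer m y| <= m%:R ^+ 2 / 2.
      apply: le_trans fy _; rewrite ler_pdivrMr ?exprn_gt0 //; lra.
    apply: (@le_trans _ _ ((m%:R ^+ 2 / 2) ^+ (2 * p))).
      rewrite /K; apply: (@le_trans _ _ (`|fejer m y| ^+ (2 * p))).
        by rewrite -normrX ler_norm.
      by rewrite lerXn2r ?nnegrE ?divr_ge0 // ltW.
    rewrite expr_div_n -K00 [X in _ / X]exprM.
    have -> : 2 ^+ 2 = 4 :> R by ring.
    by rewrite ler_wpM2r // invr_ge0 exprn_ge0.
  have -> : Z * (N%:R * 4 ^- p) = \sum_(j < N) Z * 4 ^- p.
    by rewrite sumr_const card_ord -mulr_natl; ring.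
  have Z4 : 0 <= Z * 4 ^- p by rewrite mulr_ge0 ?invr_ge0 ?exprn_ge0 // ltW.
  rewrite /B big_mkcond; apply: ler_sum => j _; case: ifP => // Pj.
  have [A1 A2] := cos_gap (ltW g0) (far j Pj).
  have := Ks _ A1; have := Ks _ A2; lra.
pose J : pred nat := fun j => c <= cos (phi j).
exists (fun k => a k * (\sum_(j < N | J j) cos (k%:R * phi j)) / Z).
  apply: (@le_trans _ _ (\sum_(k < N) a k * N%:R / Z)).
    apply: ler_sum => k _; rewrite 2!normrM (ger0_norm (a0 k)).
    have Zi : 0 <= Z^-1 by rewrite invr_ge0 ltW.
    rewrite (ger0_norm Zi); apply: (ler_wpM2r Zi).
    apply: ler_wpM2l => //; apply: le_trans (ler_norm_sum _ _ _) _.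
    have -> : N%:R = \sum_(j < N) 1 :> R by rewrite sumr_const card_ord.
    rewrite [leLHS]big_mkcond; apply: ler_sum => j _; case: ifP => // _.
    exact: cos_max.
  rewrite -!mulr_suml ler_pdivrMr // [N%:R * Z]mulrC ler_wpM2r //.
  (* Nonnegative coefficients sum, without absolute values, to the value at 0. *)
  have <- : K 0 = \sum_(k < N) a k; last exact: ZK.
  by rewrite KE; apply: eq_bigr => k _; rewrite mulr0 cos0 mulr1.
move=> x s.
have sE : s = B J x / Z.
  by rewrite BE mulr_suml; apply: eq_bigr => k _; rewrite mulrAC.
have BJ := BC J x.
split.
- rewrite sE divr_ge0 ?(ltW Z0) //= ler_pdivrMr // mul1r -BJ lerDl //.
- move=> cx; rewrite sE ler_pdivlMr // mulrBl mul1r lerBlDr -{1}BJ lerD2l.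
  rewrite mulrC; apply: small => j /=; rewrite /J -ltNge => Hj.
  by apply: le_trans (ler_norm _); lra.
- move=> cx; rewrite sE ler_pdivrMr // mulrC; apply: small => j; rewrite /J => Hj.
  by rewrite distrC; apply: le_trans (ler_norm _); lra.
Qed.

End StepFilter.

(** * Spectral analysis *)

Definition dot (R : realType) (m : nat) (u v : 'cV[R]_m) : R := (u^T *m v) 0 0.

Section Dot.
Variables (R : realType) (m : nat).
Implicit Types u v w : 'cV[R]_m.

Lemma dotE u v : dot u v = \sum_i u i 0 * v i 0.
Proof. by rewrite /dot mxE; apply: eq_bigr => i _; rewrite mxE. Qed.

Lemma dotC u v : dot u v = dot v u.
Proof. by rewrite !dotE; apply: eq_bigr => i _; rewrite mulrC. Qed.

Lemma dotDr u v w : dot u (v + w) = dot u v + dot u w.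
Proof. by rewrite /dot mulmxDr mxE. Qed.

Lemma dotDl u v w : dot (v + w) u = dot v u + dot w u.
Proof. by rewrite ![dot _ u]dotC dotDr. Qed.

Lemma dotNr u v : dot u (- v) = - dot u v.
Proof. by rewrite /dot mulmxN mxE. Qed.

Lemma dotBr u v w : dot u (v - w) = dot u v - dot u w.
Proof. by rewrite dotDr dotNr. Qed.

Lemma dotZr c u v : dot u (c *: v) = c * dot u v.
Proof. by rewrite /dot -scalemxAr mxE. Qed.

Lemma dotZl c u v : dot (c *: u) v = c * dot u v.
Proof. by rewrite dotC dotZr dotC. Qed.

Lemma dotBl u v w : dot (v - w) u = dot v u - dot w u.
Proof. by rewrite ![dot _ u]dotC dotBr. Qed.

Lemma dot_sumr I (r : seq I) (P : pred I) (f : I -> 'cV[R]_m) u :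
  dot u (\sum_(i <- r | P i) f i) = \sum_(i <- r | P i) dot u (f i).
Proof. by rewrite /dot mulmx_sumr summxE. Qed.

Lemma sqr_l2norm u : l2norm u ^+ 2 = dot u u.
Proof.
rewrite /l2norm sqr_sqrtr; last by apply: sumr_ge0 => i _; rewrite sqr_ge0.
by rewrite dotE; apply: eq_bigr => i _; rewrite expr2.
Qed.

Lemma l2norm_ge0 u : 0 <= l2norm u.
Proof. exact: sqrtr_ge0. Qed.

(** Cauchy-Schwarz, from the nonnegative square of q u - p v with p and q the two norms; if one of
    them vanishes, so does that vector. *)
Lemma dot_le_l2norm u v : dot u v <= l2norm u * l2norm v.
Proof.
set p := l2norm u; set q := l2norm v.
have p0 : 0 <= p := l2norm_ge0 u; have q0 : 0 <= q := l2norm_ge0 v.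
have E : l2norm (q *: u - p *: v) ^+ 2 = 2 * (p * q) * (p * q - dot u v).
  rewrite sqr_l2norm !dotBr !dotBl !dotZr !dotZl [dot v u]dotC -!sqr_l2norm -/p -/q.
  ring.
have pz x y : l2norm x = 0 -> @dot R m x y = 0.
  move=> /(congr1 (fun t => t ^+ 2)); rewrite sqr_l2norm expr0n /= dotE => /eqP.
  rewrite psumr_eq0 => [/allP x0|i _]; last by rewrite -expr2 sqr_ge0.
  rewrite dotE big1 // => i _; have /= := x0 i (mem_index_enum _).
  by rewrite mulf_eq0 orbb => /eqP ->; rewrite mul0r.
have [pq|] := ltP 0 (p * q).
  have : 0 <= 2 * (p * q) * (p * q - dot u v) by rewrite -E sqr_ge0.
  have pq2 : 0 < 2 * (p * q) by rewrite mulr_gt0.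
  by rewrite (pmulr_rge0 _ pq2) subr_ge0.
move=> pq; have /eqP : p * q = 0 by apply/le_anti; rewrite pq mulr_ge0.
rewrite mulf_eq0 => /orP[] /eqP e0; last rewrite dotC.
  by rewrite (pz _ v e0) mulr_ge0.
by rewrite (pz _ u e0) mulr_ge0.
Qed.

Lemma l2normD u v : l2norm (u + v) <= l2norm u + l2norm v.
Proof.
rewrite -ler_sqr ?nnegrE ?addr_ge0 ?l2norm_ge0 //.
rewrite sqr_l2norm dotDr !dotDl [dot v u]dotC sqrrD !sqr_l2norm.
have := dot_le_l2norm u v; lra.
Qed.

Lemma l2norm_le u x : 0 <= x -> dot u u <= x ^+ 2 -> l2norm u <= x.
Proof. by move=> x0 ux; rewrite -ler_sqr ?nnegrE ?l2norm_ge0 // sqr_l2norm. Qed.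

End Dot.

Lemma dot_mulmx (R : realType) (n d : nat) (A : 'M[R]_(n, d)) x y :
  dot (A *m x) y = dot x (A^T *m y).
Proof. by rewrite /dot trmx_mul -mulmxA. Qed.

Section Spectral.
Variables (R : realType) (n d : nat) (A : 'M[R]_(n, d)).
Variables (lam : 'I_d -> R) (nu : 'I_d -> 'cV[R]_d).
Hypothesis hA : eigensystem A lam nu.

Lemma dot_nu i j : dot (nu i) (nu j) = (i == j)%:R.
Proof. by case: hA => o _ _; rewrite /dot o mxE eqxx mulr1n. Qed.

(** The matrix of eigenvectors is square, so its left inverse, the transpose, is also a right
    inverse. *)
Lemma nu_complete x : x = \sum_i dot (nu i) x *: nu i.
Proof.
pose V : 'M[R]_d := \matrix_(i, j) nu j i 0.
have VV : V^T *m V = 1%:M.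
  apply/matrixP => i j; rewrite !mxE -dot_nu dotE; apply: eq_bigr => k _.
  by rewrite !mxE.
have -> : \sum_i dot (nu i) x *: nu i = V *m (V^T *m x).
  apply/colP => k; rewrite !mxE summxE; apply: eq_bigr => i _.
  rewrite !mxE mulrC; congr (_ * _); rewrite dotE; apply: eq_bigr => l _.
  by rewrite !mxE.
by rewrite mulmxA (mulmx1C VV) mul1mx.
Qed.

Lemma dot_parseval x y : dot x y = \sum_i dot (nu i) x * dot (nu i) y.
Proof.
rewrite [in LHS](nu_complete y) dot_sumr; apply: eq_bigr => i _.
by rewrite dotZr [dot x _]dotC mulrC.
Qed.

Lemma dot_nu_gram i x : dot (nu i) (A^T *m A *m x) = lam i * dot (nu i) x.
Proof.
case: hA => _ e _.
by rewrite -mulmxA -{1}[A^T]trmxK trmxK -dot_mulmx dotC dot_mulmx mulmxA e dotZr dotC.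
Qed.

Lemma dot_gram x y : dot (A *m x) (A *m y) = \sum_i lam i * (dot (nu i) x * dot (nu i) y).
Proof.
rewrite dot_mulmx mulmxA dot_parseval; apply: eq_bigr => i _.
by rewrite dot_nu_gram; ring.
Qed.

Lemma lam_ge0 i : 0 <= lam i.
Proof.
suff <- : l2norm (A *m nu i) ^+ 2 = lam i by rewrite sqr_ge0.
rewrite sqr_l2norm dot_mulmx mulmxA dot_nu_gram dot_nu eqxx mulr1 //.
Qed.

Variable b : 'cV[R]_n.
Let al i := dot (nu i) (A^T *m b).

Lemma residual_sqr w : l2norm (A *m w - b) ^+ 2 =
  l2norm b ^+ 2 + \sum_i (lam i * dot (nu i) w ^+ 2 - 2 * (dot (nu i) w * al i)).
Proof.
rewrite sqr_l2norm dotBr dotC dotBr [dot (_ - _) b]dotC dotBr.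
rewrite dot_gram [dot b (A *m w)]dotC dot_mulmx dot_parseval -sqr_l2norm.
rewrite sumrB -mulr_sumr; under [X in _ = _ + (X - _)]eq_bigr do rewrite expr2.
ring.
Qed.

(** A kernel direction of A carries no part of A^T b. This makes the convention 1 / 0 = 0 harmless
    in the sums of [al i ^+ 2 / lam i] below. *)
Lemma al0 i : lam i = 0 -> al i = 0.
Proof.
move=> l0; rewrite /al -dot_mulmx.
have := dot_gram (nu i) (nu i); rewrite big1 => [H|j _]; last first.
  by rewrite !dot_nu; case: eqVneq => [->|_]; rewrite ?l0 ?mul0r ?mulr0.
have N0 : l2norm (A *m nu i) = 0 by apply/eqP; rewrite -sqrf_eq0 sqr_l2norm H.
apply/le_anti; have := dot_le_l2norm (A *m nu i) b.
have := dot_le_l2norm (A *m nu i) (- b).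
by rewrite N0 !mul0r dotNr oppr_le0 => -> ->.
Qed.

(** The summands are the squared components of b along the normalised images of the eigenvectors.
    The sum is what the least-squares solution w removes from the squared norm of b, and the
    remaining residual is nonnegative. *)
Lemma bessel : \sum_i al i ^+ 2 / lam i <= l2norm b ^+ 2.
Proof.
pose w := \sum_i (al i / lam i) *: nu i.
have wE i : dot (nu i) w = al i / lam i.
  rewrite /w dot_sumr (bigD1 i) //= dotZr dot_nu eqxx mulr1 big1 ?addr0 // => j ji.
  by rewrite dotZr dot_nu eq_sym (negPf ji) mulr0.
have := sqr_ge0 (l2norm (A *m w - b)); rewrite residual_sqr.
rewrite (eq_bigr (fun i => - (al i ^+ 2 / lam i))) => [|i _]; last first.
  rewrite wE; have [->|l0] := eqVneq (lam i) 0; first by rewrite invr0 !(mulr0, mul0r) subr0 oppr0.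
  by field.
by rewrite sumrN subr_ge0.
Qed.

Lemma dot_pcproj t i x : dot (nu i) (pcproj lam nu t *m x) =
  if t <= lam i then dot (nu i) x else 0.
Proof.
rewrite pcproj_in_span dot_sumr big_mkcond (bigD1 i) //= big1 ?addr0 => [|j ji].
  by case: ifP => // _; rewrite dotZr dot_nu eqxx mulr1.
by case: ifP => // _; rewrite dotZr dot_nu eq_sym (negPf ji) mulr0.
Qed.

(** Projecting a minimiser by P_t gives another minimiser, no longer than the first; minimality of
    the norm forces the dropped coordinates to vanish. In the default branch of [xget] the vector is
    0. *)
Lemma xstar_low t i : lam i < t -> dot (nu i) (xstar A lam nu b t) = 0.
Proof.
move=> lt; rewrite /xstar; case: xgetP => [x xE [xmin xnorm]|_]; last first.
  by rewrite /dot mulmx0 mxE.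
have PP : pcproj lam nu t *m (pcproj lam nu t *m x) = pcproj lam nu t *m x.
  rewrite [LHS]nu_complete [RHS]nu_complete; apply: eq_bigr => j _.
  by rewrite !dot_pcproj; case: (t <= lam j).
have /xnorm : argmin_lsq (A *m pcproj lam nu t) b (pcproj lam nu t *m x).
  by move=> y; have := xmin y; rewrite -!mulmxA PP.
rewrite -ler_sqr ?nnegrE ?l2norm_ge0 // !sqr_l2norm.
rewrite [dot x x]dot_parseval [leRHS]dot_parseval -subr_le0 -sumrB.
set F := (F in \sum_i F i <= 0) => F0.
have FP j : 0 <= F j.
  by rewrite /F dot_pcproj; case: ifP; rewrite ?subrr // mul0r subr0 -expr2 sqr_ge0.
have : \sum_j F j == 0 by rewrite eq_le F0; apply: sumr_ge0 => j _; exact: FP.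
rewrite psumr_eq0 // => /allP /(_ i (mem_index_enum _)) /=.
by rewrite /F dot_pcproj leNgt lt /= mul0r subr0 mulf_eq0 orbb => /eqP.
Qed.

(** Completing the square in each coordinate bounds the optimal residual from below; this is the
    side needed to compare [w] with [xstar]. *)
Lemma residual_xstar t : 0 < t ->
  l2norm b ^+ 2 - \sum_(i | t <= lam i) al i ^+ 2 / lam i
    <= l2norm (A *m xstar A lam nu b t - b) ^+ 2.
Proof.
move=> t0; rewrite residual_sqr lerD2l -sumrN big_mkcond; apply: ler_sum => i _.
case: (leP t) => [ti|it]; last by rewrite xstar_low // expr0n mul0r !mulr0 subrr.
set x := dot _ _; have l0 : 0 < lam i by apply: lt_le_trans ti.
rewrite -subr_ge0.
have -> : lam i * x ^+ 2 - 2 * (x * al i) - - (al i ^+ 2 / lam i) =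
  (lam i * x - al i) ^+ 2 / lam i by field; rewrite gt_eqF.
by rewrite divr_ge0 ?sqr_ge0 // ltW.
Qed.

(** Split w into the exact filter output [w0] and an error [e], each paying eps / 2. For [w0], the
    squared residual differs from that of 0 by the sum of ((1 - lam q)^2 - 1) al^2 / lam; bounding
    it termwise and applying [bessel] leaves an excess of at most tau times the squared norm of
    b. *)
Lemma pcr_success_of_filter (lambda gamma eps tau rho : R) (q : 'I_d -> R) w :
  (forall i, lam i <= 1) -> 0 < lambda -> 0 < gamma -> 0 <= tau -> 0 <= eps -> 0 <= rho ->
  tau <= (eps / 2) ^+ 2 -> d%:R * rho <= eps / 2 * l2norm b ->
  (forall i, (1 - lam i * q i) ^+ 2 <= 1 + tau) ->
  (forall i, (1 + gamma) * lambda <= lam i -> (1 - lam i * q i) ^+ 2 <= tau) ->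
  (forall i, lam i < (1 - gamma) * lambda -> q i ^+ 2 * lam i <= tau) ->
  (forall i, `|dot (nu i) w - q i * al i| <= rho) ->
  pcr_success A lam nu lambda gamma eps b w.
Proof.
move=> lam1 l0 g0 tau0 eps0 rho0 taueps drho qall qhi qlo werr.
pose w0 := \sum_i (q i * al i) *: nu i; pose e := w - w0.
have w0E i : dot (nu i) w0 = q i * al i.
  rewrite /w0 dot_sumr (bigD1 i) //= dotZr dot_nu eqxx mulr1 big1 ?addr0 // => j ji.
  by rewrite dotZr dot_nu eq_sym (negPf ji) mulr0.
have eE i : `|dot (nu i) e| <= rho by rewrite dotBr w0E.
have wE : w = w0 + e by rewrite /e addrC subrK.
have b0 := l2norm_ge0 b.
have tb : Num.sqrt tau * l2norm b <= eps / 2 * l2norm b.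
  apply: ler_wpM2r => //; rewrite -ler_sqr ?nnegrE ?sqrtr_ge0 ?divr_ge0 //.
  by rewrite sqr_sqrtr.
have tau2 : (Num.sqrt tau * l2norm b) ^+ 2 = tau * l2norm b ^+ 2.
  by rewrite exprMn sqr_sqrtr.
(* The weights [k] are 0 or 1 for the projection of [e], and the eigenvalues for its image under
   A. *)
have small m (u : 'cV[R]_m) (k : 'I_d -> R) : (forall i, 0 <= k i <= 1) ->
    dot u u = \sum_i k i * dot (nu i) e ^+ 2 -> l2norm u <= eps / 2 * l2norm b.
  move=> k1 uE; apply: le_trans drho.
  apply: l2norm_le; first by rewrite mulr_ge0.
  rewrite uE; apply: (@le_trans _ _ (\sum_(i < d) rho ^+ 2)).
    apply: ler_sum => i _; have /andP[k0 k1'] := k1 i.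
    apply: (@le_trans _ _ (1 * dot (nu i) e ^+ 2)).
      by apply: ler_wpM2r => //; rewrite sqr_ge0.
    by rewrite mul1r -[leLHS]real_normK ?num_real // lerXn2r ?nnegrE.
  rewrite sumr_const card_ord -[leLHS]mulr_natl exprMn ler_wpM2r ?sqr_ge0 //.
  by rewrite -natrX ler_nat; case: (d) => // d'; rewrite leq_pmulr.
split.
  rewrite wE mulmxDr; apply: le_trans (l2normD _ _) _.
  set P := 1%:M - _.
  have PE i x : dot (nu i) (P *m x) = if (1 - gamma) * lambda <= lam i then 0 else dot (nu i) x.
    by rewrite /P mulmxBl mul1mx dotBr dot_pcproj; case: ifP; rewrite ?subrr ?subr0.
  have -> : eps * l2norm b = eps / 2 * l2norm b + eps / 2 * l2norm b by field.
  apply: lerD; last first.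
    apply: (small _ _ (fun i => if (1 - gamma) * lambda <= lam i then 0 else 1)).
      by move=> i; case: ifP; rewrite lexx ler01.
    rewrite dot_parseval; apply: eq_bigr => i _.
    by rewrite PE; case: ifP => _; rewrite ?mul0r // mul1r expr2.
  apply: le_trans tb; apply: l2norm_le; first by rewrite mulr_ge0 ?sqrtr_ge0.
  rewrite tau2; apply: (@le_trans _ _ (\sum_i tau * (al i ^+ 2 / lam i))); last first.
    by rewrite -mulr_sumr ler_wpM2l // bessel.
  rewrite dot_parseval; apply: ler_sum => i _; rewrite PE.
  have aq : 0 <= al i ^+ 2 / lam i by rewrite divr_ge0 ?sqr_ge0 ?lam_ge0.
  case: (leP ((1 - gamma) * lambda)) => [_|hi]; first by rewrite mul0r mulr_ge0.
  rewrite w0E; have [li0|ln0] := eqVneq (lam i) 0.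
    by rewrite al0 // !mulr0 expr0n mul0r mulr0.
  have -> : q i * al i * (q i * al i) = q i ^+ 2 * lam i * (al i ^+ 2 / lam i) by field.
  by rewrite ler_wpM2r // qlo.
have -> : A *m w - b = (A *m w0 - b) + A *m e by rewrite wE mulmxDr addrAC.
apply: le_trans (l2normD _ _) _.
have -> : eps * l2norm b = eps / 2 * l2norm b + eps / 2 * l2norm b by field.
rewrite addrA; apply: lerD; last first.
  apply: (small _ _ lam) => [i|]; first by rewrite lam_ge0 lam1.
  by rewrite dot_gram; apply: eq_bigr => i _; rewrite expr2.
set X := l2norm (A *m xstar _ _ _ _ _ - b).
apply: le_trans (lerD (lexx _) tb); apply: l2norm_le.
  by rewrite addr_ge0 ?mulr_ge0 ?sqrtr_ge0 ?l2norm_ge0.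
rewrite -sqr_l2norm residual_sqr sqrrD tau2.
have X0 : 0 <= X := l2norm_ge0 _.
have : 0 <= X * (Num.sqrt tau * l2norm b) by rewrite !mulr_ge0 ?sqrtr_ge0.
have hl0 : 0 < (1 + gamma) * lambda by rewrite mulr_gt0 ?addr_gt0.
have := residual_xstar hl0; rewrite -/X.
have := ler_wpM2l tau0 bessel; rewrite mulr_sumr => B1 B2 B3.
rewrite (big_mkcond (fun i => (1 + gamma) * lambda <= lam i)) /= in B2.
have : \sum_i (lam i * dot (nu i) w0 ^+ 2 - 2 * (dot (nu i) w0 * al i)) +
   \sum_i (if (1 + gamma) * lambda <= lam i then al i ^+ 2 / lam i else 0)
   <= \sum_i tau * (al i ^+ 2 / lam i).
  rewrite -big_split; apply: ler_sum => i _ /=; rewrite w0E.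
  have [li0|ln0] := eqVneq (lam i) 0.
    by rewrite al0 // li0 (lt_geF hl0) /= expr0n !(mul0r, mulr0) subrr addr0.
  have aq : 0 <= al i ^+ 2 / lam i by rewrite divr_ge0 ?sqr_ge0 ?lam_ge0.
  have -> : lam i * (q i * al i) ^+ 2 - 2 * (q i * al i * al i) =
    ((1 - lam i * q i) ^+ 2 - 1) * (al i ^+ 2 / lam i) by field.
  case: (leP ((1 + gamma) * lambda)) => [hi|_].
    rewrite mulrBl mul1r subrK; apply: ler_wpM2r => //; exact: qhi.
  rewrite addr0; apply: ler_wpM2r => //; have := qall i; lra.
lra.
Qed.

End Spectral.

(** * Stability of the three-term recurrence *)

Section Recurrence.
Variable R : realType.

Lemma norm_le_sqr (x y : R) : 0 <= y -> x ^+ 2 <= y ^+ 2 -> `|x| <= y.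
Proof.
by move=> y0; rewrite -[x ^+ 2]real_normK ?num_real // ler_sqr ?nnegrE.
Qed.

(** The form U^2 - 2cUV + V^2 is conserved by the unperturbed recurrence. It dominates (cU - V)^2,
    so a perturbation adds at most G to its root, which thus grows linearly. It also dominates the
    square of the new value minus cU, so the sequence itself grows by at most that root per step. *)
Lemma perturbed_chebyshev (c B G : R) (u g : nat -> R) K :
  -1 <= c <= 1 -> 0 <= G -> `|u 0%N| <= B -> u 1%N = 0 ->
  (forall k, (k < K)%N -> u k.+2 = 2 * c * u k.+1 - u k + g k /\ `|g k| <= G) ->
  forall k, (k <= K)%N -> `|u k.+1| <= k%:R * B + k%:R ^+ 2 * G.
Proof.
move=> c1 G0 u0 u1 rec k kK.
have c2 : c ^+ 2 <= 1 by nra.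
have B0 : 0 <= B by apply: le_trans u0.
suff [//] : `|u k.+1| <= k%:R * B + k%:R ^+ 2 * G /\
  u k.+1 ^+ 2 - 2 * c * u k.+1 * u k + u k ^+ 2 <= (B + k%:R * G) ^+ 2.
elim: k kK => [_|k IH kK].
  rewrite u1 normr0 !mul0r expr0n mul0r !addr0; split=> //.
  rewrite mulr0 mul0r subr0 add0r.
  by rewrite -[leLHS]real_normK ?num_real // lerXn2r ?nnegrE.
have [IH1 IH2] := IH (ltnW kK); have [-> gG] := rec k kK.
set U := u k.+1 in IH1 IH2 *; set V := u k in IH2 *; set S := B + k%:R * G in IH2.
have S0 : 0 <= S by rewrite addr_ge0 ?mulr_ge0.
have E : (2 * c * U - V + g k) ^+ 2 - 2 * c * (2 * c * U - V + g k) * U + U ^+ 2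
   = (U ^+ 2 - 2 * c * U * V + V ^+ 2) + 2 * g k * (c * U - V) + g k ^+ 2.
  by ring.
have cUV : `|c * U - V| <= S.
  apply: norm_le_sqr => //; apply: le_trans IH2.
  have : 0 <= (1 - c ^+ 2) * U ^+ 2 by rewrite mulr_ge0 ?sqr_ge0 // subr_ge0.
  have -> : (c * U - V) ^+ 2 = U ^+ 2 - 2 * c * U * V + V ^+ 2 - (1 - c ^+ 2) * U ^+ 2.
    by ring.
  lra.
have E2 : (2 * c * U - V + g k) ^+ 2 - 2 * c * (2 * c * U - V + g k) * U + U ^+ 2
    <= (S + G) ^+ 2.
  rewrite E; have : g k * (c * U - V) <= G * S.
    by apply: le_trans (ler_norm (g k * (c * U - V))) _; rewrite normrM ler_pM.
  have : g k ^+ 2 <= G ^+ 2.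
    by rewrite -[leLHS]real_normK ?num_real // lerXn2r ?nnegrE.
  rewrite sqrrD; move: IH2; lra.
have SE : B + k.+1%:R * G = S + G by rewrite /S -natr1; ring.
split; last by rewrite SE.
set X := 2 * c * U - V + g k in E2 *.
have XU : `|X - c * U| <= S + G.
  apply: norm_le_sqr; first exact: addr_ge0.
  apply: le_trans E2.
  have : 0 <= (1 - c ^+ 2) * U ^+ 2 by rewrite mulr_ge0 ?sqr_ge0 // subr_ge0.
  have -> : (X - c * U) ^+ 2 = X ^+ 2 - 2 * c * X * U + U ^+ 2 - (1 - c ^+ 2) * U ^+ 2.
    by ring.
  lra.
have cU : `|c * U| <= `|U|.
  by rewrite normrM ler_piMl // ler_norml.
have -> : X = (X - c * U) + c * U by rewrite subrK.
apply: le_trans (ler_normD _ _) _.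
have kG : 0 <= k%:R * G by rewrite mulr_ge0.
rewrite -natr1; move: XU IH1; rewrite /S; nra.
Qed.

(** The index is shifted by one: the initial 2 is the value (1 - cos t) / x of frequency -1. The
    inhomogeneity 4 is 2 (1 - cos t) / x. *)
Fixpoint response2 (x : R) (k : nat) : R * R :=
  if k is k'.+1 then
    let p := response2 x k' in (p.2, 2 * (1 - 2 * x) * p.2 - p.1 + 4)
  else (2, 0).

(* [response x k.+1] is [(1 - T_k (1 - 2 x)) / x], including its limit at 0. *)
Definition response (x : R) (k : nat) : R := (response2 x k).1.

Lemma responseE (x th : R) k : cos th = 1 - 2 * x ->
  x * response x k.+1 = 1 - cos (k%:R * th).
Proof.
move=> cx; suff [] : x * response x k.+1 = 1 - cos (k%:R * th) /\
    x * response x k.+2 = 1 - cos (k.+1%:R * th) by [].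
elim: k => [|k [IH1 IH2]].
  rewrite /response /= mul0r cos0 mul1r cx; split; ring.
split=> //.
have -> : response x k.+3 = 2 * (1 - 2 * x) * response x k.+2 - response x k.+1 + 4.
  by [].
rewrite mulrDr mulrBr [x * (_ * _)]mulrCA IH2 IH1 -cx.
have -> : k.+2%:R * th = k.+1%:R * th + th by rewrite -natr1; ring.
have -> : k%:R * th = k.+1%:R * th - th by rewrite -natr1; ring.
rewrite cosB cosD cx.
have -> : x * 4 = 2 * (1 - cos th) by rewrite cx; ring.
rewrite cx; ring.
Qed.

(** [perturbed_chebyshev] with the constant 4 as perturbation gives 2k + 4k^2. *)
Lemma response_bound (x : R) k : 0 <= x <= 1 -> `|response x k.+1| <= 6 * k%:R ^+ 2.
Proof.
move=> x01.
have := @perturbed_chebyshev (1 - 2 * x) 2 4 (response x) (fun _ => 4) k.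
move=> /(_ _ _ _ _ _ k (leqnn _)) H.
apply: le_trans (H _ _ _ _ _) _ => //; first lra.
- by rewrite ger0_norm.
- by move=> j _; rewrite ger0_norm.
case: k {H} => [|k]; first by rewrite expr0n !mul0r mulr0 addr0.
have : 1 <= k.+1%:R :> R by rewrite ler1n.
nra.
Qed.

End Recurrence.

Section Iteration.
Variables (R : realType) (n d : nat) (A : 'M[R]_(n, d)).
Variables (lam : 'I_d -> R) (nu : 'I_d -> 'cV[R]_d).
Hypothesis hA : eigensystem A lam nu.
Hypothesis lam1 : forall i, lam i <= 1.
Variables (a : 'cV[R]_d) (fs : nat -> 'cV[R]_d).
Hypothesis fs0 : fs 0%N = 2 *: a.
Hypothesis fs1 : fs 1%N = 0.

(** The sequence [fs] is kept abstract: it obeys the vector form of the recurrence of [response],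
    with A^T A for x and the vector a as source, up to this error. *)
Definition defect k : 'cV[R]_d :=
  fs k.+2 - (2 *: fs k.+1 - 4 *: (A^T *m A *m fs k.+1) - fs k + 4 *: a).

Let lam01 i : 0 <= lam i <= 1.
Proof. by rewrite (lam_ge0 hA) lam1. Qed.

Lemma dot_fs_rec i k : dot (nu i) (fs k.+2) =
  2 * (1 - 2 * lam i) * dot (nu i) (fs k.+1) - dot (nu i) (fs k)
  + (4 * dot (nu i) a + dot (nu i) (defect k)).
Proof.
rewrite /defect dotBr dotDr dotBr dotBr !dotZr (dot_nu_gram hA); ring.
Qed.

(** An a priori bound, with source and defect together as the perturbation. For the distance to the
    exact response, [dot_fs_response] subtracts the exact solution: only the defect is left, and the
    initial error is 0. *)
Lemma dot_fs_bound K eta i : 0 <= eta ->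
  (forall k, (k < K)%N -> `|dot (nu i) (defect k)| <= eta) ->
  forall k, (k <= K)%N ->
  `|dot (nu i) (fs k.+1)| <= k%:R * (2 * `|dot (nu i) a|) + k%:R ^+ 2 * (4 * `|dot (nu i) a| + eta).
Proof.
move=> eta0 He k kK.
apply: (@perturbed_chebyshev _ (1 - 2 * lam i) _ _ (fun k => dot (nu i) (fs k))
  (fun k => 4 * dot (nu i) a + dot (nu i) (defect k)) K) => //.
- have := lam01 i; lra.
- by rewrite addr_ge0 ?mulr_ge0.
- by rewrite fs0 dotZr normrM ger0_norm.
- by rewrite fs1 /dot mulmx0 mxE.
- move=> j jK; split; first exact: dot_fs_rec.
  apply: le_trans (ler_normD _ _) _; apply: lerD; last exact: He.
  by rewrite normrM ger0_norm.
Qed.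

Lemma dot_fs_response K eta i : 0 <= eta ->
  (forall k, (k < K)%N -> `|dot (nu i) (defect k)| <= eta) ->
  forall k, (k <= K)%N ->
  `|dot (nu i) (fs k.+1) - response (lam i) k.+1 * dot (nu i) a| <= k%:R ^+ 2 * eta.
Proof.
move=> eta0 He k kK.
rewrite -[leRHS]add0r -(mulr0 k%:R).
apply: (@perturbed_chebyshev _ (1 - 2 * lam i) _ _
  (fun k => dot (nu i) (fs k) - response (lam i) k * dot (nu i) a)
  (fun k => dot (nu i) (defect k)) K) => //.
- have := lam01 i; lra.
- by rewrite fs0 dotZr /response /= subrr normr0.
- by rewrite fs1 /response /= mul0r subr0 /dot mulmx0 mxE.
- move=> j jK; split; last exact: He.
  rewrite dot_fs_rec /response /=; ring.
Qed.

Variables (b : 'cV[R]_n) (sigma : R).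
Hypothesis ab : A^T *m b = sigma *: a.

(** Here lam q = s(0) - s(th). Below the gap this is at most [del] in size, while q may reach 6 N^3
    by [response_bound]; so q^2 lam is at most their product, which is the choice of [tau]. The
    assumption on 24 N^4 says that [tau] is at most (eps / 2)^2. *)
Lemma pcr_success_of_iteration (lambda gamma eps eta : R) (m p : nat) (r : nat -> R) :
  let N := (2 * p * m)%N in
  0 < lambda < 1 -> 0 < gamma < 1 -> 0 < eps < 1 -> 0 <= eta -> 0 <= sigma -> (0 < p)%N ->
  (0 < m)%N ->
  24 * N%:R ^+ 4 <= eps ^+ 2 * 4 ^+ p ->
  \sum_(k < N) `|r k| <= N%:R ->
  (forall x, let s := \sum_(k < N) r k * cos (k%:R * x) in
    [/\ 0 <= s <= 1,
        1 - 2 * (1 - gamma) * lambda <= cos x -> 1 - N%:R * 4 ^- p <= s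
      & cos x <= 1 - 2 * (1 + gamma) * lambda -> s <= N%:R * 4 ^- p]) ->
  (forall i k, (k < N)%N -> `|dot (nu i) (defect k)| <= eta) ->
  d%:R * (sigma * (N%:R ^+ 3 * eta)) <= eps / 2 * l2norm b ->
  pcr_success A lam nu lambda gamma eps b (sigma *: (\sum_(k < N) r k *: fs k.+1)).
Proof.
move=> N /andP[l0 l1] /andP[g0 g1] /andP[e0 e1] eta0 sg0 p0 m0 hN rN hr He hd.
have N0 : (0 < N)%N by rewrite !muln_gt0 p0.
have N1 : 1 <= N%:R :> R by rewrite ler1n.
set del := N%:R * 4 ^- p in hr.
have p4 : 0 < 4 ^+ p :> R by rewrite exprn_gt0.
have del0 : 0 <= del by rewrite mulr_ge0 ?invr_ge0 // ltW.
pose s x := \sum_(k < N) r k * cos (k%:R * x).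
pose th i := acos (1 - 2 * lam i).
have cth i : cos (th i) = 1 - 2 * lam i.
  by apply: acosK; rewrite in_itv /=; have := lam01 i; lra.
pose q i := \sum_(k < N) r k * response (lam i) k.+1.
have lq i : lam i * q i = s 0 - s (th i).
  rewrite /q /s mulr_sumr -sumrB; apply: eq_bigr => k _.
  by rewrite mulrCA (responseE _ (cth i)) mulr0 cos0; ring.
have [s0_01 s0_lo _] := hr 0; rewrite -/(s 0) cos0 in s0_01 s0_lo.
have {}s0_lo : 1 - del <= s 0 by apply: s0_lo; nra.
have s01 i : 0 <= s (th i) <= 1 by have [] := hr (th i).
pose tau := 6 * N%:R ^+ 3 * del.
have N3 : 1 <= N%:R ^+ 3 :> R by rewrite exprn_ege1.
have tau6 : 6 * del <= tau by rewrite /tau; nra.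
have taueps : tau <= (eps / 2) ^+ 2.
  have -> : tau = 6 * N%:R ^+ 4 / 4 ^+ p by rewrite /tau /del; ring.
  rewrite ler_pdivrMr // expr_div_n; lra.
have d1 : del <= 1.
  have N4 : N%:R <= N%:R ^+ 4 :> R by rewrite ler_eXnr.
  rewrite /del ler_pdivrMr // mul1r.
  have : eps ^+ 2 * 4 ^+ p <= 1 * 4 ^+ p.
    by rewrite ler_wpM2r ?(ltW p4) // expr_le1 // ltW.
  lra.
apply: (@pcr_success_of_filter _ _ _ _ _ _ hA b lambda gamma eps tau
   (sigma * (N%:R ^+ 3 * eta)) q) => //.
- by lra.
- exact: ltW.
- by rewrite !mulr_ge0 // exprn_ge0.
- move=> i; rewrite lq; have := s01 i; nra.
- move=> i hi; rewrite lq; have := s01 i.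
  have [_ _ /(_ _)] := hr (th i); rewrite -/(s _) cth => H.
  have {}H : s (th i) <= del by apply: H; lra.
  nra.
- move=> i hi.
  have [_ H _] := hr (th i); rewrite -/(s _) cth in H.
  have {}H : 1 - del <= s (th i) by apply: H; lra.
  have qN : `|q i| <= 6 * N%:R ^+ 3.
    apply: le_trans (ler_norm_sum _ _ _) _.
    apply: (@le_trans _ _ (\sum_(k < N) `|r k| * (6 * N%:R ^+ 2))).
      apply: ler_sum => k _; rewrite normrM ler_wpM2l //.
      apply: le_trans (response_bound _ (lam01 i)) _.
      by rewrite ler_wpM2l // lerXn2r ?nnegrE // ler_nat ltnW.
    rewrite -mulr_suml; apply: le_trans (ler_wpM2r _ rN) _; last by nra.
    by rewrite mulr_ge0 // exprn_ge0.
  apply: le_trans (ler_norm _) _.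
  have -> : q i ^+ 2 * lam i = q i * (lam i * q i) by ring.
  rewrite normrM /tau; apply: ler_pM => //.
  rewrite lq ler_norml; have := s01 i; lra.
- move=> i; rewrite ab !dotZr dot_sumr /q mulrCA -mulrBr normrM (ger0_norm sg0).
  rewrite ler_wpM2l // mulr_suml -sumrB.
  apply: le_trans (ler_norm_sum _ _ _) _.
  apply: (@le_trans _ _ (\sum_(k < N) `|r k| * (N%:R ^+ 2 * eta))).
    apply: ler_sum => k _; rewrite dotZr -mulrA -mulrBr normrM ler_wpM2l //.
    apply: le_trans (dot_fs_response eta0 (fun k => He i k) (ltnW (ltn_ord k))) _.
    by rewrite ler_wpM2r // lerXn2r ?nnegrE // ler_nat ltnW.
  rewrite -mulr_suml; apply: le_trans (ler_wpM2r _ rN) _; last by nra.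
  by rewrite mulr_ge0 // exprn_ge0.
Qed.

End Iteration.

(** * The rounded iteration *)

(** [quant] is the integer handled by the program, [rnd] the number it stands for. *)
Definition quant (R : realType) (H x : R) : R := (Num.floor (H * x))%:~R.
Definition rnd (R : realType) (H x : R) : R := quant H x / H.

Section Rounding.
Variable R : realType.
Implicit Types H x y z : R.

Lemma quant_itv H x : quant H x <= H * x < quant H x + 1.
Proof. by have := Num.Theory.floor_itv (H * x); rewrite intrD. Qed.

Lemma rnd_err H x : 0 < H -> `|rnd H x - x| <= H^-1.
Proof.
move=> H0; have := quant_itv H x; rewrite /rnd => /andP[h1 h2].
have -> : quant H x / H - x = (quant H x - H * x) / H by field; rewrite gt_eqF.
rewrite normrM [`|H^-1|]ger0_norm ?invr_ge0 ?(ltW H0) //.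
rewrite ler_piMl ?invr_ge0 ?(ltW H0) // ler_norml; lra.
Qed.

Lemma quant_le (h : nat) x : `|x| <= 1 -> `|quant h%:R x| <= h%:R.
Proof.
rewrite ler_norml => /andP[x1 x2].
have hn0 : 0 <= h%:R :> R by [].
rewrite ler_norml /quant; apply/andP; split.
  rewrite -[X in - X]/(h%:Z%:~R) -mulrNz ler_int floor_ge_int mulrNz.
  by rewrite -mulrN1 ler_wpM2l.
rewrite -[leRHS]/(h%:Z%:~R) ler_int -ltzD1 floor_lt_int intrD.
have : h%:R * x <= h%:R * 1 by rewrite ler_wpM2l.
by rewrite mulr1 -[h%:~R]/(h%:R); lra.
Qed.

(** Replace one factor at a time: the two changes in front of z' cost 2hF each, the last one h. *)
Lemma prod3_err h F x y z x' y' z' :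
  0 <= h <= 1 -> 1 <= F -> `|x| <= 1 -> `|y| <= 1 -> `|x'| <= 1 -> `|y'| <= 1 ->
  `|z| <= F -> `|x' - x| <= h -> `|y' - y| <= h -> `|z' - z| <= h ->
  `|x * y * z - x' * y' * z'| <= 5 * h * F.
Proof.
move=> /andP[h0 h1] F1 x1 y1 x1' y1' zF dx dy dz.
have zF' : `|z'| <= 2 * F.
  have -> : z' = (z' - z) + z by ring.
  by apply: le_trans (ler_normD _ _) _; lra.
have -> : x * y * z - x' * y' * z' =
  - ((x' - x) * y' * z' + x * (y' - y) * z' + x * y * (z' - z)) by ring.
rewrite normrN.
apply: le_trans (ler_normD _ _) _.
apply: le_trans (lerD (ler_normD _ _) (lexx _)) _.
rewrite !normrM.
have A1 : `|x' - x| * `|y'| * `|z'| <= h * 1 * (2 * F).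
  by apply: ler_pM; rewrite ?mulr_ge0 //; apply: ler_pM.
have A2 : `|x| * `|y' - y| * `|z'| <= 1 * h * (2 * F).
  by apply: ler_pM; rewrite ?mulr_ge0 //; apply: ler_pM.
have A3 : `|x| * `|y| * `|z' - z| <= 1 * 1 * h.
  by apply: ler_pM; rewrite ?mulr_ge0 //; apply: ler_pM.
have : h * 1 <= h * F by rewrite ler_wpM2l.
lra.
Qed.

End Rounding.

Section RoundedIteration.
Variables (R : realType) (n d : nat) (A : 'M[R]_(n, d)) (H : R) (a : 'cV[R]_d).

Definition rnd_mx : 'M[R]_(n, d) := map_mx (rnd H) A.

(** Only the matrix and the vector it multiplies are rounded; the linear combination is exact. The
    defect is therefore that of the Gram product alone. *)
Fixpoint iterate2 (k : nat) : 'cV[R]_d * 'cV[R]_d :=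
  if k is k'.+1 then
    let p := iterate2 k' in
    (p.2, 2 *: p.2 - 4 *: (rnd_mx^T *m rnd_mx *m map_mx (rnd H) p.2) - p.1 + 4 *: a)
  else (2 *: a, 0).

Definition iterate k := (iterate2 k).1.

Lemma iterateSS k : iterate k.+2 =
  2 *: iterate k.+1 - 4 *: (rnd_mx^T *m rnd_mx *m map_mx (rnd H) (iterate k.+1))
  - iterate k + 4 *: a.
Proof. by []. Qed.

End RoundedIteration.

Section RoundedAnalysis.
Variables (R : realType) (n d : nat) (A : 'M[R]_(n, d)).
Variables (lam : 'I_d -> R) (nu : 'I_d -> 'cV[R]_d).
Hypothesis hA : eigensystem A lam nu.
Hypothesis lam1 : forall i, lam i <= 1.
Hypothesis dn : (d <= n)%N.

Lemma norm_nu_le1 i c : `|nu i c 0| <= 1.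
Proof.
apply: norm_le_sqr => //; rewrite expr1n.
have <- : dot (nu i) (nu i) = 1 by rewrite (dot_nu hA) eqxx.
rewrite dotE (bigD1 c) //=.
by rewrite expr2 lerDl; apply: sumr_ge0 => j _; rewrite -expr2 sqr_ge0.
Qed.

(** All eigenvalues are at most 1, so A does not lengthen the unit vector of column j, and the entry
    is a coordinate of its image. *)
Lemma norm_entry_le1 i j : `|A i j| <= 1.
Proof.
apply: norm_le_sqr => //; rewrite expr1n.
pose e : 'cV[R]_d := delta_mx j 0.
have Ae k : (A *m e) k 0 = A k j.
  rewrite mxE (bigD1 j) //= big1 ?addr0 => [|l lj]; first by rewrite mxE !eqxx mulr1.
  by rewrite mxE (negPf lj) mulr0.
have ee : dot e e = 1.
  rewrite dotE (bigD1 j) //= big1 ?addr0 => [|l lj]; first by rewrite mxE !eqxx mulr1.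
  by rewrite mxE (negPf lj) mulr0.
have : dot (A *m e) (A *m e) <= dot e e.
  rewrite (dot_gram hA) (dot_parseval hA); apply: ler_sum => k _.
  by rewrite ler_piMl // -expr2 sqr_ge0.
rewrite ee; apply: le_trans; rewrite dotE (bigD1 i) //= Ae expr2 lerDl.
by apply: sumr_ge0 => k _; rewrite -expr2 sqr_ge0.
Qed.

(** Passing between eigencoordinates and entries costs a factor d either way; such losses only raise
    the precision H. *)
Lemma dot_nu_le i (x : 'cV[R]_d) (B : R) : (forall c, `|x c 0| <= B) -> `|dot (nu i) x| <= d%:R * B.
Proof.
move=> xB; rewrite dotE; apply: le_trans (ler_norm_sum _ _ _) _.
rewrite mulr_natl -[X in _ *+ X]card_ord -sumr_const; apply: ler_sum => c _.
rewrite normrM; apply: le_trans (xB c); rewrite ler_piMl // norm_nu_le1 //.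
Qed.

Lemma entry_le (x : 'cV[R]_d) (B : R) c : (forall i, `|dot (nu i) x| <= B) -> `|x c 0| <= d%:R * B.
Proof.
move=> xB; rewrite [x](nu_complete hA) summxE; apply: le_trans (ler_norm_sum _ _ _) _.
rewrite mulr_natl -[X in _ *+ X]card_ord -sumr_const; apply: ler_sum => i _.
rewrite mxE normrM; apply: le_trans (xB i); rewrite ler_piMr // norm_nu_le1 //.
Qed.

Variables (a : 'cV[R]_d) (h N : nat).
Hypothesis a1 : \sum_c `|a c 0| <= 1.
Hypothesis h0 : (0 < h)%N.
Hypothesis N0 : (0 < N)%N.
Hypothesis hbig : 140 * n%:R ^+ 4 * N%:R ^+ 2 <= h%:R :> R.

Let H : R := h%:R.
(** With [eta] and the coordinates of a at most 1, [dot_fs_bound] gives 2k + 5k^2, at most 7 N^2;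
    the factor n pays for the passage to entries. *)
Let F : R := 7 * n%:R * N%:R ^+ 2.
Let eta : R := 140 * n%:R ^+ 4 * N%:R ^+ 2 / H.
Let fs := iterate A H a.

Let H1 : 1 <= H. Proof. by rewrite /H ler1n. Qed.
Let H_gt0 : 0 < H. Proof. exact: lt_le_trans H1. Qed.

Lemma rnd_mx_le1 i j : `|rnd_mx A H i j| <= 1.
Proof.
rewrite mxE /rnd normrM [`|H^-1|]ger0_norm ?invr_ge0 ?(ltW H_gt0) //.
by rewrite ler_pdivrMr // mul1r quant_le // norm_entry_le1.
Qed.

Lemma dot_defect_le i k : (0 < d)%N -> (forall c, `|fs k.+1 c 0| <= F) ->
  `|dot (nu i) (defect A a fs k)| <= eta.
Proof.
move=> d0 fF.
have n1 : 1 <= n%:R :> R by rewrite ler1n (leq_trans d0).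
have N1 : 1 <= N%:R :> R by rewrite ler1n.
have dnR : d%:R <= n%:R :> R by rewrite ler_nat.
have F1 : 1 <= F.
  have : 1 <= N%:R ^+ 2 :> R by rewrite exprn_ege1.
  rewrite /F; nra.
have hi : 0 <= H^-1 <= 1 by rewrite invr_ge0 ltW //= invf_le1.
have Hi0 : 0 <= H^-1 by case/andP: hi.
have -> : defect A a fs k =
  4 *: (A^T *m A *m fs k.+1 - (rnd_mx A H)^T *m rnd_mx A H *m map_mx (rnd H) (fs k.+1)).
  by rewrite /defect /fs iterateSS; apply/colP => c; rewrite !mxE; ring.
apply: (@le_trans _ _ (d%:R * (4 * (d%:R * (n%:R * (5 * H^-1 * F)))))).
  apply: dot_nu_le => c; rewrite mxE normrM ger0_norm // ler_wpM2l //.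
  rewrite -!mulmxA.
  have -> : (A^T *m (A *m fs k.+1) -
     (rnd_mx A H)^T *m (rnd_mx A H *m map_mx (rnd H) (fs k.+1))) c 0 =
     \sum_j \sum_i (A i c * A i j * fs k.+1 j 0 -
       rnd_mx A H i c * rnd_mx A H i j * rnd H (fs k.+1 j 0)).
    rewrite exchange_big /= !mxE -sumrB; apply: eq_bigr => l _.
    rewrite !mxE !mulr_sumr -sumrB; apply: eq_bigr => j _.
    by rewrite !mxE; ring.
  apply: le_trans (ler_norm_sum _ _ _) _.
  rewrite mulr_natl -[X in _ *+ X]card_ord -sumr_const; apply: ler_sum => j _.
  apply: le_trans (ler_norm_sum _ _ _) _.
  rewrite mulr_natl -[X in _ *+ X]card_ord -sumr_const; apply: ler_sum => l _.
  by apply: prod3_err; rewrite ?norm_entry_le1 ?rnd_mx_le1 // ?mxE rnd_err.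
have -> : d%:R * (4 * (d%:R * (n%:R * (5 * H^-1 * F)))) =
  (140 * n%:R ^+ 2 * N%:R ^+ 2 / H) * d%:R ^+ 2 by rewrite /F; ring.
have -> : eta = (140 * n%:R ^+ 2 * N%:R ^+ 2 / H) * n%:R ^+ 2 by rewrite /eta; ring.
apply: ler_wpM2l; last by rewrite lerXn2r ?nnegrE.
by rewrite !mulr_ge0 ?exprn_ge0.
Qed.

Let eta0 : 0 <= eta.
Proof. by rewrite /eta !mulr_ge0 ?invr_ge0 ?exprn_ge0 ?(ltW H_gt0). Qed.

Let eta1 : eta <= 1.
Proof. by rewrite /eta ler_pdivrMr // mul1r. Qed.

(** The defect bound presupposes small iterates and the bound on iterates presupposes small earlier
    defects, so both are proved in one induction. *)
Lemma iterate_bound k : (0 < d)%N -> (k <= N)%N ->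
  (forall c, `|fs k.+1 c 0| <= F) /\
  (forall i j, (j <= k)%N -> `|dot (nu i) (defect A a fs j)| <= eta).
Proof.
move=> d0.
have step j : (j <= N)%N ->
    (forall i l, (l < j)%N -> `|dot (nu i) (defect A a fs l)| <= eta) ->
    forall c, `|fs j.+1 c 0| <= F.
  move=> jN He c.
  have al1 i : `|dot (nu i) a| <= 1.
    apply: le_trans a1; rewrite dotE; apply: le_trans (ler_norm_sum _ _ _) _.
    apply: ler_sum => l _; rewrite normrM ler_piMl // norm_nu_le1 //.
  have fsB i : `|dot (nu i) (fs j.+1)| <= 7 * N%:R ^+ 2.
    apply: le_trans (dot_fs_bound hA lam1 (erefl _) (erefl _) eta0 (He i) (leqnn j)) _.
    have j1 : j%:R <= j%:R ^+ 2 :> R.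
      by case: (j) => [|l]; rewrite ?expr0n // ler_eXnr // ler1n.
    have jN2 : j%:R ^+ 2 <= N%:R ^+ 2 :> R by rewrite lerXn2r ?nnegrE // ler_nat.
    have := al1 i; have := normr_ge0 (dot (nu i) a).
    set al := `|_|; move=> al0 al1i.
    have : j%:R * (2 * al) <= j%:R ^+ 2 * 2.
      by apply: ler_pM => //; lra.
    have : j%:R ^+ 2 * (4 * al + eta) <= j%:R ^+ 2 * 5.
      by apply: ler_wpM2l; [rewrite exprn_ge0|move: eta1; lra].
    lra.
  apply: le_trans (entry_le c fsB) _.
  rewrite /F -mulrA mulrCA ler_wpM2l //.
  by rewrite ler_wpM2r ?exprn_ge0 // ler_nat.
elim: k => [|k IH] kN.
  have f0 := step 0%N kN (fun i l (l0 : (l < 0)%N) => ltac:(by [])).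
  split=> // i j; rewrite leqn0 => /eqP ->; exact: dot_defect_le.
have [_ He] := IH (ltnW kN).
have fk := step k.+1 kN (fun i l lk => He i l lk).
split=> // i j; rewrite leq_eqVlt ltnS => /orP[/eqP ->|]; last exact: He.
exact: dot_defect_le.
Qed.

End RoundedAnalysis.

Section RoundedPCR.
Variables (R : realType) (n d : nat) (A : 'M[R]_(n, d)).
Variables (lam : 'I_d -> R) (nu : 'I_d -> 'cV[R]_d).
Hypothesis hA : eigensystem A lam nu.
Hypothesis lam1 : forall i, lam i <= 1.
Hypothesis dn : (d <= n)%N.

Lemma norm_dot_AtB_le b i : `|dot (nu i) (A^T *m b)| <= l2norm b.
Proof.
have bes := bessel hA b; apply: norm_le_sqr (l2norm_ge0 _) _.
apply: le_trans bes; rewrite (bigD1 i) //=.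
have [l0|l0] := eqVneq (lam i) 0.
  rewrite (al0 hA) // expr0n mul0r add0r; apply: sumr_ge0 => j _.
  by rewrite divr_ge0 ?sqr_ge0 ?(lam_ge0 hA).
apply: (@le_trans _ _ (dot (nu i) (A^T *m b) ^+ 2 / lam i)).
  have lp : 0 < lam i by rewrite lt_def l0 (lam_ge0 hA).
  by rewrite ler_pdivlMr // ler_piMr ?sqr_ge0.
rewrite lerDl; apply: sumr_ge0 => j _.
by rewrite divr_ge0 ?sqr_ge0 ?(lam_ge0 hA).
Qed.

Lemma sum_AtB_le b : \sum_c `|(A^T *m b) c 0| <= d%:R ^+ 2 * l2norm b.
Proof.
apply: (@le_trans _ _ (\sum_(c < d) d%:R * l2norm b)).
  by apply: ler_sum => c _; apply: (entry_le hA) => i; apply: norm_dot_AtB_le.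
by rewrite sumr_const card_ord -[leLHS]mulr_natl expr2 mulrA.
Qed.

End RoundedPCR.

(** * Timed big-step semantics *)

(* Coin-free programs are deterministic: [bigstep p s s' t] says that p leads
   from s to s' in exactly t time units. *)
Inductive bigstep (R : realType) : cmd -> state R -> state R -> nat -> Prop :=
| bs_skip s : bigstep Skip s s 0
| bs_nstore a i e s :
    bigstep (NStore a i e) s
      (State (upd (nmem s) a (neval s i) (neval s e)) (rmem s)) (ncost i + ncost e).+1
| bs_rstore a i e s :
    bigstep (RStore a i e) s
      (State (nmem s) (upd (rmem s) a (neval s i) (reval s e))) (ncost i + rcost e).+1
| bs_seq p1 p2 s1 s2 s3 t1 t2 :
    bigstep p1 s1 s2 t1 -> bigstep p2 s2 s3 t2 -> bigstep (Seq p1 p2) s1 s3 (t1 + t2)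
| bs_if g p1 p2 s s' t :
    bigstep (if teval s g then p1 else p2) s s' t -> bigstep (If g p1 p2) s s' (tcost g + t)
| bs_while_end g p s : ~~ teval s g -> bigstep (While g p) s s (tcost g)
| bs_while_step g p s1 s2 s3 t1 t2 :
    teval s1 g -> bigstep p s1 s2 t1 -> bigstep (While g p) s2 s3 t2 ->
    bigstep (While g p) s1 s3 (tcost g + t1 + t2).

Section Bigstep.
Variable R : realType.
Implicit Types (s : state R) (p : cmd).

Lemma run_then_ret c (f : config R -> fdist R (outcome R)) :
  run_then (dret R (Some c)) f = f c.
Proof.
rewrite /run_then /dbind /dret /= cats0 -[RHS]map_id.
by apply: eq_map => -[x o] /=; rewrite mul1r.
Qed.

Lemma tcost_gt0 g : (0 < tcost g)%N.
Proof. by case: g. Qed.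

Lemma exec_bigstep p s s' t : bigstep p s s' t ->
  forall fuel k, (t < fuel)%N -> exec fuel p (s, k) = dret R (Some (s', (k + t)%N)).
Proof.
move=> H.
(* Inside a loop the fuel left for iterations drops while the fuel of the body does not, so the
   induction needs two separate amounts. *)
suff [//] : (forall fuel k, (t < fuel)%N ->
    exec fuel p (s, k) = dret R (Some (s', (k + t)%N))) /\
  (if p is While g q then
    forall fuel fuel' k, (t < fuel)%N -> (t < fuel')%N ->
      loop fuel' g (exec fuel q) (s, k) = dret R (Some (s', (k + t)%N)) else True).
elim: {p s s' t} H => //=.
- by move=> s; split=> // fuel k _; rewrite addn0.
- move=> p1 p2 s1 s2 s3 t1 t2 _ [IH1 _] _ [IH2 _]; split=> // fuel k tf.
  by rewrite IH1 ?run_then_ret ?IH2 ?addnA //; lia.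
- move=> g p1 p2 s s' t; rewrite /tick /= => _ [IH _]; split=> // fuel k tf.
  by rewrite IH ?addnA //; lia.
- move=> g p s gs.
  suff L fuel fuel' k : (tcost g < fuel')%N ->
      loop fuel' g (exec fuel p) (s, k) = dret R (Some (s, (k + tcost g)%N)).
    by split=> [fuel k tf|fuel fuel' k _]; apply: L.
  by case: fuel' => // fuel' _ /=; rewrite (negPf gs).
move=> g p s1 s2 s3 t1 t2 gs _ [IH1 _] _ [_ IH2].
suff L fuel fuel' k : (tcost g + t1 + t2 < fuel)%N -> (tcost g + t1 + t2 < fuel')%N ->
    loop fuel' g (exec fuel p) (s1, k) = dret R (Some (s3, (k + (tcost g + t1 + t2))%N)).
  by split=> [fuel k tf|]; [apply: L|exact: L].
have := tcost_gt0 g; case: fuel' => // fuel' g0 tf tf' /=; rewrite gs /tick /=.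
rewrite IH1 ?run_then_ret ?IH2; last by lia.
- by congr (dret R (Some (_, _))); lia.
- by lia.
- by lia.
Qed.

Lemma prob_halts_bigstep p s s' t T (E : set (state R)) :
  bigstep p s s' t -> (t <= T)%N -> E s' -> prob_halts T p s E = 1.
Proof.
move=> H tT Es'; rewrite /prob_halts (exec_bigstep H) // /dprob /dret big_mkcond big_seq1.
by case: asboolP => // -[]; exists (s', t).
Qed.

Fixpoint nwrites (p : cmd) : seq nat :=
  match p with
  | NStore a _ _ => [:: a]
  | Seq p1 p2 | If _ p1 p2 | Flip _ p1 p2 => nwrites p1 ++ nwrites p2
  | While _ p1 => nwrites p1
  | _ => [::]
  end.

Fixpoint rwrites (p : cmd) : seq nat :=
  match p with
  | RStore a _ _ => [:: a]
  | Seq p1 p2 | If _ p1 p2 | Flip _ p1 p2 => rwrites p1 ++ rwrites p2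
  | While _ p1 => rwrites p1
  | _ => [::]
  end.

(** Preservation is recorded for whole arrays, so that it can be read off from the syntax and proved
    by computation on concrete programs. *)
Definition frame p s s' : Prop :=
  (forall a, a \notin nwrites p -> nmem s' a = nmem s a) /\
  (forall a, a \notin rwrites p -> rmem s' a = rmem s a).

Lemma frame_trans p s1 s2 s3 : frame p s1 s2 -> frame p s2 s3 -> frame p s1 s3.
Proof.
move=> [n12 r12] [n23 r23]; split=> a aw; first by rewrite n23 ?n12.
by rewrite r23 ?r12.
Qed.

Lemma frame_bigstep p s s' t : bigstep p s s' t -> frame p s s'.
Proof.
elim=> {p s s' t} //=.
- move=> a i e s; split=> //= a'; rewrite inE => /negPf aa'.
  by apply/funext => j; rewrite /upd aa'.
- move=> a i e s; split=> //= a'; rewrite inE => /negPf aa'.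
  by apply/funext => j; rewrite /upd aa'.
- move=> p1 p2 s1 s2 s3 t1 t2 _ [n1 r1] _ [n2 r2].
  by split=> a /=; rewrite mem_cat negb_or => /andP[a1 a2]; rewrite ?n2 ?n1 ?r2 ?r1.
- move=> g p1 p2 s s' t _ [n1 r1].
  split=> a /=; rewrite mem_cat negb_or => /andP[a1 a2]; rewrite ?n1 ?r1 //;
  by case: ifP.
- move=> g p s1 s2 s3 t1 t2 _ _ F1 _ F2; exact: frame_trans F1 F2.
Qed.

Definition wp p (T : nat) (Q : state R -> Prop) s : Prop :=
  exists s' t, [/\ bigstep p s s' t, (t <= T)%N & Q s'].

Lemma wp_le p T T' (Q : state R -> Prop) s : wp p T Q s -> (T <= T')%N -> wp p T' Q s.
Proof. by move=> [s' [t [B tT q]]] TT; exists s', t; split=> //; apply: leq_trans TT. Qed.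

Lemma wp_conseq p T (Q Q' : state R -> Prop) s :
  wp p T Q s -> (forall s', frame p s s' -> Q s' -> Q' s') -> wp p T Q' s.
Proof.
by move=> [s' [t [B tT q]]] QQ; exists s', t; split=> //; apply: QQ q; apply: frame_bigstep B.
Qed.

Lemma wp_skip (Q : state R -> Prop) s : Q s -> wp Skip 0 Q s.
Proof. by move=> q; exists s, 0%N; split=> //; constructor. Qed.

Lemma wp_nstore a i e (Q : state R -> Prop) s :
  Q (State (upd (nmem s) a (neval s i) (neval s e)) (rmem s)) ->
  wp (NStore a i e) (ncost i + ncost e).+1 Q s.
Proof. by move=> q; eexists; eexists; split; [exact: bs_nstore|by []|]. Qed.

Lemma wp_rstore a i e (Q : state R -> Prop) s :
  Q (State (nmem s) (upd (rmem s) a (neval s i) (reval s e))) ->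
  wp (RStore a i e) (ncost i + rcost e).+1 Q s.
Proof. by move=> q; eexists; eexists; split; [exact: bs_rstore|by []|]. Qed.

Lemma wp_seq p1 p2 T1 T2 (Q : state R -> Prop) s :
  wp p1 T1 (wp p2 T2 Q) s -> wp (Seq p1 p2) (T1 + T2) Q s.
Proof.
move=> [s1 [t1 [B1 l1 [s2 [t2 [B2 l2 q]]]]]]; exists s2, (t1 + t2)%N.
by split=> //; [exact: bs_seq B1 B2|exact: leq_add].
Qed.

Lemma wp_if g p1 p2 T1 T2 (Q : state R -> Prop) s :
  (teval s g -> wp p1 T1 Q s) -> (~~ teval s g -> wp p2 T2 Q s) ->
  wp (If g p1 p2) (tcost g + (T1 + T2)) Q s.
Proof.
move=> h1 h2; have [s' [t [B l q]]] : wp (if teval s g then p1 else p2) (T1 + T2) Q s.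
  case: ifPn => [/h1|/h2] h; apply: wp_le h _; [exact: leq_addr|exact: leq_addl].
by exists s', (tcost g + t)%N; split=> //; [exact: bs_if|rewrite leq_add2l].
Qed.

Lemma wp_while g p (I : nat -> state R -> Prop) m T (Q : state R -> Prop) s :
  I 0%N s ->
  (forall i s', (i < m)%N -> frame p s s' -> I i s' -> teval s' g /\ wp p T (I i.+1) s') ->
  (forall s', frame p s s' -> I m s' -> ~~ teval s' g /\ Q s') ->
  wp (While g p) (m * (T + tcost g) + tcost g) Q s.
Proof.
move=> I0 Istep Iend.
have L k : (k <= m)%N -> forall s', frame p s s' -> I (m - k)%N s' ->
    wp (While g p) (k * (T + tcost g) + tcost g) Q s'.
  elim: k => [|k IH] km s' F Is'.
    rewrite subn0 in Is'; have [gs q] := Iend s' F Is'.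
    by exists s', (tcost g); split=> //; exact: bs_while_end.
  have lt : (m - k.+1 < m)%N by lia.
  have [gs [s1 [t1 [B1 l1 I1]]]] := Istep _ s' lt F Is'.
  have F1 := frame_trans F (frame_bigstep B1).
  have [] := IH (ltnW km) s1 F1; first by rewrite (_ : (m - k = (m - k.+1).+1)%N) //; lia.
  move=> s2 [t2 [B2 l2 q]]; exists s2, (tcost g + t1 + t2)%N; split=> //.
    exact: bs_while_step B1 B2.
  by rewrite mulSn; lia.
by apply: L => //; rewrite subnn.
Qed.

End Bigstep.

Local Notation nsc a := (NRead a (NConst 0)).
Local Notation rsc a := (RRead a (NConst 0)).
Local Notation rnat k := (ROfNat (NConst k)).
Local Notation "p ;; q" := (Seq p q) (at level 60, right associativity).

(* Array 6 holds a power of two Q; for -Q <= y < Q in array 18, bisection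
   leaves the floor of y in array 16. *)
Definition floor_cmd : cmd :=
  RStore 16 (NConst 0) (RSub (rnat 0) (rsc 6)) ;;
  RStore 17 (NConst 0) (rsc 6) ;;
  While (RLe (rnat 1) (rsc 17))
   (If (RLe (RAdd (rsc 16) (rsc 17)) (rsc 18))
       (RStore 16 (NConst 0) (RAdd (rsc 16) (rsc 17))) Skip ;;
    RStore 17 (NConst 0) (RDiv (rsc 17) (rnat 2))).

Definition floor_time (q : nat) : nat := 40 * (q + 2).

(** The bracket around y has an integer left end and twice the current step as length. The step runs
    from 2^q down to 1, hence q + 1 rounds, after which the length is 1. *)
Lemma wp_floor (R : realType) (s : state R) (q : nat) :
  rmem s 6 0%N = 2 ^+ q -> - 2 ^+ q <= rmem s 18 0%N < 2 ^+ q ->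
  wp floor_cmd (floor_time q)
    (fun s' => rmem s' 16 0%N = (Num.floor (rmem s 18 0%N))%:~R) s.
Proof.
move=> Q6; set y := rmem s 18 0%N => /andP[y1 y2].
eapply wp_le.
  apply: wp_seq; apply: wp_rstore => /=.
  apply: wp_seq; apply: wp_rstore => /=.
  pose I i (s' : state R) := rmem s' 17 0%N = 2 ^+ q / 2 ^+ i /\
    exists2 z : int, rmem s' 16 0%N = z%:~R & z%:~R <= y < z%:~R + 2 * (2 ^+ q / 2 ^+ i).
  apply: (wp_while (I := I) (m := q.+1)).
  - split; rewrite /upd /= Q6; first by rewrite expr0 divr1.
    exists (- (2 ^ q)%N%:Z); first by rewrite mulrNz -pmulrn natrX sub0r.
    by rewrite mulrNz -pmulrn natrX expr0 divr1 y1 /=; move: y2; lra.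
  - move=> i s' iq [_ F]; have y18 : rmem s' 18 0%N = y by rewrite F.
    move=> [t17 [z z16 /andP[z1 z2]]].
    have tE : 2 ^+ q / 2 ^+ i = (2 ^ (q - i))%N%:R :> R.
      by rewrite natrX expfB_cond ?pnatr_eq0 //; rewrite -ltnS.
    have tS : 2 * (2 ^+ q / 2 ^+ i.+1) = 2 ^+ q / 2 ^+ i :> R.
      by rewrite exprS; field; rewrite expf_eq0 pnatr_eq0 andbF.
    split; first by rewrite /= t17 tE ler1n expn_gt0.
    apply: wp_seq; apply: wp_if => /= [c|c].
      apply: wp_rstore => /=; apply: wp_rstore; split; rewrite /upd /=.
        by rewrite t17 exprS invfM; ring.
      exists (z + (2 ^ (q - i))%N); first by rewrite z16 t17 tE intrD -pmulrn.
      rewrite z16 t17 y18 in c.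
      by rewrite intrD -pmulrn -tE tS c /=; move: z2; lra.
    apply: wp_skip; apply: wp_rstore; split; rewrite /upd /=.
      by rewrite t17 exprS invfM; ring.
    exists z => //; rewrite z16 t17 y18 -ltNge in c.
    by rewrite tS z1.
  - move=> s' _ [t17 [z z16 /andP[z1 z2]]].
    have tS : 2 * (2 ^+ q / 2 ^+ q.+1) = 1 :> R.
      by rewrite exprS; field; rewrite expf_eq0 pnatr_eq0 andbF.
    split; first by rewrite /= t17 -ltNge; move: tS; lra.
    by rewrite z16; congr _%:~R; apply/esym/floor_def; rewrite z1 intrD; move: z2; rewrite tS.
by rewrite /floor_time /=; lia.
Qed.

(** * The program *)

(** Tests offer only <=, so the guard compares the successor of the counter. The start value is left
    to the caller. *)
Definition for_lt (a : nat) (bound : nexp) (body : cmd) : cmd :=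
  While (NLe (NAdd (nsc a) (NConst 1)) bound)
    (body ;; NStore a (NConst 0) (NAdd (nsc a) (NConst 1))).

Lemma wp_for (R : realType) a bound body (I : nat -> state R -> Prop) k0 m T
    (Q : state R -> Prop) s :
  nmem s a 0%N = k0 -> I 0%N s -> a \notin nwrites body ->
  (forall s', frame (for_lt a bound body) s s' -> neval s' bound = (k0 + m)%N) ->
  (forall i s1 s2, rmem s1 = rmem s2 -> (forall b, b != a -> nmem s1 b = nmem s2 b) ->
    I i s1 -> I i s2) ->
  (forall i s', (i < m)%N -> frame (for_lt a bound body) s s' ->
    nmem s' a 0%N = (k0 + i)%N -> I i s' -> wp body T (I i.+1) s') ->
  (forall s', frame (for_lt a bound body) s s' -> nmem s' a 0%N = (k0 + m)%N ->
    I m s' -> Q s') ->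
  wp (for_lt a bound body) (m * (T + ncost bound + 11) + ncost bound + 11) Q s.
Proof.
move=> sa I0 abody hb stab step fin.
apply: wp_le.
  apply: (@wp_while _ _ _ (fun i s' => nmem s' a 0%N = (k0 + i)%N /\ I i s') m (T + 6)).
  - by rewrite addn0.
  - move=> i s' im F [s'a Is']; split.
      by rewrite /= hb // s'a addn1 ltn_add2l.
    apply: wp_seq; apply: wp_conseq (step i s' im F s'a Is') _ => s1 F1 I1.
    have s1a : nmem s1 a 0%N = (k0 + i)%N by rewrite F1.1.
    apply: wp_le; first apply: wp_nstore => /=.
      rewrite /upd !eqxx /= s1a addn1 addnS; split=> //.
      by apply: stab I1 => // c /negPf ca /=; apply/funext => j; rewrite /upd ca.
    by [].
  - move=> s' F [s'a Is']; split; last exact: fin.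
    by rewrite /= hb // s'a addn1 ltnn.
by rewrite /=; lia.
Qed.

(* Arrays of naturals: 3 flags the nonzero columns, 4 lists them, 5 counts them,
   6 to 8 hold loop counters. Arrays of reals: 5 holds H, 6 holds Q = H ^ 4,
   7 the next weight, 8 the weights of the columns, 9 the packed rows of the
   rounded matrix, 10 the packed columns of its Gram matrix, 11 the vector A^T b,
   later divided by its l1 norm, 12 this norm, 13 and 14 the current and the
   previous iterate, 15 a packed matrix-vector product, 16 to 18 the variables of
   [floor_cmd], 19 the rounded entries of A, 20 a new entry. *)
Definition precision_cmd : cmd :=
  let n := ROfNat (nsc 0) in
  RStore 5 (NConst 0) (rnat 1) ;;
  While (RLe (rsc 5)
             (RMul (rsc 3) (RMul n (RMul n (RMul n (RMul n (RMul n (RMul n n))))))))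
    (RStore 5 (NConst 0) (RAdd (rsc 5) (rsc 5))) ;;
  RStore 6 (NConst 0) (RMul (RMul (rsc 5) (rsc 5)) (RMul (rsc 5) (rsc 5))).

(** Columns are numbered by first occurrence, so later loops visit nonzero columns only and never
    scan all d of them. *)
Definition layout_cmd : cmd :=
  let j := NRead 2 (nsc 6) in
  RStore 7 (NConst 0) (rnat 1) ;;
  for_lt 6 (NRead 0 (NConst 2))
    (If (NLe (NRead 3 j) (NConst 0))
      (NStore 3 j (NConst 1) ;;
       NStore 4 (nsc 5) j ;;
       RStore 8 j (rsc 7) ;;
       RStore 7 (NConst 0) (RMul (rsc 7) (rsc 6)) ;;
       NStore 5 (NConst 0) (NAdd (nsc 5) (NConst 1)))
      Skip).

Definition pack_rows_cmd : cmd :=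
  let e := nsc 6 in let i := NRead 1 e in let j := NRead 2 e in
  NStore 6 (NConst 0) (NConst 0) ;;
  for_lt 6 (NRead 0 (NConst 2))
    (RStore 18 (NConst 0) (RMul (rsc 5) (RRead 1 e)) ;;
     floor_cmd ;;
     RStore 19 e (rsc 16) ;;
     RStore 11 j (RAdd (RRead 11 j) (RMul (RRead 1 e) (RRead 2 i))) ;;
     RStore 9 i (RAdd (RRead 9 i) (RMul (rsc 16) (RRead 8 j)))).

(** Row i is already one number, so a single multiplication per entry (i, j) adds its contribution
    to all digits of packed column j. *)
Definition pack_gram_cmd : cmd :=
  let e := nsc 6 in let i := NRead 1 e in let j := NRead 2 e in
  NStore 6 (NConst 0) (NConst 0) ;;
  for_lt 6 (NRead 0 (NConst 2))
    (RStore 10 j (RAdd (RRead 10 j) (RMul (RRead 19 e) (RRead 9 i)))).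

Definition l1norm_cmd : cmd :=
  let j := NRead 4 (nsc 7) in
  for_lt 7 (nsc 5)
    (If (RLe (rnat 0) (RRead 11 j))
       (RStore 12 (NConst 0) (RAdd (rsc 12) (RRead 11 j)))
       (RStore 12 (NConst 0) (RSub (rsc 12) (RRead 11 j)))).

Definition normalize_cmd : cmd :=
  let j := NRead 4 (nsc 7) in
  NStore 7 (NConst 0) (NConst 0) ;;
  for_lt 7 (nsc 5)
    (RStore 11 j (RDiv (RRead 11 j) (rsc 12)) ;;
     RStore 14 j (RMul (rnat 2) (RRead 11 j))).

Definition gather_cmd : cmd :=
  let j := NRead 4 (nsc 7) in
  RStore 15 (NConst 0) (rnat 0) ;;
  NStore 7 (NConst 0) (NConst 0) ;;
  for_lt 7 (nsc 5)
    (RStore 18 (NConst 0) (RMul (rsc 5) (RRead 13 j)) ;;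
     floor_cmd ;;
     RStore 15 (NConst 0) (RAdd (rsc 15) (RMul (rsc 16) (RRead 10 j)))).

(** Digits are signed. After division by the leading weight the lower digits amount to less than
    1/2, so adding 1/2 and taking the floor isolates the top digit. *)
Definition scatter_cmd : cmd :=
  let j := NRead 4 (nsc 7) in
  While (NLe (NConst 1) (nsc 7))
    (NStore 7 (NConst 0) (NSub (nsc 7) (NConst 1)) ;;
     RStore 18 (NConst 0) (RAdd (RDiv (rsc 15) (RRead 8 j)) (RDiv (rnat 1) (rnat 2))) ;;
     floor_cmd ;;
     RStore 15 (NConst 0) (RSub (rsc 15) (RMul (rsc 16) (RRead 8 j))) ;;
     RStore 20 (NConst 0)
       (RAdd (RSub (RSub (RMul (rnat 2) (RRead 13 j))
                         (RMul (rnat 4) (RDiv (rsc 16) (RMul (rsc 5) (RMul (rsc 5) (rsc 5))))))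
                   (RRead 14 j))
             (RMul (rnat 4) (RRead 11 j))) ;;
     RStore 14 j (RRead 13 j) ;;
     RStore 13 j (rsc 20) ;;
     RStore 4 j (RAdd (RRead 4 j) (RMul (rsc 12) (RMul (RRead 3 (nsc 8)) (rsc 20))))).

(** The counter starts at 1: frequency 0 contributes nothing, and cell 0 of the table holds a
    precision constant instead of a coefficient. *)
Definition iterate_cmd : cmd :=
  NStore 8 (NConst 0) (NConst 1) ;;
  for_lt 8 (NRead 0 (NConst 3)) (gather_cmd ;; scatter_cmd).

Definition pcr_cmd : cmd :=
  precision_cmd ;; layout_cmd ;; pack_rows_cmd ;; pack_gram_cmd ;;
  l1norm_cmd ;; normalize_cmd ;; iterate_cmd.

Section NonzeroEntries.
Variables (R : realType) (n d : nat) (A : 'M[R]_(n, d)).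
Local Notation nz := (nz_positions A).

Lemma mem_nz i j : ((i, j) \in nz) = (A i j != 0).
Proof.
rewrite mem_filter /= andbC.
have -> // : (i, j) \in [seq (x, y) | x <- enum 'I_n, y <- enum 'I_d].
by apply/allpairsPdep; exists i, j; rewrite !mem_enum.
Qed.

Lemma sum_nz (f : 'I_n -> 'I_d -> R) (P : pred ('I_n * 'I_d)) :
  (forall i j, A i j = 0 -> f i j = 0) ->
  \sum_(ij <- nz | P ij) f ij.1 ij.2 = \sum_i \sum_(j | P (i, j)) f i j.
Proof.
move=> f0; rewrite big_filter_cond big_mkcond big_allpairs !big_enum /=.
apply: eq_bigr => i _; rewrite big_enum [RHS]big_mkcond; apply: eq_bigr => j _ /=.
rewrite /=; case: (eqVneq (A i j) 0) => [Aij|_] /=; last by [].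
by rewrite f0 //; case: ifP.
Qed.

End NonzeroEntries.

Lemma big_take_S (R : realType) (T : Type) (x0 : T) (s : seq T) (P : pred T) (f : T -> R) e :
  (e < size s)%N ->
  \sum_(x <- take e.+1 s | P x) f x =
  \sum_(x <- take e s | P x) f x + (if P (nth x0 s e) then f (nth x0 s e) else 0).
Proof. by move=> es; rewrite (take_nth x0) // big_rcons. Qed.

Lemma exists_pow2 (R : realType) (x : R) : 1 <= x -> exists m : nat, x < 2 ^+ m <= 2 * x.
Proof.
move=> x1; have ex : exists m : nat, x < 2 ^+ m.
  by exists (Num.bound x); apply: upper_nthrootP.
case: (ex_minnP ex) => m xm mmin; exists m; rewrite xm /=.
case: m xm mmin => [|m] xm mmin; first by move: xm; rewrite expr0 ltNge x1.
rewrite exprS ler_pM2l // leNgt; apply/negP => /mmin.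
by rewrite ltnn.
Qed.

Section Phases.
Variables (R : realType) (n d : nat) (A : 'M[R]_(n, d)) (b : 'cV[R]_n).
Variables (lambda gamma eps delta : R) (cst : seq R).
Variables (i0 : 'I_n) (j0 : 'I_d).
Local Notation s0 := (input_state A b lambda gamma eps delta cst).
Local Notation nz := (nz_positions A).
Local Notation nzi e := (nth (i0, j0) nz e).1.
Local Notation nzj e := (nth (i0, j0) nz e).2.

Definition input_intact (s : state R) : Prop :=
  (forall a, (a < 3)%N -> nmem s a = nmem s0 a) /\
  (forall a, (a < 4)%N -> rmem s a = rmem s0 a).

Lemma input_frame p s s' : input_intact s -> frame p s s' ->
  all (leq 3) (nwrites p) -> all (leq 4) (rwrites p) -> input_intact s'.
Proof.
move=> [ni ri] [nf rf] /allP an /allP ar; split=> a al.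
  by rewrite nf ?ni //; apply: contraL al => /an; rewrite -leqNgt.
by rewrite rf ?ri //; apply: contraL al => /ar; rewrite -leqNgt.
Qed.

Section Reads.
Variable s : state R.
Hypothesis hs : input_intact s.

Lemma read_n : nmem s 0 0%N = n. Proof. by rewrite hs.1. Qed.
Lemma read_nnz : nmem s 0 2%N = size nz. Proof. by rewrite hs.1 //= size_nz_positions. Qed.
Lemma read_size_cst : nmem s 0 3%N = size cst. Proof. by rewrite hs.1. Qed.

Lemma read_row e : (e < size nz)%N -> nmem s 1 e = nzi e.
Proof. by move=> es; rewrite hs.1 //= /input_nmem /= (nth_map (i0, j0)). Qed.

Lemma read_col e : (e < size nz)%N -> nmem s 2 e = nzj e.
Proof. by move=> es; rewrite hs.1 //= /input_nmem /= (nth_map (i0, j0)). Qed.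

Lemma read_val e : (e < size nz)%N -> rmem s 1 e = A (nzi e) (nzj e).
Proof. by move=> es; rewrite hs.2 //= /input_rmem /= (nth_map (i0, j0)). Qed.

Lemma read_b (i : 'I_n) : rmem s 2 i = b i 0.
Proof.
by rewrite hs.2 //= /input_rmem /= (nth_map i) ?nth_ord_enum // size_enum_ord.
Qed.

Lemma read_cst k : rmem s 3 k = nth 0 cst k.
Proof. by rewrite hs.2. Qed.

End Reads.

Lemma wp_precision s T0 m : input_intact s -> T0 = nth 0 cst 0 * n%:R ^+ 7 ->
  T0 < 2 ^+ m <= 2 * T0 ->
  wp precision_cmd (100 * m + 100)
    (fun s' => rmem s' 5 0%N = 2 ^+ m /\ rmem s' 6 0%N = 2 ^+ (4 * m)) s.
Proof.
move=> hs T0E /andP[T1 T2].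
apply: wp_le.
  apply: wp_seq; apply: wp_rstore => /=.
  apply: wp_seq; apply: (wp_while (I := fun i s' => rmem s' 5 0%N = 2 ^+ i) (m := m)).
  - by rewrite /upd /= expr0.
  - move=> i s' im F s'i.
    have hs' : input_intact s'.
      have [F1 F2] := F; split=> a al; first by rewrite F1 //= hs.1.
      rewrite F2 ?inE; last by apply: contraTneq al => ->.
      by apply/funext => k; rewrite -(hs.2 a al) /= /upd; case: eqP al => // ->.
    split; last by apply: wp_rstore; rewrite /= /upd /= s'i exprS; ring.
    rewrite /= s'i (read_n hs') (read_cst hs').
    have -> : nth 0 cst 0 * (n%:R * (n%:R * (n%:R * (n%:R * (n%:R * (n%:R * n%:R)))))) = T0.
      by rewrite T0E; ring.
    (* Twice 2^i is at most 2^m, hence at most 2 T0: doubling cannot have stopped yet. *)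
    have : 2 ^+ i.+1 <= 2 ^+ m :> R by rewrite ler_weXn2l // ler1n.
    rewrite exprS; lra.
  move=> s' F s'i; have hs' : input_intact s'.
    have [F1 F2] := F; split=> a al; first by rewrite F1 //= hs.1.
    rewrite F2 ?inE; last by apply: contraTneq al => ->.
    by apply/funext => k; rewrite -(hs.2 a al) /= /upd; case: eqP al => // ->.
  split.
    rewrite /= s'i (read_n hs') (read_cst hs').
    have -> : nth 0 cst 0 * (n%:R * (n%:R * (n%:R * (n%:R * (n%:R * (n%:R * n%:R)))))) = T0.
      by rewrite T0E; ring.
    by rewrite -ltNge.
  apply: wp_rstore; rewrite /= /upd /= s'i; split=> //.
  by rewrite mulnC exprM; ring.
by rewrite /=; lia.
Qed.

(* [L] lists the nonzero columns; column [L_c] is assigned the weight [Q ^+ c]. *)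
Definition layout (Q : R) (L : seq 'I_d) (s : state R) : Prop :=
  nmem s 5 0%N = size L /\
  forall c, (c < size L)%N -> nmem s 4 c = nth j0 L c /\ rmem s 8 (nth j0 L c) = Q ^+ c.

(** The list is chosen before the state and Q, as it depends only on the sequence of nonzero
    positions. *)
Lemma wp_layout : exists L : seq 'I_d, [/\ uniq L, L =i [seq ij.2 | ij <- nz] &
  forall s Q, input_intact s -> rmem s 6 0%N = Q ->
    nmem s 3 = (fun _ => 0%N) -> nmem s 5 0%N = 0%N -> nmem s 6 0%N = 0%N ->
    wp layout_cmd (100 * size nz + 50) (layout Q L) s].
Proof.
pose fix L e : seq 'I_d := if e is e'.+1 then
  if nzj e' \in L e' then L e' else rcons (L e') (nzj e') else [::].
have LU e : uniq (L e).
  by elim: e => //= e IH; case: ifPn => // H; rewrite rcons_uniq H.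
have Lmem e : (e <= size nz)%N -> L e =i [seq ij.2 | ij <- take e nz].
  elim: e => [|e IH] es; first by rewrite take0.
  rewrite (take_nth (i0, j0)) // map_rcons => j; rewrite mem_rcons inE -(IH (ltnW es)) /=.
  by case: ifPn => [H|H]; [case: eqP => // ->|rewrite mem_rcons inE].
exists (L (size nz)); split=> //.
  by move=> j; rewrite Lmem // take_size.
move=> s Q hs sQ s3 s5 s6; apply: wp_le.
  apply: wp_seq; apply: wp_rstore => /=.
  set s1 := State _ _.
  pose I e (s' : state R) := [/\ layout Q (L e) s', rmem s' 7 0%N = Q ^+ size (L e)
    & forall j : 'I_d, nmem s' 3 j = (j \in L e)].
  apply: (wp_for (I := I) (k0 := 0%N) (m := size nz)) => //.
  - by split=> //=; rewrite s3.
  - move=> s' F; rewrite /= F.1 //= add0n; exact: (read_nnz hs).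
  - move=> i t1 t2 rE nE; rewrite /I /layout rE.
    by rewrite (nE 5%N) // (nE 4%N) // (nE 3%N).
  - move=> e s' es F s'e [[s'5 s'L] s'7 s'3].
    have s'2 : nmem s' 2 e = nzj e by rewrite F.1 //= (read_col hs).
    have s'6 : rmem s' 6 0%N = Q by rewrite F.2.
    rewrite add0n in s'e.
    apply: wp_if => /=; rewrite s'e s'2 s'3 => jL.
      have {jL} jL : nzj e \notin L e by case: (_ \in _) jL.
      have LE : L e.+1 = rcons (L e) (nzj e) by rewrite /= (negPf jL).
      apply: wp_seq; apply: wp_nstore => /=.
      apply: wp_seq; apply: wp_nstore => /=.
      apply: wp_seq; apply: wp_rstore => /=.
      apply: wp_seq; apply: wp_rstore => /=.
      apply: wp_nstore => /=.
      rewrite /upd /= !(s'e, s'2, s'5); rewrite /I /layout LE size_rcons /=.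
      rewrite addn1; split=> //; last 2 first.
      + by rewrite s'7 s'6 exprSr.
      + move=> j; rewrite mem_rcons inE; case: (eqVneq j (nzj e)) => [->|jn].
          by rewrite eqxx.
        by rewrite val_eqE (negPf jn) s'3.
      split=> // c; rewrite ltnS leq_eqVlt nth_rcons => /orP[/eqP->|cs].
        by rewrite ltnn !eqxx s'7.
      have [A1 A2] := s'L c cs.
      rewrite cs (ltn_eqF cs) A1; split=> //.
      by rewrite val_eqE; case: eqP => // cj; rewrite -cj mem_nth in jL.
    have {}jL : nzj e \in L e by case: (_ \in _) jL.
    by apply: wp_skip; rewrite /I /= jL.
  - by move=> s' F _ [].
by rewrite /=; lia.
Qed.

End Phases.

(** Rounding keeps zeros, so sums over the entry list equal sums over the full rounded matrix. *)
Lemma quant0 (R : realType) (H : R) : quant H 0 = 0.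
Proof. by rewrite /quant mulr0 floor0. Qed.

Section Phases.
Variables (R : realType) (n d : nat) (A : 'M[R]_(n, d)) (b : 'cV[R]_n).
Variables (lambda gamma eps delta : R) (cst : seq R).
Variables (i0 : 'I_n) (j0 : 'I_d).
Local Notation s0 := (input_state A b lambda gamma eps delta cst).
Local Notation nz := (nz_positions A).
Local Notation nzi e := (nth (i0, j0) nz e).1.
Local Notation nzj e := (nth (i0, j0) nz e).2.
Local Notation input_intact := (input_intact A b lambda gamma eps delta cst).
Local Notation layout := (layout j0).

Variable m : nat.
Hypothesis m0 : (0 < m)%N.
Hypothesis A1 : forall i j, `|A i j| <= 1.
Local Notation H := (2 ^+ m : R).
Local Notation Q := (2 ^+ (4 * m) : R).
Local Notation qA i j := (quant H (A i j)).

Definition precise (s : state R) := rmem s 5 0%N = H /\ rmem s 6 0%N = Q.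

Lemma QE : Q = H ^+ 4. Proof. by rewrite -exprM mulnC. Qed.

Lemma H_ge2 : 2 <= H.
Proof. by rewrite -[leLHS]expr1 ler_weXn2l // ler1n. Qed.

Lemma H_lt_Q : H < Q.
Proof. by rewrite ltr_eXn2l ?ltr1n //; lia. Qed.

Lemma scaled_in_range x B : `|x| <= B -> H * B < Q -> - Q <= H * x < Q.
Proof.
rewrite ler_norml => /andP[x1 x2] BQ; have h2 := H_ge2.
have : H * x <= H * B by rewrite ler_wpM2l //; lra.
have : H * - B <= H * x by rewrite ler_wpM2l //; lra.
by rewrite mulrN; lra.
Qed.

Lemma wp_pack_rows s : input_intact s -> precise s ->
  rmem s 11 = (fun _ => 0) -> rmem s 9 = (fun _ => 0) ->
  wp pack_rows_cmd (size nz * (floor_time (4 * m) + 100) + 50)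
    (fun s' => [/\ forall e, (e < size nz)%N -> rmem s' 19 e = qA (nzi e) (nzj e),
        forall j : 'I_d, rmem s' 11 j = (A^T *m b) j 0
      & forall i : 'I_n, rmem s' 9 i = \sum_(j < d) qA i j * rmem s 8 j]) s.
Proof.
move=> hs [s5 s6] s11 s9.
apply: wp_le.
  apply: wp_seq; apply: wp_nstore => /=.
  set s1 := State _ _.
  pose I e (s' : state R) := [/\
    forall k, (k < e)%N -> rmem s' 19 k = qA (nzi k) (nzj k),
    forall j : 'I_d, rmem s' 11 j =
      \sum_(ij <- take e nz | ij.2 == j) A ij.1 ij.2 * b ij.1 0
    & forall i : 'I_n, rmem s' 9 i =
      \sum_(ij <- take e nz | ij.1 == i) qA ij.1 ij.2 * rmem s 8 ij.2].
  apply: (wp_for (I := I) (k0 := 0%N) (m := size nz)) => //.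
  - by split=> // j; rewrite take0 big_nil /= ?s11 ?s9.
  - move=> s' F; rewrite /= F.1 // /s1 /upd /= add0n; exact: (read_nnz hs).
  - by move=> i t1 t2 rE nE; rewrite /I rE.
  - move=> e s' es F; rewrite add0n => s'e [s'19 s'11 s'9].
    have s'5 : rmem s' 5 0%N = H by rewrite F.2.
    have s'6 : rmem s' 6 0%N = Q by rewrite F.2.
    have s'8 : rmem s' 8 = rmem s 8 by rewrite F.2.
    have s'1 : rmem s' 1 e = A (nzi e) (nzj e) by rewrite F.2 //= (read_val i0 j0 hs).
    have s'2 : nmem s' 2 e = nzj e by rewrite F.1 // /s1 /upd /= (read_col i0 j0 hs).
    have s'i : nmem s' 1 e = nzi e by rewrite F.1 // /s1 /upd /= (read_row i0 j0 hs).
    have s'b (i : 'I_n) : rmem s' 2 i = b i 0 by rewrite F.2 //= (read_b hs).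
    apply: wp_seq; apply: wp_rstore => /=; rewrite s'5 s'e s'1.
    apply: wp_seq; apply: wp_conseq (wp_floor (q := 4 * m) _ _) _ => /=.
    + by rewrite /upd /= s'6.
    + rewrite /upd /=; apply: (@scaled_in_range _ 1) => //.
      by rewrite mulr1 H_lt_Q.
    move=> s2 [F2n F2r]; rewrite /upd /= -/(qA _ _) => s2z.
    have nE a : nmem s2 a = nmem s' a by rewrite F2n.
    have rE a : a \notin [:: 16; 17; 18] -> rmem s2 a = rmem s' a.
      move=> a3; rewrite F2r /=.
        move: a3; rewrite !inE !negb_or => /and3P[_ _ /negPf a18].
        by apply/funext => k; rewrite /upd a18.
      by move: a3; rewrite !inE !negb_or => /and3P[-> -> _].
    apply: wp_seq; apply: wp_rstore => /=; rewrite !nE s'e s2z.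
    apply: wp_seq; apply: wp_rstore => /=; rewrite /upd /= !nE s'e s'2 s'i !rE // s'1 s'b.
    apply: wp_rstore; rewrite /I /upd /= !nE s'e s'2 s'i s2z !rE // s'8; split.
    + move=> k; rewrite ltnS leq_eqVlt => /orP[/eqP->|ke]; first by rewrite eqxx.
      by rewrite (ltn_eqF ke) s'19.
    + move=> j; rewrite (big_take_S (i0, j0)) // s'11 val_eqE [nzj e == j]eq_sym.
      by case: eqP => [<-|_]; rewrite ?addr0 ?s'11.
    + move=> i; rewrite (big_take_S (i0, j0)) // val_eqE [nzi e == i]eq_sym.
      by case: eqP => [<-|_]; rewrite ?addr0 ?s'9.
  - move=> s' F _ []; rewrite take_size => r19 r11 r9; split=> //.
    + move=> j; rewrite r11 (sum_nz (f := fun i j => A i j * b i 0)) => [|i k ->]; last by rewrite mul0r.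
      rewrite mxE; apply: eq_bigr => i _; rewrite mxE big_mkcond (bigD1 j) //= eqxx big1 ?addr0 //.
      by move=> k /negPf ->.
    + move=> i; rewrite r9 (sum_nz (f := fun i j => qA i j * rmem s 8 j)) => [|k j ->]; last by rewrite quant0 mul0r.
      rewrite (bigD1 i) //= [X in _ + X]big1 ?addr0 => [|k /negPf ki]; last by apply: big1 => j; rewrite /= ki.
      by apply: eq_bigl => j; rewrite eqxx.
by rewrite /floor_time /=; clear; lia.
Qed.

Lemma wp_pack_gram s : input_intact s ->
  (forall e, (e < size nz)%N -> rmem s 19 e = qA (nzi e) (nzj e)) ->
  rmem s 10 = (fun _ => 0) ->
  wp pack_gram_cmd (size nz * 100 + 50)
    (fun s' => forall j : 'I_d, rmem s' 10 j = \sum_(i < n) qA i j * rmem s 9 i) s.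
Proof.
move=> hs s19 s10.
apply: wp_le.
  apply: wp_seq; apply: wp_nstore => /=.
  set s1 := State _ _.
  pose I e (s' : state R) := forall j : 'I_d, rmem s' 10 j =
      \sum_(ij <- take e nz | ij.2 == j) qA ij.1 ij.2 * rmem s 9 ij.1.
  apply: (wp_for (I := I) (k0 := 0%N) (m := size nz)) => //.
  - by move=> j; rewrite take0 big_nil /= s10.
  - move=> s' F; rewrite /= F.1 // /s1 /upd /= add0n; exact: (read_nnz hs).
  - by move=> i t1 t2 rE nE; rewrite /I rE.
  - move=> e s' es F; rewrite add0n => s'e s'10.
    have s'19 : rmem s' 19 e = qA (nzi e) (nzj e) by rewrite F.2 //= s19.
    have s'9 : rmem s' 9 = rmem s 9 by rewrite F.2.
    have s'2 : nmem s' 2 e = nzj e by rewrite F.1 // /s1 /upd /= (read_col i0 j0 hs).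
    have s'i : nmem s' 1 e = nzi e by rewrite F.1 // /s1 /upd /= (read_row i0 j0 hs).
    apply: wp_rstore; rewrite /I /upd /= s'e s'2 s'i s'19 s'9 => j.
    rewrite (big_take_S (i0, j0)) // s'10 val_eqE [nzj e == j]eq_sym.
    by case: eqP => [<-|_]; rewrite ?addr0 ?s'10.
  - move=> s' F _ I'; move=> j; rewrite I' take_size.
    rewrite (sum_nz (f := fun i j => qA i j * rmem s 9 i)) => [|i k ->]; last by rewrite quant0 mul0r.
    apply: eq_bigr => i _; rewrite big_mkcond (bigD1 j) //= eqxx big1 ?addr0 //.
    by move=> k /negPf ->.
by rewrite /floor_time /=; clear; lia.
Qed.

Variable L : seq 'I_d.
Hypothesis LU : uniq L.
Hypothesis Lmem : L =i [seq ij.2 | ij <- nz].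

Lemma notin_L i j : j \notin L -> A i j = 0.
Proof.
rewrite Lmem => /mapP jL; apply/eqP; apply: contra_notT jL => Aij.
by exists (i, j); rewrite // mem_nz.
Qed.

Lemma sum_L (f : 'I_d -> R) : (forall j, j \notin L -> f j = 0) ->
  \sum_(c < size L) f (nth j0 L c) = \sum_j f j.
Proof.
move=> f0; rewrite [RHS](bigID [in L]) /= [X in _ + X]big1 ?addr0 => [|j /f0 //].
by rewrite -(big_mkord xpredT (fun c => f (nth j0 L c))) -(big_nth j0 xpredT) big_uniq.
Qed.

Variables (a : 'cV[R]_d).
Let sigma := \sum_j `|a j 0|.

Lemma wp_l1norm s : layout Q L s -> nmem s 7 0%N = 0%N -> rmem s 12 0%N = 0 ->
  (forall j : 'I_d, rmem s 11 j = a j 0) -> (forall j, j \notin L -> a j 0 = 0) ->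
  wp l1norm_cmd (size L * 100 + 50) (fun s' => rmem s' 12 0%N = sigma) s.
Proof.
move=> [s5 sL] s7 s12 s11 aL; apply: wp_le.
  pose I e (s' : state R) := rmem s' 12 0%N = \sum_(c < e) `|a (nth j0 L c) 0|.
  apply: (wp_for (I := I) (k0 := 0%N) (m := size L)) => //.
  - by rewrite /I big_ord0.
  - by move=> s' F; rewrite /= F.1.
  - by move=> i t1 t2 rE nE; rewrite /I rE.
  - move=> e s' es F; rewrite add0n => s'e s'12.
    have s'4 : nmem s' 4 e = nth j0 L e by rewrite F.1 // (sL e es).1.
    have s'11 (j : 'I_d) : rmem s' 11 j = a j 0 by rewrite F.2.
    apply: wp_if => /=; rewrite s'e s'4 s'11 => c; apply: wp_rstore;
      rewrite /I /upd /= s'e s'4 s'11 s'12 big_ord_recr /=.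
      by rewrite ger0_norm.
    by rewrite ltr0_norm // ltNge.
  - move=> s' F _ ->; apply: (@sum_L (fun j => `|a j 0|)) => j /aL ->; exact: normr0.
by rewrite /floor_time /=; clear; lia.
Qed.

Lemma wp_normalize s : layout Q L s -> rmem s 12 0%N = sigma ->
  (forall j : 'I_d, rmem s 11 j = a j 0) -> (forall j, j \notin L -> a j 0 = 0) ->
  rmem s 14 = (fun _ => 0) ->
  wp normalize_cmd (size L * 100 + 50) (fun s' => forall j : 'I_d,
    rmem s' 11 j = a j 0 / sigma /\ rmem s' 14 j = 2 * (a j 0 / sigma)) s.
Proof.
move=> [s5 sL] s12 s11 aL s14; apply: wp_le.
  apply: wp_seq; apply: wp_nstore => /=.
  set s1 := State _ _.
  pose I e (s' : state R) := forall j : 'I_d,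
    (rmem s' 11 j = if j \in take e L then a j 0 / sigma else a j 0) /\
    (rmem s' 14 j = if j \in take e L then 2 * (a j 0 / sigma) else 0).
  apply: (wp_for (I := I) (k0 := 0%N) (m := size L)) => //.
  - by rewrite /I take0 => j /=; rewrite s11 s14.
  - by move=> s' F; rewrite /= F.1.
  - by move=> i t1 t2 rE nE; rewrite /I rE.
  - move=> e s' es F; rewrite add0n => s'e Is'.
    have s'4 : nmem s' 4 e = nth j0 L e by rewrite F.1 // /s1 /upd /= (sL e es).1.
    have s'12 : rmem s' 12 0%N = sigma by rewrite F.2.
    (* The column has not been normalised before, so its entry is divided exactly once. *)
    have jnew : nth j0 L e \notin take e L.
      have := take_uniq e.+1 LU; rewrite (take_nth j0) // rcons_uniq.
      by case/andP.
    apply: wp_seq; apply: wp_rstore => /=; rewrite s'e s'4 s'12.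
    apply: wp_rstore; rewrite /I /upd /= s'e s'4 eqxx => j.
    rewrite (take_nth j0) // mem_rcons inE val_eqE.
    case: eqP => [->|_] /=; last exact: Is'.
    by rewrite (Is' _).1 (negPf jnew).
  - move=> s' F _ Is' j; have := Is' j; rewrite take_size.
    by case: ifPn => // /aL ->; rewrite mul0r mulr0.
by rewrite /floor_time /=; clear; lia.
Qed.

End Phases.

(** * Signed digits of packed numbers *)

Section Digits.
Variables (R : realType) (Q : R) (y : nat -> R).
Hypothesis Q2 : 2 <= Q.
Hypothesis yQ : forall c, `|y c| <= Q / 8.

(** Inductively Q^c / 4 + Q^(c+1) / 8 is at most Q^(c+1) / 4, because Q is at least 2. *)
Lemma low_digits_le c : `|\sum_(k < c) y k * Q ^+ k| <= Q ^+ c / 4.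
Proof.
have Q0 : 0 <= Q by move: Q2; lra.
elim: c => [|c IH]; first by rewrite big_ord0 normr0 divr_ge0 ?exprn_ge0.
rewrite big_ord_recr /=; apply: le_trans (ler_normD _ _) _.
have Qc : 0 <= Q ^+ c by rewrite exprn_ge0.
rewrite normrM (ger0_norm Qc) exprS; have := ler_wpM2r Qc (yQ c).
have := ler_wpM2r Qc Q2; move: IH; lra.
Qed.

Lemma top_digit c : y c \is a Num.int ->
  let x := (\sum_(k < c.+1) y k * Q ^+ k) / Q ^+ c + 1 / 2 in
  (Num.floor x)%:~R = y c /\ - Q <= x < Q.
Proof.
move=> yi x; have Qc : 0 < Q ^+ c by rewrite exprn_gt0 //; move: Q2; lra.
have xE : x = y c + (\sum_(k < c) y k * Q ^+ k) / Q ^+ c + 1 / 2.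
  by rewrite /x big_ord_recr /=; field; rewrite gt_eqF.
have low : `|(\sum_(k < c) y k * Q ^+ k) / Q ^+ c| <= 1 / 4.
  rewrite normrM [`|(_ ^+ _)^-1|]ger0_norm ?invr_ge0 ?(ltW Qc) // ler_pdivrMr //.
  by have := low_digits_le c; lra.
have := yQ c; move: low; rewrite !ler_norml => /andP[l1 l2] /andP[y1 y2].
have q2 := Q2; split; last by rewrite xE; lra.
have [z yz] : exists z : int, y c = z%:~R by exists (Num.floor (y c)); rewrite floorK.
rewrite yz; congr _%:~R; apply: floor_def; rewrite intrD xE yz; lra.
Qed.

End Digits.

(** * One matrix-vector product on packed data *)

Section Iterations.
Variables (R : realType) (n d : nat) (A : 'M[R]_(n, d)) (b : 'cV[R]_n).
Variables (lambda gamma eps delta : R) (cst : seq R).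
Variables (i0 : 'I_n) (j0 : 'I_d).
Local Notation s0 := (input_state A b lambda gamma eps delta cst).
Local Notation nz := (nz_positions A).
Local Notation input_intact := (input_intact A b lambda gamma eps delta cst).
Local Notation layout := (layout j0).

Variable m : nat.
Hypothesis m0 : (0 < m)%N.
Local Notation H := (2 ^+ m : R).
Local Notation Q := (2 ^+ (4 * m) : R).
Local Notation qA i j := (quant H (A i j)).
Local Notation precise := (precise m).

Variable L : seq 'I_d.
Hypothesis LU : uniq L.
Hypothesis Lmem : L =i [seq ij.2 | ij <- nz].

(** The integer product carries the scale H^3: two factors from the matrix, one from the vector. *)
Definition gram_digit (f : 'cV[R]_d) (j : 'I_d) : R :=
  \sum_(k < d) \sum_(i < n) qA i j * qA i k * quant H (f k 0).

Lemma gram_digit_int f j : gram_digit f j \is a Num.int.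
Proof.
apply: rpred_sum => k _; apply: rpred_sum => i _.
by rewrite !rpredM // /quant intr_int.
Qed.

Lemma gram_digitE f j : gram_digit f j / (H * (H * H)) =
  ((rnd_mx A H)^T *m rnd_mx A H *m map_mx (rnd H) f) j 0.
Proof.
rewrite -mulmxA mxE mulr_suml.
under [RHS]eq_bigr do rewrite !mxE mulr_sumr.
rewrite exchange_big /=; apply: eq_bigr => k _.
rewrite mulr_suml; apply: eq_bigr => i _.
by rewrite !mxE /rnd; field; rewrite expf_eq0 pnatr_eq0 andbF.
Qed.

Definition packed (s : state R) : Prop := [/\ precise s, layout Q L s &
  forall j : 'I_d, rmem s 10 j = \sum_(i < n) qA i j * \sum_(k < d) qA i k * rmem s 8 k].

(** Summing packed columns with integer weights acts on all digits at once; by symmetry of the Gram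
    matrix, its columns are also the rows needed for the product. *)
Lemma gather_value s (f : 'cV[R]_d) : packed s ->
  \sum_(c < size L) quant H (f (nth j0 L c) 0) * rmem s 10 (nth j0 L c) =
  \sum_(c < size L) gram_digit f (nth j0 L c) * Q ^+ c.
Proof.
move=> [_ [_ sL] s10].
have row i : \sum_(k < d) qA i k * rmem s 8 k =
    \sum_(c < size L) qA i (nth j0 L c) * Q ^+ c.
  rewrite -(sum_L j0 LU (f := fun k => qA i k * rmem s 8 k)) => [|k /(notin_L Lmem) ->].
    by apply: eq_bigr => c _; rewrite (sL c (ltn_ord c)).2.
  by rewrite quant0 mul0r.
rewrite (sum_L j0 LU (f := fun j => quant H (f j 0) * rmem s 10 j)); last first.
  move=> j jL; rewrite s10 big1 ?mulr0 // => i _.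
  by rewrite (notin_L Lmem i jL) quant0 mul0r.
under [RHS]eq_bigr do rewrite /gram_digit mulr_suml.
rewrite [RHS]exchange_big /=; apply: eq_bigr => j _.
rewrite s10; under [X in _ * X = _]eq_bigr => i _ do rewrite row mulr_sumr.
rewrite exchange_big /= mulr_sumr; apply: eq_bigr => c _.
rewrite mulr_sumr mulr_suml; apply: eq_bigr => i _; ring.
Qed.

Section OneIteration.
Variables (f fold a w : 'cV[R]_d) (sigma : R) (k : nat).
Hypothesis f_range : forall j, - Q <= H * f j 0 < Q.
Hypothesis digit_range : forall j, `|gram_digit f j| <= Q / 8.

Definition next_entry (j : 'I_d) : R :=
  2 * f j 0 - 4 * (gram_digit f j / (H * (H * H))) - fold j 0 + 4 * a j 0.

Lemma wp_gather s : packed s -> (forall j : 'I_d, rmem s 13 j = f j 0) ->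
  wp gather_cmd (size L * (floor_time (4 * m) + 100) + 50)
    (fun s' => rmem s' 15 0%N = \sum_(c < size L) gram_digit f (nth j0 L c) * Q ^+ c
       /\ nmem s' 7 0%N = size L) s.
Proof.
move=> ps s13; have [[s5 s6] [sN sL] _] := ps.
rewrite -(gather_value f ps).
apply: wp_le.
  apply: wp_seq; apply: wp_rstore => /=.
  apply: wp_seq; apply: wp_nstore => /=.
  set s1 := State _ _.
  pose I e (s' : state R) := rmem s' 15 0%N =
    \sum_(c < e) quant H (f (nth j0 L c) 0) * rmem s 10 (nth j0 L c).
  apply: (wp_for (I := I) (k0 := 0%N) (m := size L)) => //.
  - by rewrite /I big_ord0.
  - by move=> s' F; rewrite /= F.1.
  - by move=> i t1 t2 rE nE; rewrite /I rE.
  - move=> e s' es F; rewrite add0n => s'e s'15.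
    have s'4 : nmem s' 4 e = nth j0 L e by rewrite F.1 // /s1 /upd /= (sL e es).1.
    have s'5 : rmem s' 5 0%N = H by rewrite F.2.
    have s'6 : rmem s' 6 0%N = Q by rewrite F.2.
    have s'13 (j : 'I_d) : rmem s' 13 j = f j 0 by rewrite F.2 // /s1 /upd /= s13.
    have s'10 : rmem s' 10 = rmem s 10 by rewrite F.2.
    apply: wp_seq; apply: wp_rstore => /=; rewrite s'5 s'e s'4 s'13.
    apply: wp_seq; apply: wp_conseq (wp_floor (q := 4 * m) _ _) _ => /=.
    + by rewrite /upd /= s'6.
    + by rewrite /upd /=.
    move=> s2 [F2n F2r]; rewrite /upd /= -/(quant _ _) => s2z.
    have nE c : nmem s2 c = nmem s' c by rewrite F2n.
    apply: wp_rstore; rewrite /I /upd /= !nE s'e s'4 s2z.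
    rewrite (F2r 15%N) // (F2r 10%N) // /upd /= s'10.
    by rewrite s'15 big_ord_recr.
by rewrite /floor_time /=; clear; lia.
Qed.

(** The last columns of L have the largest weights and are popped first: after e rounds the final e
    columns are updated, and array 15 holds the digits of the others. *)
Lemma wp_scatter s : input_intact s -> packed s ->
  rmem s 15 0%N = \sum_(c < size L) gram_digit f (nth j0 L c) * Q ^+ c ->
  nmem s 7 0%N = size L -> nmem s 8 0%N = k -> rmem s 12 0%N = sigma ->
  (forall j : 'I_d, [/\ rmem s 13 j = f j 0, rmem s 14 j = fold j 0,
     rmem s 11 j = a j 0 & rmem s 4 j = w j 0]) ->
  wp scatter_cmd (size L * (floor_time (4 * m) + 200) + 50)
    (fun s' => forall j : 'I_d,
       if j \in L then [/\ rmem s' 13 j = next_entry j, rmem s' 14 j = f j 0 &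
         rmem s' 4 j = w j 0 + sigma * (nth 0 cst k * next_entry j)]
       else [/\ rmem s' 13 j = f j 0, rmem s' 14 j = fold j 0 & rmem s' 4 j = w j 0]) s.
Proof.
move=> hs ps s15 s7 s8 s12 sf; have [[s5 s6] [sN sL] _] := ps.
apply: wp_le.
  pose I e (s' : state R) := [/\ nmem s' 7 0%N = (size L - e)%N,
    rmem s' 15 0%N = \sum_(c < size L - e) gram_digit f (nth j0 L c) * Q ^+ c &
    forall j : 'I_d,
       if j \in drop (size L - e) L then [/\ rmem s' 13 j = next_entry j, rmem s' 14 j = f j 0 &
         rmem s' 4 j = w j 0 + sigma * (nth 0 cst k * next_entry j)]
       else [/\ rmem s' 13 j = f j 0, rmem s' 14 j = fold j 0 & rmem s' 4 j = w j 0]].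
  apply: (wp_while (I := I) (m := size L)).
  - by split; rewrite ?subn0 // drop_size => j /=; have [] := sf j.
  - move=> e s' es F [s'7 s'15 s'j].
    split; first by rewrite /= s'7 subn_gt0.
    have [c cE] : exists c, (size L - e)%N = c.+1 by exists (size L - e.+1)%N; lia.
    have cL : (c < size L)%N by lia.
    rewrite cE in s'7 s'15 s'j.
    set j := nth j0 L c.
    have s'4 : nmem s' 4 c = j by rewrite F.1 // (sL c cL).1.
    have s'8 : rmem s' 8 j = Q ^+ c by rewrite F.2 // (sL c cL).2.
    have s'5 : rmem s' 5 0%N = H by rewrite F.2.
    have s'6 : rmem s' 6 0%N = Q by rewrite F.2.
    have s'12 : rmem s' 12 0%N = sigma by rewrite F.2.
    have s'11 : rmem s' 11 j = a j 0 by rewrite F.2 //; have [] := sf j.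
    have s'k : nmem s' 8 0%N = k by rewrite F.1.
    have s'3 : rmem s' 3 k = nth 0 cst k by rewrite F.2 // (read_cst hs).
    have jnew : j \notin drop c.+1 L.
      have := drop_uniq c LU; rewrite (drop_nth j0 cL) //=.
      by case/andP.
    have [s'13 s'14 s'w] : [/\ rmem s' 13 j = f j 0, rmem s' 14 j = fold j 0 & rmem s' 4 j = w j 0].
      by have := s'j j; rewrite (negPf jnew).
    have Q2 : 2 <= Q by rewrite -[leLHS]expr1 ler_weXn2l ?ler1n //; lia.
    have [dig rng] := @top_digit _ Q (fun c => gram_digit f (nth j0 L c)) Q2
      (fun c => digit_range _) c (gram_digit_int f j).
    apply: wp_seq; apply: wp_nstore => /=; rewrite s'7 subn1 /=.
    apply: wp_seq; apply: wp_rstore => /=; rewrite /upd /= s'15 s'4 s'8.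
    apply: wp_seq; apply: wp_conseq (wp_floor (q := 4 * m) _ _) _ => /=.
    + by rewrite /upd /=.
    + by rewrite /upd /=; exact: rng.
    move=> s2 [F2n F2r]; rewrite /upd /= [X in _ = X -> _]dig -/j => s2z.
    have n7 : nmem s2 7 0%N = c by rewrite F2n.
    have n4 : nmem s2 4 c = j by rewrite F2n.
    have n8 : nmem s2 8 0%N = k by rewrite F2n.
    have rE b' : b' \notin [:: 16; 17; 18] -> rmem s2 b' = rmem s' b'.
      move=> a3; rewrite F2r /=; last by move: a3; rewrite !inE !negb_or => /and3P[-> -> _].
      move: a3; rewrite !inE !negb_or => /and3P[_ _ /negPf a18].
      by apply/funext => l; rewrite a18.
    have r15 := congr1 (fun g => g 0%N) (rE 15%N isT); rewrite /= s'15 in r15.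
    have r13 := rE 13%N isT; have r14 := rE 14%N isT; have r11 := rE 11%N isT.
    have r12 := congr1 (fun g => g 0%N) (rE 12%N isT); rewrite /= s'12 in r12.
    have r4 := rE 4%N isT.
    have r5 := congr1 (fun g => g 0%N) (rE 5%N isT); rewrite /= s'5 in r5.
    have r8 := congr1 (fun g : nat -> R => g j) (rE 8%N isT); rewrite /= s'8 in r8.
    have r3 := congr1 (fun g : nat -> R => g k) (rE 3%N isT); rewrite /= s'3 in r3.
    apply: wp_seq; apply: wp_rstore => /=; rewrite n7 n4 s2z r15 r8.
    apply: wp_seq; apply: wp_rstore; rewrite /upd /= n7 n4 s2z r13 r14 r11 r5 s'13 s'14 s'11.
    rewrite -/(next_entry j).
    apply: wp_seq; apply: wp_rstore; rewrite /= n7 n4 r13 s'13.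
    apply: wp_seq; apply: wp_rstore; rewrite /= n7 n4.
    apply: wp_rstore; rewrite /upd /= n7 n4 n8 r4 s'w r12 r3.
    rewrite /I.
    have -> : (size L - e.+1 = c)%N by lia.
    split=> //=.
      by rewrite big_ord_recr /= addrK.
    move=> l; rewrite (drop_nth j0) // inE -/j val_eqE.
    case: eqP => [->|_] /=; first by [].
    by rewrite r13 r14 r4; apply: s'j.
  - move=> s' F [s'7 _ s'j]; split; first by rewrite /= s'7 subnn.
    by move=> j; have := s'j j; rewrite subnn drop0.
by rewrite /floor_time /=; clear; lia.
Qed.

End OneIteration.

End Iterations.

(** The program never touches cells of zero columns; this shows that the initial 0 stays correct
    there. *)
Lemma iterate_zero (R : realType) n d (A : 'M[R]_(n, d)) (H : R) (a : 'cV[R]_d) j :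
  (forall i, A i j = 0) -> a j 0 = 0 -> forall k, iterate A H a k j 0 = 0.
Proof.
move=> Aj aj k; suff [] : iterate A H a k j 0 = 0 /\ iterate A H a k.+1 j 0 = 0 by [].
elim: k => [|k [IH1 IH2]].
  by rewrite /iterate /= !mxE aj mulr0.
split=> //; rewrite iterateSS !mxE IH1 IH2 aj !mulr0 big1 => [|i _]; first by ring.
rewrite !mxE big1 ?mul0r // => l _.
by rewrite !mxE Aj /rnd quant0 !mul0r.
Qed.

(** * The complete run *)

Section Run.
Variables (R : realType) (n d : nat) (A : 'M[R]_(n, d)) (b : 'cV[R]_n).
Variables (lambda gamma eps delta : R) (cst : seq R).
Variables (i0 : 'I_n) (j0 : 'I_d).
Local Notation s0 := (input_state A b lambda gamma eps delta cst).
Local Notation nz := (nz_positions A).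
Local Notation input_intact := (input_intact A b lambda gamma eps delta cst).
Local Notation layout := (layout j0).

Variable m : nat.
Hypothesis m0 : (0 < m)%N.
Local Notation H := (2 ^+ m : R).
Local Notation Q := (2 ^+ (4 * m) : R).
Local Notation precise := (precise m).

Section Iterate.
Variable L : seq 'I_d.
Hypothesis LU : uniq L.
Hypothesis Lmem : L =i [seq ij.2 | ij <- nz].
Local Notation packed := (packed A j0 m L).

Lemma packed_eq s s' : packed s ->
  (forall c, c \in [:: 5; 6; 8; 10]%N -> rmem s' c = rmem s c) ->
  (forall c, c \in [:: 4; 5]%N -> nmem s' c = nmem s c) -> packed s'.
Proof.
move=> [[s5 s6] [sN sL] s10] rE nE; split.
- by split; rewrite rE.
- by split; rewrite nE // rE.
- by move=> j; rewrite !rE.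
Qed.

Variables (a : 'cV[R]_d) (sigma : R).
Local Notation fs := (iterate A H a).
Hypothesis aL : forall j, j \notin L -> a j 0 = 0.
Hypothesis cst0 : (0 < size cst)%N.
Hypothesis f_range : forall k, (k < size cst)%N -> forall j, - Q <= H * fs k.+1 j 0 < Q.
Hypothesis digit_range : forall k, (k < size cst)%N ->
  forall j, `|gram_digit A m (fs k.+1) j| <= Q / 8.

(** After i rounds the stored pair is (fs (i+1), fs i) and the answer contains terms 0 to i. Term 0
    is present from the start because its iterate vanishes, so one round fewer than the table size
    is made. *)
Lemma wp_iterate s : input_intact s -> packed s -> rmem s 12 0%N = sigma ->
  (forall j : 'I_d, rmem s 11 j = a j 0 /\ rmem s 14 j = 2 * a j 0) ->
  rmem s 13 = (fun _ => 0) -> rmem s 4 = (fun _ => 0) ->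
  wp iterate_cmd ((size cst).-1 * (size L * (2 * floor_time (4 * m) + 300) + 150) + 50)
    (fun s' => forall j : 'I_d, rmem s' 4 j =
       sigma * \sum_(l < size cst) nth 0 cst l * fs l.+1 j 0) s.
Proof.
move=> hs ps s12 sa s13 s4; have [[s5 s6] [sN sL] _] := ps.
apply: wp_le.
  apply: wp_seq; apply: wp_nstore => /=.
  set s1 := State _ _.
  have hs1 : input_intact s1.
    split=> c cl; last exact: (hs.2 c cl).
    rewrite -(hs.1 c cl); apply/funext => l.
    by rewrite /s1 /upd /=; case: eqP cl => // ->.
  pose I i (s' : state R) := forall j : 'I_d,
    [/\ rmem s' 13 j = fs i.+1 j 0, rmem s' 14 j = fs i j 0
      & rmem s' 4 j = sigma * \sum_(l < i.+1) nth 0 cst l * fs l.+1 j 0].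
  apply: (wp_for (I := I) (k0 := 1%N) (m := (size cst).-1)) => //.
  - move=> j; split=> /=.
    + by rewrite s13 /iterate /= mxE.
    + by rewrite (sa j).2 /iterate /= !mxE.
    + by rewrite s4 big_ord1 /iterate /= mxE !mulr0.
  - by move=> s' F; rewrite /= F.1 // /s1 /upd /= (read_size_cst hs) add1n prednK.
  - by move=> i t1 t2 rE nE; rewrite /I rE.
  - move=> i s' ic F s'8 Is'.
    have hs' : input_intact s' := input_frame hs1 F isT isT.
    have ps' : packed s'.
      apply: (packed_eq ps) => c.
        by rewrite !inE => /or4P[] /eqP->; rewrite F.2.
      by rewrite !inE => /orP[] /eqP->; rewrite F.1.
    have ic' : (i < size cst)%N by lia.
    apply: wp_seq.
    have s'13 (j : 'I_d) : rmem s' 13 j = fs i.+1 j 0 by have [] := Is' j.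
    apply: wp_conseq (wp_gather LU Lmem (f_range ic') ps' s'13) _.
    move=> s2 F2 [s2_15 s2_7].
    have ps2 : packed s2.
      apply: (packed_eq ps') => c.
        by rewrite !inE => /or4P[] /eqP->; rewrite F2.2.
      by rewrite !inE => /orP[] /eqP->; rewrite F2.1.
    have hs2 : input_intact s2 := input_frame hs' F2 isT isT.
    apply: wp_conseq (wp_scatter m0 LU (f := fs i.+1) (fold := fs i) (a := a)
      (w := \col_j (sigma * \sum_(l < i.+1) nth 0 cst l * fs l.+1 j 0))
      (sigma := sigma) (k := i.+1)
      (digit_range ic') hs2 ps2 s2_15 s2_7 _ _ _) _.
    + by rewrite F2.1 // s'8.
    + by rewrite F2.2 // F.2.
    + move=> j; rewrite !F2.2 // mxE; have [-> -> ->] := Is' j; split=> //.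
      by rewrite F.2 // /s1 /= (sa j).1.
    move=> s3 F3 s3E j; have := s3E j; rewrite mxE.
    have nextE : next_entry A m (fs i.+1) (fs i) a j = fs i.+2 j 0.
      by rewrite /next_entry gram_digitE iterateSS !mxE.
    have [jL|jL] := ifPn.
      by rewrite nextE [in X in _ -> X]big_ord_recr /= mulrDr.
    have z k : fs k j 0 = 0.
      by apply: iterate_zero => [i'|]; [apply: notin_L Lmem _ _ _|apply: aL].
    move=> [-> -> ->]; rewrite !z; split=> //.
    by rewrite [in RHS]big_ord_recr /= z mulr0 addr0.
  - move=> s' F _ Is' j; have [_ _ ->] := Is' j.
    by rewrite prednK.
by rewrite /floor_time /=; clear; nia.
Qed.

End Iterate.

Definition pcr_time (m nnz l N : nat) : nat := (1000 * (m + 1) * (nnz + N * (l + 1)))%N.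

Hypothesis A1 : forall i j, `|A i j| <= 1.
Let sigma := \sum_j `|(A^T *m b) j 0|.
Let a := \col_j ((A^T *m b) j 0 / sigma).
Local Notation fs := (iterate A H a).
Hypothesis cst0 : (0 < size cst)%N.
Hypothesis target : nth 0 cst 0 * n%:R ^+ 7 < 2 ^+ m <= 2 * (nth 0 cst 0 * n%:R ^+ 7).
Hypothesis f_range : forall k, (k < size cst)%N -> forall j, - Q <= H * fs k.+1 j 0 < Q.
Hypothesis digit_range : forall k, (k < size cst)%N ->
  forall j, `|gram_digit A m (fs k.+1) j| <= Q / 8.

Lemma init_nmem c : (3 <= c)%N -> nmem s0 c = (fun _ => 0%N).
Proof.
by case: c => [|[|[|c]]] // _; apply/funext => i; rewrite /= /input_nmem /= !nth_nil.
Qed.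

Lemma init_rmem c : (4 <= c)%N -> rmem s0 c = (fun _ => 0).
Proof.
by case: c => [|[|[|[|c]]]] // _; apply/funext => i; rewrite /= /input_rmem /= !nth_nil.
Qed.

Lemma wp_pcr : exists l : nat, [/\ (l <= nnz A)%N, (l <= d)%N &
  wp pcr_cmd (pcr_time m (nnz A) l (size cst))
    (fun s' => output d s' =
       sigma *: \sum_(k < size cst) nth 0 cst k *: fs k.+1) s0].
Proof.
have [L [LU Lmem wpL]] := wp_layout A b lambda gamma eps delta cst i0 j0.
exists (size L); split.
- rewrite -(size_nz_positions A) -(size_map (fun ij => ij.2)).
  by apply: uniq_leq_size => // j; rewrite Lmem.
- by rewrite -[X in (_ <= X)%N]card_ord cardE; apply: uniq_leq_size => // j _; rewrite mem_enum.
have aL0 j : j \notin L -> (A^T *m b) j 0 = 0.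
  move=> jL; rewrite mxE big1 // => i _.
  by rewrite mxE (notin_L Lmem i jL) mul0r.
have aL j : j \notin L -> a j 0 = 0 by move=> /aL0 aj; rewrite mxE aj mul0r.
rewrite -(size_nz_positions A); apply: wp_le.
  apply: wp_seq; apply: wp_conseq (wp_precision (s := s0) _ erefl target) _ => //.
  move=> s1 F1 [s1_5 s1_6].
  have hs1 : input_intact s1 by apply: (input_frame _ F1).
  apply: wp_seq; apply: wp_conseq (wpL s1 Q hs1 s1_6 _ _ _) _.
  1-3: by rewrite F1.1 // init_nmem.
  move=> s2 F2 s2L; have hs2 := input_frame hs1 F2 isT isT.
  have p2 : precise s2 by split; rewrite F2.2.
  apply: wp_seq; apply: wp_conseq (wp_pack_rows i0 j0 m0 A1 hs2 p2 _ _) _.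
  1-2: by rewrite F2.2 // F1.2 // init_rmem.
  move=> s3 F3 [s3_19 s3_11 s3_9]; have hs3 := input_frame hs2 F3 isT isT.
  apply: wp_seq; apply: wp_conseq (wp_pack_gram (i0 := i0) (j0 := j0) (m := m) hs3 s3_19 _) _.
    by rewrite F3.2 // F2.2 // F1.2 // init_rmem.
  move=> s4 F4 s4_10; have hs4 := input_frame hs3 F4 isT isT.
  have p4 : packed A j0 m L s4.
    split.
    - by split; rewrite F4.2 // F3.2 //; case: p2.
    - have [e5 eL] := s2L; split; rewrite F4.1 // F3.1 //.
      by move=> c /eL; rewrite F4.2 // F3.2.
    - move=> j; rewrite s4_10; apply: eq_bigr => i _; rewrite s3_9.
      by rewrite F4.2 // F3.2.
  have s4_11 (j : 'I_d) : rmem s4 11 j = (A^T *m b) j 0 by rewrite F4.2.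
  have [_ L4 _] := p4.
  apply: wp_seq; apply: wp_conseq (wp_l1norm (m := m) LU L4 _ _ s4_11 aL0) _.
  + by rewrite F4.1 // F3.1 // F2.1 // F1.1 // init_nmem.
  + by rewrite F4.2 // F3.2 // F2.2 // F1.2 // init_rmem.
  move=> s5 F5 s5_12; have hs5 := input_frame hs4 F5 isT isT.
  have p5 : packed A j0 m L s5.
    apply: (packed_eq p4) => c.
      by rewrite !inE => /or4P[] /eqP->; rewrite F5.2.
    by rewrite !inE => /orP[] /eqP->; rewrite F5.1.
  have s5_11 (j : 'I_d) : rmem s5 11 j = (A^T *m b) j 0 by rewrite F5.2.
  have [_ L5 _] := p5.
  apply: wp_seq; apply: wp_conseq (wp_normalize (m := m) LU L5 s5_12 s5_11 aL0 _) _.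
    by rewrite F5.2 // F4.2 // F3.2 // F2.2 // F1.2 // init_rmem.
  move=> s6 F6 s6a; have hs6 := input_frame hs5 F6 isT isT.
  have p6 : packed A j0 m L s6.
    apply: (packed_eq p5) => c.
      by rewrite !inE => /or4P[] /eqP->; rewrite F6.2.
    by rewrite !inE => /orP[] /eqP->; rewrite F6.1.
  apply: wp_conseq (wp_iterate LU Lmem aL cst0 f_range digit_range hs6 p6 (sigma := sigma) _ _ _ _) _.
  + by rewrite F6.2.
  + by move=> j; have [-> ->] := s6a j; rewrite [a j 0]mxE.
  + by rewrite F6.2 // F5.2 // F4.2 // F3.2 // F2.2 // F1.2 // init_rmem.
  + by rewrite F6.2 // F5.2 // F4.2 // F3.2 // F2.2 // F1.2 // init_rmem.
  move=> s7 F7 s7_4; apply/colP => j; rewrite !mxE s7_4 summxE; congr (_ * _).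
  by apply: eq_bigr => k _; rewrite mxE.
rewrite /pcr_time /floor_time; move: (size nz) (size L) (size cst) cst0 => e l N.
clear; case: N => // N _ /=; nia.
Qed.

End Run.

(** From p = 6 on, p^4 grows per step by at most (7/6)^4 = 2401/1296 < 2. *)
Lemma expn4_le p : (p ^ 4 <= 100 * 2 ^ p)%N.
Proof.
have [p6|] := leqP p 6; first by case: p p6 => [|[|[|[|[|[|[|]]]]]]].
elim: p => // p IH; rewrite ltnS leq_eqVlt => /orP[/eqP <- //|p6].
have {}IH := IH p6; have : (6 ^ 4 * p.+1 ^ 4 <= 7 ^ 4 * p ^ 4)%N.
  by rewrite -!expnMn leq_exp2r //; lia.
rewrite [(2 ^ p.+1)%N]expnS -[(6 ^ 4)%N]/1296%N -[(7 ^ 4)%N]/2401%N.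
by move: (p.+1 ^ 4)%N (p ^ 4)%N (2 ^ p)%N IH => x y z; lia.
Qed.

(** * The table of constants *)

Section Precomputation.
Variable R : realType.

(** The table may not depend on n, so cell 0 holds the required precision without its factor n^7,
    which the program supplies. *)
Definition precomputed (lambda gamma eps : R) (cst : seq R) : Prop :=
  exists p m : nat, exists r : nat -> R, let N := (2 * p * m)%N in
  [/\ [/\ (0 < p)%N, (0 < m)%N & size cst = N],
      m%:R <= 3 / (gamma * lambda),
      2 ^+ p <= 2 ^+ 17 * m%:R ^+ 4 / eps ^+ 2,
      24 * N%:R ^+ 4 <= eps ^+ 2 * 4 ^+ p &
  [/\ nth 0 cst 0 = 280 * N%:R ^+ 5 / eps,
      forall k, (0 < k < N)%N -> nth 0 cst k = r k,
      \sum_(k < N) `|r k| <= N%:R &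
  forall x, let s := \sum_(k < N) r k * cos (k%:R * x) in
    [/\ 0 <= s <= 1,
        1 - 2 * (1 - gamma) * lambda <= cos x -> 1 - N%:R * 4 ^- p <= s
      & cos x <= 1 - 2 * (1 + gamma) * lambda -> s <= N%:R * 4 ^- p]]].

(** In terms of cosines the half-gap is 2 gamma lambda, so m about 2 / (gamma lambda) meets the
    demand of [step_filter]. Since N = 2pm, the demand on 4^p reads 384 p^4 m^4 <= eps^2 4^p; with
    p^4 <= 100 * 2^p it suffices that 2^p exceeds 2^16 m^4 / eps^2. *)
Lemma exists_precomputed (lambda gamma eps : R) :
  0 < lambda < 1 -> 0 < gamma < 1 -> 0 < eps < 1 ->
  exists cst, precomputed lambda gamma eps cst.
Proof.
move=> /andP[l0 l1] /andP[g0 g1] /andP[e0 e1].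
have gl0 : 0 < gamma * lambda by rewrite mulr_gt0.
have gl1 : gamma * lambda <= 1 by nra.
pose y := 2 / (gamma * lambda).
have y2 : 2 <= y by rewrite /y ler_pdivlMr //; lra.
pose m := (Num.trunc y).+1.
have /andP[m1 m2] : m.-1%:R <= y < m%:R.
  by apply: Num.Theory.trunc_itv; lra.
have mle : m%:R <= 3 / (gamma * lambda).
  have -> : 3 / (gamma * lambda) = y + 1 / (gamma * lambda) by rewrite /y; field; rewrite !gt_eqF.
  have : 1 <= 1 / (gamma * lambda) by rewrite ler_pdivlMr //; lra.
  by move: m1; rewrite /m /= -natr1; lra.
have mR : 1 <= m%:R :> R by rewrite ler1n.
have e2 : 0 < eps ^+ 2 by rewrite exprn_gt0.
have e21 : eps ^+ 2 <= 1 by rewrite expr_le1 // ltW.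
have c16 : 384 * 100 <= 2 ^+ 16 :> R.
  have -> : 2 ^+ 16 = 256 * 256 :> R by ring.
  by lra.
pose X : R := 2 ^+ 16 * m%:R ^+ 4 / eps ^+ 2.
have m4 : 1 <= m%:R ^+ 4 :> R by rewrite exprn_ege1.
have X1 : 1 <= X by rewrite /X ler_pdivlMr // mul1r (le_trans e21) // mulr_ege1 // exprn_ege1 // ler1n.
have [p /andP[p1 p2]] := exists_pow2 X1.
have p0 : (0 < p)%N by case: p p1 {p2} => //; rewrite expr0 ltNge X1.
pose N := (2 * p * m)%N.
have N0 : (0 < N)%N by rewrite !muln_gt0 p0.
have gsf : 0 < 2 * (gamma * lambda) by lra.
have sf8 : 8 <= m%:R ^+ 2 * (2 * (gamma * lambda)) ^+ 2.
  have : 2 <= m%:R * (gamma * lambda) by rewrite -ler_pdivrMr // ltW.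
  rewrite -exprMn => h; have : 4 <= m%:R * (2 * (gamma * lambda)) by lra.
  nra.
have [r rN rs] := step_filter (1 - 2 * lambda) gsf p0 sf8.
exists (mkseq (fun k => if k == 0%N then 280 * N%:R ^+ 5 / eps else r k) N).
exists p, m, r; split => //.
- by rewrite size_mkseq.
- by apply: le_trans p2 _; rewrite /X [2 ^+ 17]exprS !mulrA.
- have -> : 24 * (2 * p * m)%:R ^+ 4 = 384 * m%:R ^+ 4 * p%:R ^+ 4 :> R.
    by rewrite !natrM; ring.
  have p4 : p%:R ^+ 4 <= 100 * 2 ^+ p :> R.
    by rewrite -!natrX -natrM ler_nat expn4_le.
  have -> : 4 ^+ p = 2 ^+ p * 2 ^+ p :> R by rewrite -exprMn; congr (_ ^+ _); ring.
  move: p1; rewrite /X ltr_pdivrMr // => p1.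
  have q0 : 0 <= 2 ^+ p :> R by rewrite exprn_ge0.
  have h1 : 384 * m%:R ^+ 4 * p%:R ^+ 4 <= 384 * m%:R ^+ 4 * (100 * 2 ^+ p) :> R.
    by rewrite ler_wpM2l //; lra.
  have h2 : 2 ^+ 16 * m%:R ^+ 4 * 2 ^+ p <= 2 ^+ p * eps ^+ 2 * 2 ^+ p.
    by rewrite ler_wpM2r // ltW.
  have h3 : 384 * 100 * (m%:R ^+ 4 * 2 ^+ p) <= 2 ^+ 16 * (m%:R ^+ 4 * 2 ^+ p) :> R.
    by rewrite ler_wpM2r // mulr_ge0 //; lra.
  by move: h1 h2 h3; lra.
split=> //.
- by rewrite nth_mkseq.
- by move=> k /andP[k0 kN]; rewrite nth_mkseq // gtn_eqF.
move=> x; have [s01 slo shi] := rs x; split=> // h.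
  by apply: slo; move: h; lra.
by apply: shi; move: h; lra.
Qed.

Lemma exponent_le_ln (t e : nat) (S : R) : 0 < S -> 2 ^+ t <= S ^+ e ->
  t%:R <= e%:R / ln 2 * ln S.
Proof.
move=> S0 h; have ln2 : 0 < ln 2 :> R by rewrite ln_gt0 // ltr1n.
rewrite mulrAC ler_pdivlMr //.
rewrite mulr_natl -lnXn // mulr_natl -lnXn //.
by rewrite ler_ln // posrE exprn_gt0.
Qed.

End Precomputation.

(** * Correctness and running time *)

Lemma norm_sum_le (R : realType) n (f : 'I_n -> R) (B : R) :
  (forall i, `|f i| <= B) -> `|\sum_i f i| <= n%:R * B.
Proof.
move=> fB; apply: le_trans (ler_norm_sum _ _ _) _.
apply: (@le_trans _ _ (\sum_(i < n) B)); first exact: ler_sum.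
by rewrite sumr_const card_ord mulr_natl.
Qed.

Section Correctness.
Variables (R : realType) (n d : nat) (A : 'M[R]_(n, d)) (b : 'cV[R]_n).
Variables (lam : 'I_d -> R) (nu : 'I_d -> 'cV[R]_d).
Hypothesis hA : eigensystem A lam nu.
Hypothesis lam1 : forall i, lam i <= 1.
Hypothesis d0 : (0 < d)%N.
Hypothesis dn : (d <= n)%N.
Variables (N m : nat) (eps : R).
Hypothesis N0 : (0 < N)%N.
Hypothesis heps : 0 < eps < 1.
Local Notation H := (2 ^+ m : R).
Local Notation Q := (2 ^+ (4 * m) : R).
Hypothesis Hbig : 280 * N%:R ^+ 5 / eps * n%:R ^+ 7 < H.

Let sigma := \sum_j `|(A^T *m b) j 0|.
Let a := \col_j ((A^T *m b) j 0 / sigma).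
Local Notation fs := (iterate A H a).
Let F : R := 7 * n%:R * N%:R ^+ 2.

Let n1 : 1 <= n%:R :> R. Proof. by rewrite ler1n (leq_trans d0). Qed.
Let N1 : 1 <= N%:R :> R. Proof. by rewrite ler1n. Qed.
Let HE : H = (2 ^ m)%N%:R. Proof. by rewrite natrX. Qed.

(** A single lower bound on H dominates every monomial in n and N that occurs below. *)
Let powers_le (i j : nat) : (i <= 7)%N -> (j <= 5)%N -> 280 * n%:R ^+ i * N%:R ^+ j <= H.
Proof.
move=> i7 j5; apply: le_trans (ltW Hbig).
have /andP[e0 e1] := heps.
have hn : n%:R ^+ i <= n%:R ^+ 7 :> R by rewrite ler_weXn2l.
have hN : N%:R ^+ j <= N%:R ^+ 5 :> R by rewrite ler_weXn2l.
have nN0 : 0 <= n%:R ^+ 7 * N%:R ^+ 5 :> R by rewrite mulr_ge0 // exprn_ge0.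
apply: (@le_trans _ _ (280 * (n%:R ^+ 7 * N%:R ^+ 5))).
  rewrite -mulrA ler_wpM2l // ler_pM // exprn_ge0 //.
have -> : 280 * N%:R ^+ 5 / eps * n%:R ^+ 7 = 280 * (n%:R ^+ 7 * N%:R ^+ 5) / eps.
  by field; rewrite gt_eqF.
rewrite ler_pdivlMr // ler_piMr ?(ltW e1) //.
by rewrite mulr_ge0.
Qed.

Let H280 : 280 <= H.
Proof. by have := powers_le (leq0n _) (leq0n _); rewrite !expr0 !mulr1. Qed.

Let m0 : (0 < m)%N.
Proof.
by case: (posnP m) => // m0; have := H280; rewrite m0 expr0 => h; exfalso; move: h; lra.
Qed.

Let A1 i j : `|A i j| <= 1. Proof. exact: norm_entry_le1 hA lam1 i j. Qed.

Let sigma0 : 0 <= sigma. Proof. by apply: sumr_ge0. Qed.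

Let atb : A^T *m b = sigma *: a.
Proof.
apply/colP => j; rewrite !mxE -[\sum_(_ < n) _](_ : (A^T *m b) j 0 = _); last by rewrite mxE.
have [s0|s0] := eqVneq sigma 0; last by rewrite mulrCA divff ?mulr1.
have /eqP := s0; rewrite psumr_eq0 // => /allP /(_ j (mem_index_enum _)) /=.
by rewrite normr_eq0 => /eqP ->; rewrite mul0r mulr0.
Qed.

Let a1 : \sum_c `|a c 0| <= 1.
Proof.
under eq_bigr do rewrite mxE normrM.
rewrite -mulr_suml -/sigma normfV (ger0_norm sigma0).
(* If A^T b = 0, division by 0 yields a = 0 and the bound still holds. *)
by have [->|s0] := eqVneq sigma 0; rewrite ?mul0r ?ler01 // divff.
Qed.

Let hbig : 140 * n%:R ^+ 4 * N%:R ^+ 2 <= (2 ^ m)%N%:R :> R.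
Proof.
rewrite -HE; apply: le_trans (@powers_le 4 2 _ _) => //.
rewrite -!mulrA ler_wpM2r ?mulr_ge0 ?exprn_ge0 //; lra.
Qed.

Let fs_bound k : (k < N)%N -> forall j, `|fs k.+1 j 0| <= F.
Proof.
move=> kN; have h0 : (0 < 2 ^ m)%N by rewrite expn_gt0.
have [B _] := iterate_bound hA lam1 dn a1 h0 N0 hbig d0 (ltnW kN).
by move=> j; have := B j; rewrite -HE.
Qed.

Let F_H : 16 * n%:R ^+ 2 * F <= H.
Proof.
apply: le_trans (@powers_le 3 2 _ _) => //; rewrite /F.
have : 0 <= n%:R ^+ 3 * N%:R ^+ 2 :> R by rewrite mulr_ge0 ?exprn_ge0.
have -> : 16 * n%:R ^+ 2 * (7 * n%:R * N%:R ^+ 2) = 112 * (n%:R ^+ 3 * N%:R ^+ 2) :> R.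
  by ring.
rewrite -mulrA; lra.
Qed.

Let F1 : 1 <= F.
Proof. have : 1 <= N%:R ^+ 2 :> R by rewrite exprn_ege1. rewrite /F; move: n1; nra. Qed.

Lemma iterate_in_range k : (k < N)%N -> forall j, - Q <= H * fs k.+1 j 0 < Q.
Proof.
move=> kN j; apply: (scaled_in_range m0 (fs_bound kN j)).
rewrite QE; have n2 : 1 <= n%:R ^+ 2 :> R by rewrite exprn_ege1.
have FH : F <= H by apply: le_trans F_H; move: F1; nra.
have h := H280; have -> : H ^+ 4 = H * (H * H ^+ 2) by ring.
rewrite ltr_pM2l ?(lt_le_trans _ h) //.
apply: le_lt_trans FH _; rewrite ltr_pMr ?(lt_le_trans _ h) //.
by rewrite exprn_egt1 // (lt_le_trans _ h) // ltr1n.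
Qed.

(** A digit is a sum of dn products of size at most H * H * 2HF, hence at most 2 n^2 F H^3; [F_H]
    turns this into H^4 / 8. *)
Lemma gram_digit_in_range k : (k < N)%N -> forall j, `|gram_digit A m (fs k.+1) j| <= Q / 8.
Proof.
move=> kN j; have h := H280; have H0 : 0 <= H by lra.
have qA1 i l : `|quant H (A i l)| <= H by rewrite HE quant_le.
have qf l : `|quant H (fs k.+1 l 0)| <= 2 * (H * F).
  have /andP[q1 q2] := quant_itv H (fs k.+1 l 0).
  have := fs_bound kN l; rewrite ler_norml => /andP[f1 f2].
  have : H * fs k.+1 l 0 <= H * F by rewrite ler_wpM2l.
  have : H * - F <= H * fs k.+1 l 0 by rewrite ler_wpM2l.
  have : 1 <= H * F by move: F1; nra.
  by rewrite ler_norml mulrN; lra.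
apply: (@le_trans _ _ (d%:R * (n%:R * (H * H * (2 * (H * F)))))).
  apply: norm_sum_le => l; apply: norm_sum_le => i.
  by rewrite !normrM; apply: ler_pM => //; rewrite ?mulr_ge0 //; apply: ler_pM.
have HF : 0 <= H * H * (2 * (H * F)) by rewrite !mulr_ge0 // (le_trans _ F1).
apply: (@le_trans _ _ (n%:R * (n%:R * (H * H * (2 * (H * F)))))).
  by rewrite ler_wpM2r ?mulr_ge0 // ler_nat.
rewrite QE ler_pdivlMr //.
have -> : n%:R * (n%:R * (H * H * (2 * (H * F)))) * 8 = H ^+ 3 * (16 * n%:R ^+ 2 * F) by ring.
have -> : H ^+ 4 = H ^+ 3 * H by ring.
by rewrite ler_wpM2l ?exprn_ge0.
Qed.

(** Error budget: n from the coordinates, n^2 from [sigma], N^3 from the recurrence and summation,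
    and 140 n^4 N^2 / H from each defect multiply to 140 N^5 n^7 / H, which [Hbig] puts below eps /
    2. *)
Lemma pcr_success_iterate (lambda gamma : R) (p mk : nat) (r : nat -> R) :
  N = (2 * p * mk)%N -> 0 < lambda < 1 -> 0 < gamma < 1 -> (0 < p)%N -> (0 < mk)%N ->
  24 * N%:R ^+ 4 <= eps ^+ 2 * 4 ^+ p ->
  \sum_(k < N) `|r k| <= N%:R ->
  (forall x, let s := \sum_(k < N) r k * cos (k%:R * x) in
    [/\ 0 <= s <= 1,
        1 - 2 * (1 - gamma) * lambda <= cos x -> 1 - N%:R * 4 ^- p <= s
      & cos x <= 1 - 2 * (1 + gamma) * lambda -> s <= N%:R * 4 ^- p]) ->
  pcr_success A lam nu lambda gamma eps b (sigma *: (\sum_(k < N) r k *: fs k.+1)).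
Proof.
move=> NE hl hg p0 mk0 hN rN rs.
have h0 : (0 < 2 ^ m)%N by rewrite expn_gt0.
have Hp : 0 < H by apply: lt_le_trans H280.
pose eta : R := 140 * n%:R ^+ 4 * N%:R ^+ 2 / H.
have eta0 : 0 <= eta by rewrite /eta !mulr_ge0 ?exprn_ge0 ?invr_ge0 ?(ltW Hp).
have He i k : (k < N)%N -> `|dot (nu i) (defect A a fs k)| <= eta.
  move=> kN; have [_ B] := iterate_bound hA lam1 dn a1 h0 N0 hbig d0 (ltnW kN).
  by have := B i k (leqnn k); rewrite -HE.
rewrite NE in hN rN rs He *.
apply: (pcr_success_of_iteration hA lam1 _ _ atb hl hg heps eta0 sigma0 p0 mk0 hN rN rs He) => //.
have b0 := l2norm_ge0 b; have /andP[e0 e1] := heps.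
rewrite -NE; have Hb := Hbig; set NN : R := N%:R in Hb eta eta0 He *.
have dnR : d%:R <= n%:R :> R by rewrite ler_nat.
have sig : sigma <= n%:R ^+ 2 * l2norm b.
  apply: le_trans (sum_AtB_le hA lam1 b) _; apply: ler_wpM2r => //.
  by rewrite lerXn2r ?nnegrE.
have N3e : 0 <= NN ^+ 3 * eta by rewrite mulr_ge0 ?exprn_ge0.
apply: (@le_trans _ _ (n%:R * (n%:R ^+ 2 * l2norm b * (NN ^+ 3 * eta)))).
  by apply: ler_pM => //; [rewrite mulr_ge0|rewrite ler_wpM2r].
have -> : n%:R * (n%:R ^+ 2 * l2norm b * (NN ^+ 3 * eta)) =
   (140 * NN ^+ 5 * n%:R ^+ 7 / H) * l2norm b by rewrite /eta; ring.
apply: ler_wpM2r => //; rewrite ler_pdivrMr //.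
have : 280 * NN ^+ 5 * n%:R ^+ 7 <= H * eps.
  have -> : 280 * NN ^+ 5 * n%:R ^+ 7 = 280 * NN ^+ 5 / eps * n%:R ^+ 7 * eps.
    by field; rewrite gt_eqF.
  by rewrite ler_wpM2r ?(ltW e0) ?(ltW Hb).
lra.
Qed.

End Correctness.

Section Frobenius.
Variables (R : realType) (n d : nat) (A : 'M[R]_(n, d)).
Variables (lam : 'I_d -> R) (nu : 'I_d -> 'cV[R]_d).
Hypothesis hA : eigensystem A lam nu.

(** Cauchy-Schwarz in each row of A. For the top eigenvalue this says that the stable rank is at
    least 1. *)
Lemma lam_le_frobenius i : lam i <= \sum_k \sum_j A k j ^+ 2.
Proof.
have -> : lam i = dot (A *m nu i) (A *m nu i).
  by rewrite dot_mulmx mulmxA (dot_nu_gram hA) (dot_nu hA) eqxx mulr1.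
rewrite dotE; apply: ler_sum => k _.
pose u : 'cV[R]_d := \col_j A k j.
have Ak : (A *m nu i) k 0 = dot u (nu i).
  by rewrite dotE mxE; apply: eq_bigr => j _; rewrite mxE.
have nui : l2norm (nu i) = 1.
  by apply/eqP; rewrite -(@eqrXn2 _ 2) ?l2norm_ge0 // sqr_l2norm (dot_nu hA) eqxx expr1n.
have uE : l2norm u ^+ 2 = \sum_j A k j ^+ 2.
  by rewrite sqr_l2norm dotE; apply: eq_bigr => j _; rewrite mxE expr2.
rewrite Ak -expr2 -uE -[leLHS]real_normK ?num_real //.
rewrite lerXn2r ?nnegrE ?l2norm_ge0 // ler_norml.
have := dot_le_l2norm u (nu i); have := dot_le_l2norm u (- nu i).
have -> : l2norm (- nu i) = 1.
  by rewrite -nui /l2norm; congr Num.sqrt; apply: eq_bigr => j _; rewrite mxE sqrrN.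
rewrite nui dotNr !mulr1; lra.
Qed.

Lemma nnz_gt0 i : 0 < lam i -> (0 < nnz A)%N.
Proof.
move=> l0; rewrite lt0n; apply: contraTneq l0 => nz0; rewrite -leNgt.
apply: le_trans (lam_le_frobenius i) _; rewrite big1 // => k _; rewrite big1 // => j _.
have := mem_nz A k j; have : size (nz_positions A) = 0%N by rewrite size_nz_positions.
by move/size0nil => ->; rewrite in_nil; case: eqP => // ->; rewrite expr0n.
Qed.

End Frobenius.

(* The bounds [S ^ 21] and [S ^ 138] absorb the constants, as [6 <= S]. *)
Lemma pcr_time_bound (R : realType) (nz d l p mk m n : nat) (sr lam1 lambda gamma eps S : R) :
  let N := (2 * p * mk)%N in
  (l <= nz)%N -> (l <= d)%N -> (0 < nz)%N -> (0 < d)%N -> (0 < p)%N -> 1 <= sr ->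
  2^-1 <= lam1 <= 1 -> 0 < lambda -> 0 < gamma -> 0 < eps ->
  6 <= S -> n%:R <= S -> lambda^-1 <= S -> gamma^-1 <= S -> eps^-1 <= S ->
  mk%:R <= 3 / (gamma * lambda) -> 2 ^+ p <= 2 ^+ 17 * mk%:R ^+ 4 / eps ^+ 2 ->
  2 ^+ m <= 2 * (280 * N%:R ^+ 5 / eps * n%:R ^+ 7) ->
  (pcr_time m nz l N)%:R <=
    24 * 1000 * (138%:R / ln 2) * (21%:R / ln 2)
    * (nz%:R + Num.sqrt (nz%:R * d%:R * sr) * (lam1 / lambda / gamma)) * ln S ^+ 2.
Proof.
move=> N lnz ld nz0 d0 p0 sr1 /andP[lam1h lam1_1] lambda0 gamma0 eps0 S6 nS lS gS eS mkle pX mX.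
have S0 : 0 < S by lra.
have S1 : 1 <= S by lra.
have Sp (i j : nat) : (i <= j)%N -> S ^+ i <= S ^+ j by move=> ij; rewrite ler_weXn2l.
have Sge0 i : 0 <= S ^+ i by rewrite exprn_ge0 // ltW.
have mkS : mk%:R <= S ^+ 3.
  apply: le_trans mkle _; rewrite invfM mulrA [S ^+ 3]exprS expr2 mulrA.
  have gi : 0 <= gamma^-1 by rewrite invr_ge0 ltW.
  have li : 0 <= lambda^-1 by rewrite invr_ge0 ltW.
  apply: ler_pM => //; first by rewrite mulr_ge0.
  by apply: ler_pM => //; lra.
have six k : 6 ^+ k <= S ^+ k by rewrite lerXn2r ?nnegrE // ltW.
have pS : 2 ^+ p <= S ^+ 21.
  apply: le_trans pX _.
  have c17 : 2 ^+ 17 <= S ^+ 7.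
    apply: le_trans (six 7%N).
    have -> : 2 ^+ 17 = 256 * 512 :> R by ring.
    have -> : 6 ^+ 7 = 216 * 216 * 6 :> R by ring.
    lra.
  have mk4 : mk%:R ^+ 4 <= S ^+ 12.
    by rewrite (exprM S 3 4) lerXn2r ?nnegrE.
  have e2 : (eps ^+ 2)^-1 <= S ^+ 2.
    by rewrite -exprVn lerXn2r ?nnegrE ?invr_ge0 ?(ltW eps0) ?(ltW S0).
  have -> : S ^+ 21 = S ^+ 7 * S ^+ 12 * S ^+ 2 by rewrite -!exprD.
  apply: ler_pM => //.
  - by rewrite mulr_ge0 ?exprn_ge0.
  - by rewrite invr_ge0 exprn_ge0 // ltW.
  - by apply: ler_pM => //; rewrite exprn_ge0.
have NS : N%:R <= S ^+ 25.
  rewrite /N !natrM; have -> : S ^+ 25 = S * S ^+ 21 * S ^+ 3 by rewrite -exprS -exprD.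
  apply: ler_pM => //; first by rewrite mulr_ge0.
  apply: ler_pM => //; first by lra.
  by apply: le_trans pS; rewrite -natrX ler_nat ltnW // ltn_expl.
have mS : 2 ^+ m.+1 <= S ^+ 138.
  rewrite exprS; apply: (@le_trans _ _ (2 * (2 * (280 * N%:R ^+ 5 / eps * n%:R ^+ 7)))).
    by rewrite ler_wpM2l.
  have c4 : 2 * 2 * 280 <= S ^+ 4.
    apply: le_trans (six 4%N); have -> : 6 ^+ 4 = 36 * 36 :> R by ring.
    lra.
  have N5 : N%:R ^+ 5 <= S ^+ 125 by rewrite (exprM S 25 5) lerXn2r ?nnegrE.
  have n7 : n%:R ^+ 7 <= S ^+ 7 by rewrite lerXn2r ?nnegrE // ltW.
  have -> : 2 * (2 * (280 * N%:R ^+ 5 / eps * n%:R ^+ 7)) =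
    (2 * 2 * 280) * N%:R ^+ 5 * eps^-1 * n%:R ^+ 7 by ring.
  apply: (@le_trans _ _ (S ^+ 4 * S ^+ 125 * S * S ^+ 7)).
    have ei : 0 <= eps^-1 by rewrite invr_ge0 ltW.
    have z1 : 0 <= 2 * 2 * 280 :> R by rewrite !mulr_ge0.
    have z2 : 0 <= N%:R ^+ 5 :> R by rewrite exprn_ge0.
    have z3 : 0 <= n%:R ^+ 7 :> R by rewrite exprn_ge0.
    have w1 := ler_pM z1 z2 c4 N5.
    have w2 := ler_pM (mulr_ge0 z1 z2) ei w1 eS.
    exact: ler_pM (mulr_ge0 (mulr_ge0 z1 z2) ei) z3 w2 n7.
  by rewrite -exprD -exprSr -exprD Sp.
have ln2 : 0 < ln 2 :> R by rewrite ln_gt0 // ltr1n.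
have pl := exponent_le_ln S0 pS.
have ml := exponent_le_ln S0 mS.
set lS' := ln S in pl ml *.
pose M := Num.sqrt (nz%:R * d%:R * sr) * (lam1 / lambda / gamma).
have nzd : 0 <= nz%:R * d%:R :> R by rewrite mulr_ge0.
(* As l is at most both nnz and d, its square is at most their product, and the stable rank only
   increases it. *)
have M1 : (l + 1)%:R <= 2 * Num.sqrt (nz%:R * d%:R * sr).
  have sq x : 0 <= x -> x ^+ 2 <= nz%:R * d%:R -> x <= Num.sqrt (nz%:R * d%:R * sr).
    move=> x0 xx; have -> : x = Num.sqrt (x ^+ 2) by rewrite sqrtr_sqr ger0_norm.
    apply: ler_wsqrtr.
    by apply: le_trans xx _; rewrite ler_peMr.
  have q1 : l%:R <= Num.sqrt (nz%:R * d%:R * sr).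
    by apply: sq => //; rewrite expr2 -!natrM ler_nat leq_mul.
  have q2 : 1 <= Num.sqrt (nz%:R * d%:R * sr).
    by apply: sq => //; rewrite expr1n -natrM ler1n muln_gt0 nz0.
  by rewrite natrD; lra.
(* Here lam1 >= 1/2 is used to trade 1 / lambda for kappa. *)
have kg : 3 / (gamma * lambda) <= 6 * (lam1 / lambda / gamma).
  have -> : 6 * (lam1 / lambda / gamma) = (6 * lam1) / (gamma * lambda).
    by field; rewrite !gt_eqF.
  have gl0 : 0 <= (gamma * lambda)^-1 by rewrite invr_ge0 mulr_ge0 // ltW.
  by apply: (ler_wpM2r gl0); lra.
have lam1p : 0 <= lam1 by lra.
have kg0 : 0 <= lam1 / lambda / gamma.
  by rewrite !mulr_ge0 ?invr_ge0 ?(ltW lambda0) ?(ltW gamma0).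
have M0 : 0 <= M by rewrite mulr_ge0 ?sqrtr_ge0.
have NM : (N * (l + 1))%:R <= 24 * p%:R * M.
  rewrite natrM /N !natrM.
  have -> : 24 * p%:R * M = (2 * p%:R * (6 * (lam1 / lambda / gamma))) *
     (2 * Num.sqrt (nz%:R * d%:R * sr)) by rewrite /M; ring.
  apply: ler_pM => //; first by rewrite !mulr_ge0.
  by rewrite ler_wpM2l ?mulr_ge0 // (le_trans mkle).
have p1 : 1 <= p%:R :> R by rewrite ler1n.
have nzM : (nz + N * (l + 1))%:R <= 24 * p%:R * (nz%:R + M).
  rewrite natrD; have : nz%:R * 1 <= nz%:R * p%:R :> R by rewrite ler_wpM2l.
  have : 0 <= nz%:R * p%:R :> R by rewrite mulr_ge0.
  lra.
rewrite /pcr_time natrM natrM -/M.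
have nzM0 : 0 <= nz%:R + M by rewrite addr_ge0.
(* One logarithm comes from the bits of H, the other from the kernel exponent p; hence the power 2
   of the logarithm. *)
apply: (@le_trans _ _ (1000 * (138%:R / ln 2 * lS') * (24 * (21%:R / ln 2 * lS') * (nz%:R + M)))).
  apply: ler_pM => //; first by rewrite mulr_ge0.
    by rewrite ler_wpM2l // addn1.
  apply: le_trans nzM _; apply: ler_wpM2r => //; rewrite ler_wpM2l //.
lra.
Qed.

Theorem theorem2 (R : realType) :
  exists (prog : cmd) (cst : R -> R -> R -> seq R) (C : R) (k : nat),
  forall (n d : nat) (hd : (0 < d)%N) (hnd : (d <= n)%N)
    (A : 'M[R]_(n, d)) (lam : 'I_d -> R) (nu : 'I_d -> 'cV[R]_d)
    (hA : eigensystem A lam nu)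
    (lam1 : R) (hlam1 : lam1 = lam (Ordinal hd)) (hlam1_bounds : 2^-1 <= lam1 <= 1)
    (lambda : R) (hlambda : 0 < lambda < lam1)
    (gamma : R) (hgamma : 0 < gamma <= 2 / 3)
    (eps : R) (heps : 0 < eps < 1)
    (delta : R) (hdelta : 0 < delta < 1)
    (b : 'cV[R]_n),
  let kappa := lam1 / lambda in
  let polylog := ln (n%:R + lam1^-1 + lambda^-1 + gamma^-1
                     + eps^-1 + delta^-1) ^+ k in
  exists T : nat,
    T%:R <= C * ((nnz A)%:R
                 + Num.sqrt ((nnz A)%:R * d%:R * stable_rank A lam1)
                   * (kappa / gamma)) * polylog
    /\ approx_pcr_in_time prog (cst lambda gamma eps) A lam nu
         lambda gamma eps delta b T.
Proof.
exists pcr_cmd, (fun l g e => xget [::] [set c | precomputed l g e c]).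
exists (24 * 1000 * (138%:R / ln 2) * (21%:R / ln 2)), 2%N.
move=> n d hd hnd A lam nu hA lam1 hlam1 hb lambda hl gamma hg eps he delta hdl b kappa polylog.
have /andP[lb1 lb2] := hb; have /andP[l0 l1] := hl; have /andP[g0 g1] := hg.
have /andP[e0 e1] := he; have /andP[dl0 dl1] := hdl.
set cst := xget _ _.
have hl' : 0 < lambda < 1 by rewrite l0 (lt_le_trans l1).
have hg' : 0 < gamma < 1 by rewrite g0 /=; lra.
have : precomputed lambda gamma eps cst := xgetPex _ (exists_precomputed hl' hg' he).
case=> p [mk [r [[p0 mk0 sz] mkle pX hN [c0 ck rN rs]]]].
set N := (2 * p * mk)%N in sz hN c0 ck rN rs.
have N0 : (0 < N)%N by rewrite !muln_gt0 p0.
have lam_le1 i : lam i <= 1.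
  have [_ _ srt] := hA; apply: le_trans lb2; rewrite hlam1; exact: srt.
have n0 : (0 < n)%N by apply: leq_trans hnd.
have n1 : 1 <= n%:R :> R by rewrite ler1n.
have inv1 x : 0 < x -> x <= 1 -> 1 <= x^-1 :> R by move=> x0 x1; rewrite invf_ge1.
have T1 : 1 <= nth 0 cst 0 * n%:R ^+ 7.
  rewrite c0 -[leLHS]mulr1; apply: ler_pM => //; last by rewrite exprn_ege1.
  have : 1 <= N%:R ^+ 5 :> R by rewrite exprn_ege1 // ler1n.
  have := inv1 _ e0 (ltW e1); nra.
have [m hm] := exists_pow2 T1; have /andP[m1 m2] := hm.
rewrite c0 in m1 m2.
have m0 : (0 < m)%N.
  by case: m {m2} hm m1 => // /andP[h _] _; move: h; rewrite expr0 ltNge T1.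
have cst0 : (0 < size cst)%N by rewrite sz.
have [l [lnz ld [s' [t [B tT out]]]]] := @wp_pcr R n d A b lambda gamma eps delta cst
  (Ordinal n0) (Ordinal hd) m m0 (norm_entry_le1 hA lam_le1) cst0 hm
  (fun k kN => iterate_in_range b hA lam_le1 hd hnd N0 he m1 (leq_trans kN (eq_leq sz)))
  (fun k kN => gram_digit_in_range b hA lam_le1 hd hnd N0 he m1 (leq_trans kN (eq_leq sz))).
exists (pcr_time m (nnz A) l (size cst)); split.
  rewrite /polylog /kappa sz.
  have i1 := inv1 _ (lt_trans l0 l1) lb2.
  have i2 := inv1 _ l0 (ltW (lt_le_trans l1 lb2)).
  have i3 : 3 / 2 <= gamma^-1.
    by rewrite -[gamma^-1]mul1r ler_pdivlMr //; lra.
  have i4 := inv1 _ e0 (ltW e1); have i5 := inv1 _ dl0 (ltW dl1).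
  (* All six summands inside the logarithm are at least 1, which yields the bound 6 on their sum. *)
  apply: pcr_time_bound m2 => //; try lra.
  - by apply: (nnz_gt0 hA (i := Ordinal hd)); rewrite -hlam1; lra.
  - rewrite /stable_rank ler_pdivlMr ?mul1r; last by lra.
    by rewrite hlam1; apply: lam_le_frobenius hA _.
rewrite /approx_pcr_in_time; split; first exact: prob_halts_bigstep B tT _.
rewrite (prob_halts_bigstep B tT); first by lra.
rewrite /= out.
pose fs := iterate A (2 ^+ m) (\col_j ((A^T *m b) j 0 / \sum_j `|(A^T *m b) j 0|)).
(* At index 0 the table entry is not [r 0], but both multiply the zero vector. *)
have -> : \sum_(k < size cst) nth 0 cst k *: fs k.+1 = \sum_(k < N) r k *: fs k.+1.
  rewrite sz; apply: eq_bigr => -[[|k] kN] _ /=.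
    by rewrite /fs /iterate /= !scaler0.
  by rewrite ck.
exact: (pcr_success_iterate b hA lam_le1 hd hnd N0 he m1 erefl hl' hg' p0 mk0 hN rN rs).
Qed.
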